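(* Let $d,n$ be positive integers and let $\mu\in{\rm Comp}_d(n)$. The map $$\Psi_\mu:E_\mu{\rm Y}_{d,n}(q)\to{\rm Mat}_{m_\mu}(\mathcal{H}^\mu(q)),\qquad \Psi_\mu(E_\mu a):=U_\mu\widetilde{\Psi}_\mu(E_\mu a)U_\mu^{-1}\quad\text{for all }a\in{\rm Y}_{d,n}(q),$$ is an isomorphism of $\mathbb{C}[q,q^{-1}]$-algebras. Its inverse is the map $$\Phi_\mu:{\rm Mat}_{m_\mu}(\mathcal{H}^\mu(q))\to E_\mu{\rm Y}_{d,n}(q),\qquad \Phi_\mu(A):=\widetilde{\Phi}_\mu(U_\mu^{-1}AU_\mu)\quad\text{for all }A\in{\rm Mat}_{m_\mu}(\mathcal{H}^\mu(q)).$$ As a consequence, the map $$\Psi_n:=\bigoplus_{\mu\in{\rm Comp}_d(n)}\Psi_\mu:{\rm Y}_{d,n}(q)\to\bigoplus_{\mu\in{\rm Comp}_d(n)}{\rm Mat}_{m_\mu}(\mathcal{H}^\mu(q))$$ is also an isomorphism of $\mathbb{C}[q,q^{-1}]$-algebras, with inverse map $\Phi_n:=\bigoplus_{\mu\in{\rm Comp}_d(n)}\Phi_\mu$. Here ${\rm Y}_{d,n}(q)$ and $\mathcal{H}^\mu(q)$ are the algebras over $\mathbb{C}[q,q^{-1}]$ (not $\mathbb{C}[q^{1/2},q^{-1/2}]$), viewed inside their scalar extensions to $\mathbb{C}[q^{1/2},q^{-1/2}]$.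
   Context: Let $q$ be an indeterminate. The Yokonuma--Hecke algebra ${\rm Y}_{d,n}(q)$ is the associative unital $\mathbb{C}[q,q^{-1}]$-algebra generated by $g_1,\dots,g_{n-1},t_1,\dots,t_n$ with relations: $g_ig_j=g_jg_i$ if $|i-j|>1$; $g_ig_{i+1}g_i=g_{i+1}g_ig_{i+1}$ for $1\le i\le n-2$; $t_it_j=t_jt_i$; $t_jg_i=g_it_{s_i(j)}$ where $s_i=(i,i+1)\in\mathfrak{S}_n$; $t_j^d=1$; and $g_i^2=q+(q-1)e_ig_i$, where $e_i=\frac1d\sum_{s=0}^{d-1}t_i^st_{i+1}^{-s}$. For $w\in\mathfrak{S}_n$ with reduced expression $s_{i_1}\cdots s_{i_r}$, $g_w:=g_{i_1}\cdots g_{i_r}$. Let $\ell$ be the length function on $\mathfrak{S}_n$. The Iwahori--Hecke algebra $\mathcal{H}_n(q)$ is the $\mathbb{C}[q,q^{-1}]$-algebra generated by $G_1,\dots,G_{n-1}$ with the braid relations $G_iG_j=G_jG_i$ ($|i-j|>1$), $G_iG_{i+1}G_i=G_{i+1}G_iG_{i+1}$, and $G_i^2=q+(q-1)G_i$; it is free with basis $G_w:=G_{i_1}\cdots G_{i_r}$, $w\in\mathfrak{S}_n$. ${\rm Comp}_d(n)$ is the set of $d$-tuples $\mu=(\mu_1,\dots,\mu_d)$ of non-negative integers with sum $n$. For such $\mu$, let $\mathfrak{S}_\mu=\mathfrak{S}_{\mu_1}\times\cdots\times\mathfrak{S}_{\mu_d}$ be the Young subgroup of $\mathfrak{S}_n$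 ($\mathfrak{S}_{\mu_1}$ acting on $\{1,\dots,\mu_1\}$, $\mathfrak{S}_{\mu_2}$ on $\{\mu_1+1,\dots,\mu_1+\mu_2\}$, etc.), generated by the $s_j$ with $j\in J^\mu:=\{1,\dots,n-1\}\setminus\{\mu_1,\mu_1+\mu_2,\dots,\mu_1+\cdots+\mu_{d-1}\}$. $\mathcal{H}^\mu(q)$ is the subalgebra of $\mathcal{H}_n(q)$ generated by $\{G_j\mid j\in J^\mu\}$, with basis $\{G_w\mid w\in\mathfrak{S}_\mu\}$. Let $\{\xi_1,\dots,\xi_d\}$ be the $d$-th roots of unity in $\mathbb{C}$ (ordered arbitrarily), and let $\mathcal{A}_{d,n}\cong(\mathbb{Z}/d\mathbb{Z})^n$ be the group generated by $t_1,\dots,t_n$. For an irreducible character $\chi$ of $\mathcal{A}_{d,n}$ let $E_\chi:=\prod_{j=1}^n\bigl(\frac1d\sum_{s=0}^{d-1}\chi(t_j)^st_j^{-s}\bigr)$. $\mathfrak{S}_n$ acts on characters by $w(\chi)(t_j)=\chi(t_{w^{-1}(j)})$. Let $\chi_1^\mu$ be the character with $\chi_1^\mu(t_j)=\xi_i$ for $\mu_1+\cdots+\mu_{i-1}<j\le\mu_1+\cdots+\mu_i$; its stabiliser is $\mathfrak{S}_\mu$. Let $\pi_{\mu,1}=1,\pi_{\mu,2},\dots,\pi_{\mu,m_\mu}$, $m_\mu=\frac{n!}{\mu_1!\cdots\mu_d!}$, be the minimal length representatives of the left cosets $\mathfrak{S}_n/\mathfrak{S}_\mu$, and $\chi_k^\mu:=\pi_{\mu,k}(\chi_1^\mu)$.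 Put $E_\mu:=\sum_{k=1}^{m_\mu}E_{\chi_k^\mu}$. The $E_\mu$ ($\mu\in{\rm Comp}_d(n)$) form a complete set of central orthogonal idempotents of ${\rm Y}_{d,n}(q)$, so ${\rm Y}_{d,n}(q)=\bigoplus_\mu E_\mu{\rm Y}_{d,n}(q)$. Let $M_{k,l}$ denote the elementary $m_\mu\times m_\mu$ matrix with $1$ in position $(k,l)$. After extension of scalars to $\mathbb{C}[q^{1/2},q^{-1/2}]$, define $\mathbb{C}[q^{1/2},q^{-1/2}]$-linear maps: $\widetilde{\Psi}_\mu:E_\mu{\rm Y}_{d,n}(q)\to{\rm Mat}_{m_\mu}(\mathcal{H}^\mu(q))$ by $\widetilde{\Psi}_\mu(E_{\chi_k^\mu}g_w):=q^{\frac12(\ell(w)-\ell(\pi_{\mu,k}^{-1}w\pi_{\mu,l}))}G_{\pi_{\mu,k}^{-1}w\pi_{\mu,l}}M_{k,l}$ for $1\le k\le m_\mu$, $w\in\mathfrak{S}_n$, where $l$ is uniquely determined by $w(\chi_l^\mu)=\chi_k^\mu$ (then $\pi_{\mu,k}^{-1}w\pi_{\mu,l}\in\mathfrak{S}_\mu$); and $\widetilde{\Phi}_\mu:{\rm Mat}_{m_\mu}(\mathcal{H}^\mu(q))\to E_\mu{\rm Y}_{d,n}(q)$ by $\widetilde{\Phi}_\mu(G_wM_{k,l}):=q^{\frac12(\ell(w)-\ell(\pi_{\mu,k}w\pi_{\mu,l}^{-1}))}E_{\chi_k^\mu}g_{\pi_{\mu,k}w\pi_{\mu,l}^{-1}}E_{\chi_l^\mu}$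 for $1\le k,l\le m_\mu$, $w\in\mathfrak{S}_\mu$. It is known (Jacon--Poulain d'Andecy) that $\widetilde{\Psi}_\mu$ is an isomorphism of $\mathbb{C}[q^{1/2},q^{-1/2}]$-algebras with inverse $\widetilde{\Phi}_\mu$. Finally, $U_\mu:=\sum_{k=1}^{m_\mu}q^{\ell(\pi_{\mu,k})/2}M_{k,k}$. *)

(* Defs.v *)
From HB Require Import structures.
From mathcomp Require Import all_boot all_order all_algebra all_fingroup.
From mathcomp Require Import boolp classical_sets reals.
From mathcomp Require Import generic_quotient complex.

Set Implicit Arguments.
Unset Strict Implicit.
Unset Printing Implicit Defensive.

Import Order.TTheory GRing.Theory Num.Theory.
Local Open Scope ring_scope.
Local Open Scope quotient_scope.

(* F[q, q^-1] is the subring of F(q) of the fractions p / q^n *)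

Section Laurent.
Variable F : fieldType.
Local Notation "x %:F" := (FracField.tofrac x).
Local Notation X := (('X : {poly F})%:F).

Definition laurent_pred : {pred {fraction {poly F}}} :=
  fun x => `[< exists pn : {poly F} * nat, x = pn.1%:F / X ^+ pn.2 >].

Lemma fracX_neq0 : X != 0.
Proof. by rewrite tofrac_eq0 polyX_eq0. Qed.

Lemma fracXn_neq0 n : X ^+ n != 0.
Proof. by rewrite expf_neq0 // fracX_neq0. Qed.

Lemma laurent_subring : subring_closed laurent_pred.
Proof.
split.
- apply/asboolP; exists (1, 0%N).
  by rewrite /= tofrac1 expr0 divr1.
- move=> _ _ /asboolP[[p n] ->] /asboolP[[p' n'] ->] /=.
  apply/asboolP; exists (p * 'X^n' - p' * 'X^n, (n + n')%N) => /=.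
  rewrite tofracB !tofracM !tofracXn exprD.
  by rewrite -mulNr (addf_div _ _ (fracXn_neq0 n) (fracXn_neq0 n')) mulNr.
- move=> _ _ /asboolP[[p n] ->] /asboolP[[p' n'] ->] /=.
  apply/asboolP; exists (p * p', (n + n')%N) => /=.
  by rewrite tofracM exprD mulf_div.
Qed.

HB.instance Definition _ :=
  GRing.isSubringClosed.Build _ laurent_pred laurent_subring.

Record laurent := Laurent { lval : {fraction {poly F}}; _ : lval \in laurent_pred }.

HB.instance Definition _ := [isSub for lval].
HB.instance Definition _ := [Choice of laurent by <:].
HB.instance Definition _ := [SubChoice_isSubComNzRing of laurent by <:].

Lemma laurent_const_subproof (c : F) : (c%:P)%:F \in laurent_pred.
Proof. by apply/asboolP; exists (c%:P, 0%N); rewrite /= expr0 divr1. Qed.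

Definition lconst (c : F) : laurent := Laurent (laurent_const_subproof c).

Lemma laurent_mon_subproof (z : int) : X ^ z \in laurent_pred.
Proof.
apply/asboolP; case: z => n.
  by exists ('X^n, 0%N); rewrite /= expr0 divr1 tofracXn.
by exists (1, n.+1); rewrite /= tofrac1 div1r.
Qed.

(* the monomial q^z, z any integer *)
Definition lmon (z : int) : laurent := Laurent (laurent_mon_subproof z).

Lemma lmonD z z' : lmon (z + z') = lmon z * lmon z'.
Proof. by apply: val_inj; rewrite /= expfzDr // fracX_neq0. Qed.

Lemma lmon0 : lmon 0 = 1.
Proof. by apply: val_inj. Qed.

Lemma lval_ex (x : laurent) :
  exists pn : {poly F} * nat, lval x = pn.1%:F / X ^+ pn.2.
Proof. by apply/asboolP; exact: (valP x). Qed.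

(* the substitution q := v^2, i.e. the inclusion of F[q, q^-1] in             *)
(* F[q^(1/2), q^(-1/2)] when v stands for q^(1/2)                             *)
Lemma lsquare_subproof (x : laurent) :
  ((sval (cid (lval_ex x))).1 \Po 'X^2)%:F / X ^+ (sval (cid (lval_ex x))).2.*2
    \in laurent_pred.
Proof.
move: (sval _) => pn; apply/asboolP.
by exists (pn.1 \Po 'X^2, pn.2.*2).
Qed.

Definition lsquare (x : laurent) : laurent := Laurent (lsquare_subproof x).

Lemma lsquareE x p n : lval x = p%:F / X ^+ n ->
  lval (lsquare x) = (p \Po 'X^2)%:F / X ^+ n.*2.
Proof.
move=> xE; rewrite /lsquare /=; case: (cid _) => -[p' n'] /= x'E.
have pE : p' * 'X^n = p * 'X^n'.
  have /eqP : p'%:F / X ^+ n' = p%:F / X ^+ n by rewrite -xE -x'E.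
  by rewrite eqr_div ?fracXn_neq0 // -!tofracXn -!tofracM tofrac_eq => /eqP.
apply/eqP; rewrite eqr_div ?fracXn_neq0 // -!tofracXn -!tofracM tofrac_eq.
have XE m : 'X^(m.*2) = ('X^m \Po 'X^2) :> {poly F}.
  by rewrite comp_Xn_poly -exprM mul2n.
by rewrite !XE -!comp_polyM pE.
Qed.

Lemma lvalB (x y : laurent) : lval (x - y) = lval x - lval y.
Proof. exact: (raddfB (val : laurent -> _)). Qed.

Lemma lvalM (x y : laurent) : lval (x * y) = lval x * lval y.
Proof. exact: (rmorphM (val : laurent -> _)). Qed.

Lemma lsquare_zmod : zmod_morphism lsquare.
Proof.
move=> x y; apply: val_inj.
change (lval (lsquare (x - y)) = lval (lsquare x - lsquare y)); rewrite [RHS]lvalB.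
have [[p n] xE] := lval_ex x; have [[p' n'] yE] := lval_ex y.
rewrite (lsquareE xE) (lsquareE yE).
have /lsquareE-> : lval (x - y) = (p * 'X^n' - p' * 'X^n)%:F / X ^+ (n + n').
  rewrite lvalB xE yE tofracB !tofracM !tofracXn exprD.
  by rewrite -!mulNr (addf_div _ _ (fracXn_neq0 n) (fracXn_neq0 n')).
rewrite -[in RHS]mulNr (addf_div _ _ (fracXn_neq0 _) (fracXn_neq0 _)) doubleD exprD.
by rewrite comp_polyB !comp_polyM !comp_Xn_poly -!exprM !mul2n tofracB !tofracM
  !tofracXn mulNr.
Qed.

Lemma lsquare_monoid : monoid_morphism lsquare.
Proof.
split=> [|x y]; apply: val_inj.
  change (lval (lsquare 1) = lval 1).
  have lval1 : lval 1 = (1 : {poly F})%:F / X ^+ 0 by rewrite expr0 divr1 tofrac1.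
  by rewrite (lsquareE lval1) lval1 -[1]/(1%:P) comp_polyC.
change (lval (lsquare (x * y)) = lval (lsquare x * lsquare y)); rewrite [RHS]lvalM.
have [[p n] xE] := lval_ex x; have [[p' n'] yE] := lval_ex y.
rewrite (lsquareE xE) (lsquareE yE).
have /lsquareE-> : lval (x * y) = (p * p')%:F / X ^+ (n + n').
  by rewrite lvalM xE yE tofracM exprD mulf_div.
by rewrite comp_polyM tofracM doubleD exprD mulf_div.
Qed.

HB.instance Definition _ :=
  GRing.isZmodMorphism.Build laurent laurent lsquare lsquare_zmod.
HB.instance Definition _ :=
  GRing.isMonoidMorphism.Build laurent laurent lsquare lsquare_monoid.

Lemma lsquare_mon : lsquare (lmon 1) = lmon 2.
Proof.
apply: val_inj; rewrite -[LHS]/(lval (lsquare _)).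
have /lsquareE-> : lval (lmon 1) = ('X : {poly F})%:F / X ^+ 0.
  by rewrite expr0 divr1.
by rewrite comp_polyX expr0 divr1 tofracXn.
Qed.

Lemma lsquare_const c : lsquare (lconst c) = lconst c.
Proof.
apply: val_inj; rewrite -[LHS]/(lval (lsquare _)).
have /lsquareE-> : lval (lconst c) = (c%:P)%:F / X ^+ 0.
  by rewrite expr0 divr1.
by rewrite comp_polyC expr0 divr1.
Qed.

End Laurent.

(* The relations are a predicate on the families indexed by the generators in *)
(* an arbitrary algebra; a family satisfying it is called a model below.  The *)
(* consistency field makes the presented algebra nonzero, as algType demands. *)
Record presentation (R : comNzRingType) := Presentation {
  gens : Type;
  rels : forall B : algType R, (gens -> B) -> Prop;
  consistent : exists (B : algType R) (f : gens -> B), rels f }.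
Arguments Presentation {R gens}.

Inductive term (R X : Type) :=
| TGen of X
| TOne
| TAdd of term R X & term R X
| TMul of term R X & term R X
| TScale of R & term R X.
Arguments TGen {R X}.
Arguments TOne {R X}.

HB.instance Definition _ R X := gen_eqMixin (term R X).
HB.instance Definition _ R X := gen_choiceMixin (term R X).

Fixpoint teval (R : comNzRingType) X (B : algType R) (f : X -> B) (u : term R X) : B :=
  match u with
  | TGen x => f x
  | TOne => 1
  | TAdd u1 u2 => teval f u1 + teval f u2
  | TMul u1 u2 => teval f u1 * teval f u2
  | TScale a u1 => a *: teval f u1
  end.

Section Presented.
Variables (R : comNzRingType) (P : presentation R).
Local Notation T := (term R (gens P)).

(* two terms are identified when they agree in all models *)
Definition term_equiv (u v : T) : bool :=
  `[< forall (B : algType R) (f : gens P -> B), rels f -> teval f u = teval f v >].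

Lemma term_equiv_refl : reflexive term_equiv.
Proof. by move=> u; apply/asboolP. Qed.

Lemma term_equiv_sym : symmetric term_equiv.
Proof.
by move=> u v; apply/asboolP/asboolP => E B f /E ->.
Qed.

Lemma term_equiv_trans : transitive term_equiv.
Proof.
move=> v u w /asboolP uv /asboolP vw; apply/asboolP => B f fP.
by rewrite uv // vw.
Qed.

Canonical term_equivRel :=
  EquivRel term_equiv term_equiv_refl term_equiv_sym term_equiv_trans.

Definition presented : Type := {eq_quot term_equivRel}.
HB.instance Definition _ := Choice.on presented.
HB.instance Definition _ := EqQuotient.on presented.

Definition pres_class (u : T) : presented := \pi_presented u.
Definition pres_gen (x : gens P) : presented := pres_class (TGen x).

(* the value of an element of the presented algebra in a model *)
Definition pres_eval (B : algType R) (f : gens P -> B) (x : presented) : B :=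
  teval f (repr x).

Lemma pres_eval_class (B : algType R) (f : gens P -> B) u :
  rels f -> pres_eval f (pres_class u) = teval f u.
Proof.
move=> fP; rewrite /pres_eval.
have : term_equivRel (repr (pres_class u)) u.
  by apply/eqmodP; rewrite reprK.
by move=> /asboolP; apply.
Qed.

Lemma pres_ext (x y : presented) :
  (forall (B : algType R) (f : gens P -> B), rels f -> pres_eval f x = pres_eval f y) ->
  x = y.
Proof.
move=> E; rewrite -[x]reprK -[y]reprK; apply/eqmodP/asboolP => B f fP.
exact: E.
Qed.

Let zero := pres_class (TScale 0 TOne).
Let one := pres_class TOne.
Let opp (x : presented) := pres_class (TScale (-1) (repr x)).
Let add (x y : presented) := pres_class (TAdd (repr x) (repr y)).
Let mul (x y : presented) := pres_class (TMul (repr x) (repr y)).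
Let scale (a : R) (x : presented) := pres_class (TScale a (repr x)).

Section Eval.
Variables (B : algType R) (f : gens P -> B).
Hypothesis fP : rels f.
Let ev0 : pres_eval f zero = 0.
Proof. by rewrite pres_eval_class //= scale0r. Qed.
Let ev1 : pres_eval f one = 1.
Proof. by rewrite pres_eval_class. Qed.
Let evN x : pres_eval f (opp x) = - pres_eval f x.
Proof. by rewrite pres_eval_class //= scaleN1r. Qed.
Let evD x y : pres_eval f (add x y) = pres_eval f x + pres_eval f y.
Proof. by rewrite pres_eval_class. Qed.
Let evM x y : pres_eval f (mul x y) = pres_eval f x * pres_eval f y.
Proof. by rewrite pres_eval_class. Qed.
Let evZ a x : pres_eval f (scale a x) = a *: pres_eval f x.
Proof. by rewrite pres_eval_class. Qed.
Definition pres_evE := (ev0, ev1, evN, evD, evM, evZ).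
End Eval.

Lemma pres_addA : associative add.
Proof. by move=> x y z; apply: pres_ext => B f fP; rewrite !(pres_evE fP) addrA. Qed.
Lemma pres_addC : commutative add.
Proof. by move=> x y; apply: pres_ext => B f fP; rewrite !(pres_evE fP) addrC. Qed.
Lemma pres_add0 : left_id zero add.
Proof. by move=> x; apply: pres_ext => B f fP; rewrite !(pres_evE fP) add0r. Qed.
Lemma pres_addN : left_inverse zero opp add.
Proof. by move=> x; apply: pres_ext => B f fP; rewrite !(pres_evE fP) addNr. Qed.

HB.instance Definition _ :=
  GRing.isZmodule.Build presented pres_addA pres_addC pres_add0 pres_addN.

Lemma pres_mulA : associative mul.
Proof. by move=> x y z; apply: pres_ext => B f fP; rewrite !(pres_evE fP) mulrA. Qed.
Lemma pres_mul1 : left_id one mul.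
Proof. by move=> x; apply: pres_ext => B f fP; rewrite !(pres_evE fP) mul1r. Qed.
Lemma pres_mulr1 : right_id one mul.
Proof. by move=> x; apply: pres_ext => B f fP; rewrite !(pres_evE fP) mulr1. Qed.
Lemma pres_mulDl : left_distributive mul add.
Proof. by move=> x y z; apply: pres_ext => B f fP; rewrite !(pres_evE fP) mulrDl. Qed.
Lemma pres_mulDr : right_distributive mul add.
Proof. by move=> x y z; apply: pres_ext => B f fP; rewrite !(pres_evE fP) mulrDr. Qed.
Lemma pres_1neq0 : one != zero.
Proof.
apply/eqP => E; have [B [f fP]] := consistent P.
by have /eqP := congr1 (pres_eval f) E; rewrite !(pres_evE fP) oner_eq0.
Qed.

HB.instance Definition _ := GRing.Zmodule_isNzRing.Build presented
  pres_mulA pres_mul1 pres_mulr1 pres_mulDl pres_mulDr pres_1neq0.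

Lemma pres_scaleA a b x : scale a (scale b x) = scale (a * b) x.
Proof. by apply: pres_ext => B f fP; rewrite !(pres_evE fP) scalerA. Qed.
Lemma pres_scale1 : left_id 1 scale.
Proof. by move=> x; apply: pres_ext => B f fP; rewrite !(pres_evE fP) scale1r. Qed.
Lemma pres_scaleDr : right_distributive scale add.
Proof. by move=> a x y; apply: pres_ext => B f fP; rewrite !(pres_evE fP) scalerDr. Qed.
Lemma pres_scaleDl x a b : scale (a + b) x = add (scale a x) (scale b x).
Proof. by apply: pres_ext => B f fP; rewrite !(pres_evE fP) scalerDl. Qed.

HB.instance Definition _ := GRing.Zmodule_isLmodule.Build R presented
  pres_scaleA pres_scale1 pres_scaleDr pres_scaleDl.

Lemma pres_scaleAl a x y : scale a (mul x y) = mul (scale a x) y.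
Proof. by apply: pres_ext => B f fP; rewrite !(pres_evE fP) scalerAl. Qed.

HB.instance Definition _ := GRing.Lmodule_isLalgebra.Build R presented pres_scaleAl.

Lemma pres_scaleAr a x y : scale a (mul x y) = mul x (scale a y).
Proof. by apply: pres_ext => B f fP; rewrite !(pres_evE fP) scalerAr. Qed.

HB.instance Definition _ := GRing.Lalgebra_isAlgebra.Build R presented pres_scaleAr.

Section Universal.
Variables (B : algType R) (f : gens P -> B).
Hypothesis fP : rels f.

Lemma pres_evalD : {morph pres_eval f : x y / x + y}.
Proof. by move=> x y; exact: pres_eval_class. Qed.
Lemma pres_evalM : {morph pres_eval f : x y / x * y}.
Proof. by move=> x y; exact: pres_eval_class. Qed.
Lemma pres_eval1 : pres_eval f 1 = 1.
Proof. exact: pres_eval_class. Qed.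
Lemma pres_evalZ a : {morph pres_eval f : x / a *: x}.
Proof. by move=> x; exact: pres_eval_class. Qed.
Lemma pres_eval_gen x : pres_eval f (pres_gen x) = f x.
Proof. exact: pres_eval_class. Qed.

Lemma pres_eval0 : pres_eval f 0 = 0.
Proof. by rewrite -[0 in LHS](scale0r 0) pres_evalZ scale0r. Qed.
Lemma pres_eval_sum I r (p : pred I) (F : I -> presented) :
  pres_eval f (\sum_(i <- r | p i) F i) = \sum_(i <- r | p i) pres_eval f (F i).
Proof. exact: (big_morph _ pres_evalD pres_eval0). Qed.
Lemma pres_evalX k : {morph pres_eval f : x / x ^+ k}.
Proof.
by move=> x; elim: k => [|k IH]; rewrite ?expr0 ?pres_eval1 // !exprS pres_evalM IH.
Qed.
End Universal.

Lemma pres_ind (S : presented -> Prop) :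
  (forall x, S (pres_gen x)) -> S 1 ->
  (forall x y, S x -> S y -> S (x + y)) -> (forall x y, S x -> S y -> S (x * y)) ->
  (forall a x, S x -> S (a *: x)) -> forall x, S x.
Proof.
move=> Sg S1 SD SM SZ x; rewrite -[x]reprK -/(pres_class _).
elim: (repr x) => [y||u Su v Sv|u Su v Sv|a u Su].
- exact: Sg.
- exact: S1.
- suff -> : pres_class (TAdd u v) = pres_class u + pres_class v by exact: SD.
  by apply: pres_ext => B f fP; rewrite pres_evalD // !pres_eval_class.
- suff -> : pres_class (TMul u v) = pres_class u * pres_class v by exact: SM.
  by apply: pres_ext => B f fP; rewrite pres_evalM // !pres_eval_class.
- suff -> : pres_class (TScale a u) = a *: pres_class u by exact: SZ.
  by apply: pres_ext => B f fP; rewrite pres_evalZ // !pres_eval_class.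
Qed.

End Presented.

Section Subalgebra.
Variables (R : comNzRingType) (B : algType R) (G : set B).

Definition subalg_pred : {pred B} := fun x =>
  `[< forall S : {pred B}, GRing.subalg_closed S -> (forall y, G y -> y \in S) -> x \in S >].

Lemma subalg_pred_closed : GRing.subalg_closed subalg_pred.
Proof.
split.
- by apply/asboolP => S [S1 _ _].
- move=> a u v /asboolP Su /asboolP Sv; apply/asboolP => S SP GS.
  by have [_ SD _] := SP; apply: SD; [exact: Su|exact: Sv].
- move=> u v /asboolP Su /asboolP Sv; apply/asboolP => S SP GS.
  by have [_ _ SM] := SP; apply: SM; [exact: Su|exact: Sv].
Qed.

HB.instance Definition _ := GRing.isSubalgClosed.Build R B subalg_pred subalg_pred_closed.

Record subalg := Subalg { subalg_val : B; _ : subalg_val \in subalg_pred }.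

HB.instance Definition _ := [isSub for subalg_val].
HB.instance Definition _ := [Choice of subalg by <:].
HB.instance Definition _ := [SubChoice_isSubAlgebra of subalg by <:].

End Subalgebra.

Section ScalarExtension.
Variables (R R' : comNzRingType) (phi : {rmorphism R -> R'}).

Definition semilinear_rels (B : algType R) (D : algType R') (f : B -> D) : Prop :=
  [/\ f 1 = 1, {morph f : x y / x + y}, {morph f : x y / x * y} &
      forall a x, f (a *: x) = phi a *: f x].

Definition scext_pres (B : algType R)
    (h : exists (D : algType R') (f : B -> D), semilinear_rels f) : presentation R' :=
  Presentation (@semilinear_rels B) h.

(* R' (x)_R B, presented by the elements 1 (x) b and the relations saying that *)
(* b |-> 1 (x) b is a phi-semilinear ring morphism; h only witnesses that the  *)
(* result is not the zero ring                                                *)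
Definition scalar_ext (B : algType R)
    (h : exists (D : algType R') (f : B -> D), semilinear_rels f) : algType R' :=
  presented (scext_pres h).

Definition scext_in (B : algType R)
    (h : exists (D : algType R') (f : B -> D), semilinear_rels f) (x : B) :
    scalar_ext h :=
  pres_gen (P := scext_pres h) x.

Lemma scext_in_rels (B : algType R)
    (h : exists (D : algType R') (f : B -> D), semilinear_rels f) :
  semilinear_rels (scext_in h).
Proof.
split=> [|x y|x y|a x]; apply: pres_ext => D f fP; have [f1 fD fM fZ] := fP.
- by rewrite pres_eval1 // pres_eval_gen.
- by rewrite pres_evalD // !pres_eval_gen.
- by rewrite pres_evalM // !pres_eval_gen.
- by rewrite pres_evalZ // !pres_eval_gen.
Qed.

End ScalarExtension.

Section ProductRing.
Variables (I : Type) (D : I -> pzRingType).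

Definition prod_ring : Type := forall i, D i.

HB.instance Definition _ := gen_eqMixin prod_ring.
HB.instance Definition _ := gen_choiceMixin prod_ring.

Let add (x y : prod_ring) : prod_ring := fun i => x i + y i.
Let opp (x : prod_ring) : prod_ring := fun i => - x i.
Let mul (x y : prod_ring) : prod_ring := fun i => x i * y i.

Fact prod_ring_addA : associative add.
Proof. by move=> x y z; apply: functional_extensionality_dep => i; exact: addrA. Qed.
Fact prod_ring_addC : commutative add.
Proof. by move=> x y; apply: functional_extensionality_dep => i; exact: addrC. Qed.
Fact prod_ring_add0 : left_id (fun=> 0) add.
Proof. by move=> x; apply: functional_extensionality_dep => i; exact: add0r. Qed.
Fact prod_ring_addN : left_inverse (fun=> 0) opp add.
Proof. by move=> x; apply: functional_extensionality_dep => i; exact: addNr. Qed.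

HB.instance Definition _ := GRing.isZmodule.Build prod_ring
  prod_ring_addA prod_ring_addC prod_ring_add0 prod_ring_addN.

Fact prod_ring_mulA : associative mul.
Proof. by move=> x y z; apply: functional_extensionality_dep => i; exact: mulrA. Qed.
Fact prod_ring_mul1 : left_id (fun=> 1) mul.
Proof. by move=> x; apply: functional_extensionality_dep => i; exact: mul1r. Qed.
Fact prod_ring_mulr1 : right_id (fun=> 1) mul.
Proof. by move=> x; apply: functional_extensionality_dep => i; exact: mulr1. Qed.
Fact prod_ring_mulDl : left_distributive mul add.
Proof. by move=> x y z; apply: functional_extensionality_dep => i; exact: mulrDl. Qed.
Fact prod_ring_mulDr : right_distributive mul add.
Proof. by move=> x y z; apply: functional_extensionality_dep => i; exact: mulrDr. Qed.

HB.instance Definition _ := GRing.Zmodule_isPzRing.Build prod_ring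
  prod_ring_mulA prod_ring_mul1 prod_ring_mulr1 prod_ring_mulDl prod_ring_mulDr.

End ProductRing.

Definition corner (R : comNzRingType) (B : algType R) (e : B) : set B :=
  [set e * a | a in [set: B]]%classic.

(* f : e B -> D is an isomorphism of R-algebras with inverse g, where e is the *)
(* unit of e B and sc is the action of R on D; f may take any value outside    *)
(* e B                                                                        *)
Record corner_alg_iso (R : comNzRingType) (B : algType R) (e : B)
    (D : pzRingType) (sc : R -> D -> D) (f : B -> D) (g : D -> B) : Prop := {
  cisoD : forall x y, corner e x -> corner e y -> f (x + y) = f x + f y;
  cisoZ : forall c x, corner e x -> f (c *: x) = sc c (f x);
  cisoM : forall x y, corner e x -> corner e y -> f (x * y) = f x * f y;
  ciso1 : f e = 1;
  ciso_range : forall z, corner e (g z);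
  cisoK : forall x, corner e x -> g (f x) = x;
  cisoVK : forall z, f (g z) = z }.

(* the action of R on matrices over an R-algebra *)
Definition scmx (R : comNzRingType) (B : algType R) m (c : R) (M : 'M[B]_m) : 'M[B]_m :=
  map_mx (fun x => c *: x) M.

(* The symmetric group.  The letters 1..n of the usual notation are 0..n-1,   *)
(* and the generator of index i : 'I_n.-1 is s_(i+1) in the usual notation    *)

Section Symmetric.
Variable n : nat.

Fact lo_subproof (i : 'I_n.-1) : (i < n)%N.
Proof. by case: n i => [[] //|m] i /=; apply: leqW. Qed.
Fact hi_subproof (i : 'I_n.-1) : (i.+1 < n)%N.
Proof. by case: n i => [[] //|m] i /=; rewrite ltnS. Qed.
Definition lo (i : 'I_n.-1) : 'I_n := Ordinal (lo_subproof i).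
Definition hi (i : 'I_n.-1) : 'I_n := Ordinal (hi_subproof i).

Definition adj (i : 'I_n.-1) : 'S_n := tperm (lo i) (hi i).

(* the product of permutations composed as functions, (u v)(j) = u(v(j)); the *)
(* group law of 'S_n is the opposite one                                      *)
Definition pmul (u v : 'S_n) : 'S_n := (v * u)%g.

Lemma pmulE u v j : pmul u v j = u (v j).
Proof. exact: permM. Qed.

Definition word_perm (s : seq 'I_n.-1) : 'S_n :=
  foldr (fun i u => pmul (adj i) u) 1%g s.

Lemma word_perm_cat s t : word_perm (s ++ t) = pmul (word_perm s) (word_perm t).
Proof.
by elim: s => [|i s IH] /=; rewrite /pmul ?mulg1 // IH /pmul mulgA.
Qed.

Lemma word_perm_surj (w : 'S_n) : exists s, word_perm s = w.
Proof.
have tpw k : forall x y : 'I_n, y = (x + k.+1)%N :> nat ->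
    exists s, word_perm s = tperm x y.
  elim: k => [|k IH] x y yE.
    have xn : (x < n.-1)%N by have := ltn_ord y; rewrite yE addn1 ltn_predRL.
    exists [:: Ordinal xn]; rewrite /= /pmul mul1g /adj.
    by congr tperm; apply: val_inj; rewrite /= ?yE ?addn1.
  have zn : (x + k.+1 < n)%N by have := ltn_ord y; rewrite yE addnS; exact: ltnW.
  have [s sE] := IH x (Ordinal zn) (erefl _).
  have zn' : (x + k.+1 < n.-1)%N by have := ltn_ord y; rewrite yE addnS ltn_predRL.
  pose i : 'I_n.-1 := Ordinal zn'.
  exists (i :: s ++ [:: i]); rewrite /= word_perm_cat sE /= /pmul mul1g /adj.
  have loE : lo i = Ordinal zn by apply: val_inj.
  have hiE : hi i = y by apply: val_inj; rewrite /= yE !addnS.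
  rewrite loE hiE.
  have cE (a b : 'I_n) (c : 'S_n) : (tperm a b * c * tperm a b = c ^ tperm a b)%g.
    by rewrite /conjg tpermV mulgA.
  by rewrite cE tpermJ tpermL tpermD // -val_eqE /= ?yE -[X in _ == X]addn0 eqn_add2l.
have tpw' x y : exists s, word_perm s = tperm x y.
  case: (ltngtP x y) => xy.
  - by apply: (tpw (y - x.+1)%N); rewrite addnS -addSn subnKC.
  - by rewrite tpermC; apply: (tpw (x - y.+1)%N); rewrite addnS -addSn subnKC.
  - by exists [::]; rewrite (val_inj xy) tperm1.
have [ts -> _] := prod_tpermP w.
elim: ts => [|[x y] ts [s sE]]; first by exists [::]; rewrite big_nil.
have [s' s'E] := tpw' x y.
by exists (s ++ s'); rewrite big_cons word_perm_cat sE s'E.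
Qed.

Lemma word_perm_tuple (w : 'S_n) :
  exists k, [exists t : k.-tuple 'I_n.-1, word_perm t == w].
Proof.
have [s sE] := word_perm_surj w.
by exists (size s); apply/existsP; exists (in_tuple s); rewrite /= sE.
Qed.

Definition ell (w : 'S_n) : nat := ex_minn (word_perm_tuple w).

Lemma redword_ex w : exists t : (ell w).-tuple 'I_n.-1, word_perm t == w.
Proof. by rewrite /ell; case: ex_minnP => k /existsP. Qed.

Definition redword (w : 'S_n) : seq 'I_n.-1 := xchoose (redword_ex w).

End Symmetric.

Section Algebras.
Variables (C : fieldType) (d n : nat).
Local Notation A := (laurent C).
Local Notation q := (lmon C 1).

(* e_i for x = t_i and y = t_(i+1); y^(-s) is written y^(d-s), as y^d = 1 *)
Definition e_elt (B : algType A) (x y : B) : B :=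
  lconst d%:R^-1 *: \sum_(s < d) x ^+ s * y ^+ (d - s).

Record yh_rels (B : algType A) (g : 'I_n.-1 -> B) (t : 'I_n -> B) : Prop := {
  yh_gg : forall i j : 'I_n.-1, (i.+1 < j)%N || (j.+1 < i)%N -> g i * g j = g j * g i;
  yh_ggg : forall i j : 'I_n.-1, j = i.+1 :> nat -> g i * g j * g i = g j * g i * g j;
  yh_tt : forall i j, t i * t j = t j * t i;
  yh_tg : forall i j, t j * g i = g i * t (adj i j);
  yh_td : forall j, t j ^+ d = 1;
  yh_g2 : forall i,
    g i ^+ 2 = q%:A + (q - 1) *: (e_elt (t (lo i)) (t (hi i)) * g i) }.

Record hecke_rels (B : algType A) (G : 'I_n.-1 -> B) : Prop := {
  hecke_GG : forall i j : 'I_n.-1, (i.+1 < j)%N || (j.+1 < i)%N -> G i * G j = G j * G i;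
  hecke_GGG : forall i j : 'I_n.-1, j = i.+1 :> nat -> G i * G j * G i = G j * G i * G j;
  hecke_G2 : forall i, G i ^+ 2 = q%:A + (q - 1) *: G i }.

(* A model in which all the t_j act by 1 and all the g_i by the same matrix, *)
(* whatever d is in C                                                         *)
Lemma companion_ex (c : A) :
  exists M : 'M[A]_2, M ^+ 2 = q%:A + (q - 1) *: (c%:A * M).
Proof.
exists (\matrix_(i, j) if i == 0 then if j == 0 then 0 else q
                       else if j == 0 then 1 else (q - 1) * c).
rewrite expr2 mulr_algl; apply/matrixP => i j.
rewrite !mxE !big_ord_recl big_ord0 !mxE.
by case: i j => [[|[|//]] ?] [[|[|//]] ?]; rewrite /= -?[_ == 0]/(_ == _) /=;
  rewrite ?(mulr0, mul0r, mulr1, mul1r, addr0, add0r) // ?mulrA // -!mulrA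
    [LHS]mulrC mulrA.
Qed.

Lemma yh_model (B : algType A) (M : B) :
  M ^+ 2 = q%:A + (q - 1) *: ((lconst d%:R^-1 * d%:R)%:A * M) ->
  yh_rels (fun=> M) (fun=> 1).
Proof.
move=> ME; split=> [|||i j|j|i]; [by []|by []|by []| | |].
- by rewrite mulr1 mul1r.
- exact: expr1n.
- rewrite ME; congr (_ + _ *: (_ * _)).
  rewrite /e_elt (eq_bigr (fun=> 1)) => [|s _]; last by rewrite !expr1n mulr1.
  by rewrite big_const_ord iter_addr_0 -scaler_nat scalerA.
Qed.

Lemma hecke_model (B : algType A) (M : B) :
  M ^+ 2 = q%:A + (q - 1) *: (1%:A * M) -> hecke_rels (fun=> M).
Proof. by move=> ME; split=> // i; rewrite ME scale1r mul1r. Qed.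

Definition YH_rels_on (B : algType A) (f : 'I_n.-1 + 'I_n -> B) : Prop :=
  yh_rels (fun i => f (inl i)) (fun j => f (inr j)).

Lemma yh_consistent :
  exists (B : algType A) (f : 'I_n.-1 + 'I_n -> B), YH_rels_on f.
Proof.
have [M ME] := companion_ex (lconst d%:R^-1 * d%:R).
by exists 'M[A]_2, (fun z => if z is inl _ then M else 1); exact: yh_model.
Qed.

Definition YH_pres : presentation A := Presentation YH_rels_on yh_consistent.

Definition YH : algType A := presented YH_pres.

Definition yg (i : 'I_n.-1) : YH := pres_gen (P := YH_pres) (inl i).
Definition yt (j : 'I_n) : YH := pres_gen (P := YH_pres) (inr j).

Lemma YH_rels : yh_rels yg yt.
Proof.
split=> *; apply: pres_ext => B f fP; have [gg ggg tt tg td g2] := fP.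
- by rewrite !pres_evalM // !pres_eval_gen //; exact: gg.
- by rewrite !pres_evalM // !pres_eval_gen //; exact: ggg.
- by rewrite !pres_evalM // !pres_eval_gen //; exact: tt.
- by rewrite !pres_evalM // !pres_eval_gen //; exact: tg.
- by rewrite pres_evalX // pres_eval_gen // pres_eval1 //; exact: td.
- rewrite pres_evalX // pres_evalD // !pres_evalZ // pres_eval1 // pres_evalM //.
  rewrite pres_evalZ // pres_eval_sum // !pres_eval_gen // g2.
  congr (_ + _ *: (_ *: _ * _)); apply: eq_bigr => s _.
  by rewrite pres_evalM // !pres_evalX // !pres_eval_gen.
Qed.

Lemma hecke_consistent : exists (B : algType A) (f : 'I_n.-1 -> B), hecke_rels f.
Proof.
by have [M ME] := companion_ex 1; exists 'M[A]_2, (fun=> M); exact: hecke_model.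
Qed.

Definition Hecke_pres : presentation A := Presentation hecke_rels hecke_consistent.

Definition Hecke : algType A := presented Hecke_pres.

Definition hG (i : 'I_n.-1) : Hecke := pres_gen (P := Hecke_pres) i.

Lemma Hecke_rels : hecke_rels hG.
Proof.
split=> *; apply: pres_ext => B f fP; have [GG GGG G2] := fP.
- by rewrite !pres_evalM // !pres_eval_gen //; exact: GG.
- by rewrite !pres_evalM // !pres_eval_gen //; exact: GGG.
- rewrite pres_evalX // pres_evalD // !pres_evalZ // pres_eval1 // !pres_eval_gen //.
Qed.

(* independent of the choice of a reduced expression, by Matsumoto's theorem *)
Definition gw (w : 'S_n) : YH := \prod_(i <- redword w) yg i.
Definition hGw (w : 'S_n) : Hecke := \prod_(i <- redword w) hG i.

(* Comp_d(n), each part being at most n *)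
Definition wcomp := {mu : d.-tuple 'I_n.+1 | sumn [seq val x | x <- mu] == n}.

Section Composition.
Variable mu : wcomp.

Definition parts : seq nat := [seq val x | x <- val mu].

(* mu_1 + ... + mu_r *)
Definition psum (r : nat) : nat := sumn (take r parts).

(* the 0-based index of the block of consecutive letters, of lengths mu_1, ..., *)
(* mu_d, to which the letter j belongs                                        *)
Definition block (j : nat) : nat := find (fun r => j < psum r.+1)%N (iota 0 d).

Definition young : {set 'S_n} := [set w : 'S_n | [forall j, block (w j) == block j]].

Definition Jmu (i : 'I_n.-1) : bool := i.+1 \notin [seq psum r | r <- iota 1 d.-1].

Definition Hmu : algType A := subalg [set hG i | i in [set i | Jmu i]]%classic.

(* G_w as an element of H^mu, meant for w in the Young subgroup *)
Definition hGmu (w : 'S_n) : Hmu := insubd (0 : subalg _) (hGw w).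

(* m_mu, the index of the Young subgroup *)
Definition mnum : nat := n`! %/ \prod_(x <- parts) x`!.

Definition min_coset_reps (pi : 'I_mnum -> 'S_n) : Prop :=
  [/\ forall k, val k = 0%N -> pi k = 1%g,
      forall w, exists! k, exists2 u, u \in young & w = pmul (pi k) u
    & forall k u, u \in young -> (ell (pi k) <= ell (pmul (pi k) u))%N].

End Composition.

(* a character of A_(d,n) is given by its values on t_1, ..., t_n *)
Definition E_elt (chi : {ffun 'I_n -> C}) : YH :=
  \prod_(j < n) (lconst d%:R^-1 *: \sum_(s < d) lconst (chi j ^+ s) *: yt j ^+ (d - s)).

Definition char_act (w : 'S_n) (chi : {ffun 'I_n -> C}) : {ffun 'I_n -> C} :=
  [ffun j => chi (w^-1%g j)].

(* Extension of scalars to C[q^(1/2), q^(-1/2)], that is C[v, v^-1] with      *)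
(* q = v^2                                                                    *)

Local Notation to_v := (@lsquare C : {rmorphism A -> A}).

Lemma pres_semilinear (P : presentation A) m (f : gens P -> 'M[A]_m.+1) :
  rels f ->
  semilinear_rels to_v (fun x : presented P => map_mx to_v (pres_eval f x)).
Proof.
move=> fP; split=> [|x y|x y|a x].
- by rewrite pres_eval1 // map_mx1.
- by rewrite pres_evalD // map_mxD.
- by rewrite pres_evalM // map_mxM.
- by rewrite pres_evalZ // map_mxZ.
Qed.

Lemma YH_ext_nz : exists (D : algType A) (f : YH -> D), semilinear_rels to_v f.
Proof.
have [M ME] := companion_ex (lconst d%:R^-1 * d%:R).
pose f (z : gens YH_pres) := if z is inl _ then M else 1.
exists 'M[A]_2, (fun x : YH => map_mx to_v (pres_eval f x)).
by apply: (pres_semilinear (P := YH_pres)); exact: yh_model.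
Qed.

Lemma Hmu_ext_nz mu : exists (D : algType A) (f : Hmu mu -> D), semilinear_rels to_v f.
Proof.
have [M ME] := companion_ex 1.
have fP : @rels _ Hecke_pres _ (fun=> M) by exact: hecke_model.
have [h1 hD hM hZ] := pres_semilinear fP.
exists 'M[A]_2, (fun x : Hmu mu => map_mx to_v (pres_eval (fun=> M) (subalg_val x))).
split=> [|x y|x y|a x].
- exact: h1.
- exact: hD.
- exact: hM.
- exact: hZ.
Qed.

Definition YHv : algType A := scalar_ext YH_ext_nz.
Definition Hmuv (mu : wcomp) : algType A := scalar_ext (Hmu_ext_nz mu).

Definition toYv (x : YH) : YHv := scext_in YH_ext_nz x.
Definition toHv (mu : wcomp) (x : Hmu mu) : Hmuv mu := scext_in (Hmu_ext_nz mu) x.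

Variables (xi : d.-tuple C) (pi : forall mu : wcomp, 'I_(mnum mu) -> 'S_n).
Arguments pi : clear implicits.

Definition char1 (mu : wcomp) : {ffun 'I_n -> C} := [ffun j : 'I_n => nth 0 xi (block mu j)].

Section Maps.
Variable mu : wcomp.
Local Notation m := (mnum mu).

Definition chark (k : 'I_m) : {ffun 'I_n -> C} := char_act (pi mu k) (char1 mu).

Definition Emu : YH := \sum_(k < m) E_elt (chark k).

(* v^(ell w - ell u) = q^((ell w - ell u) / 2) *)
Definition vdiff (w u : 'S_n) : A := lmon C ((ell w)%:Z - (ell u)%:Z).

Definition Umu : 'M[Hmuv mu]_m :=
  \sum_(k < m) (lmon C (ell (pi mu k))%:Z)%:A *: delta_mx k k.
Definition Umu_inv : 'M[Hmuv mu]_m :=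
  \sum_(k < m) (lmon C (- (ell (pi mu k))%:Z))%:A *: delta_mx k k.

Let diagMM (a b : 'I_m -> A) :
  (\sum_(k < m) (a k)%:A *: delta_mx k k : 'M[Hmuv mu]_m) *m
  (\sum_(k < m) (b k)%:A *: delta_mx k k) = \sum_(k < m) (a k * b k)%:A *: delta_mx k k.
Proof.
have dE (c : 'I_m -> A) (i j : 'I_m) :
    (\sum_(k < m) (c k)%:A *: delta_mx k k : 'M[Hmuv mu]_m) i j = (c i)%:A *+ (i == j).
  rewrite summxE (bigD1 i) //= big1 => [|k ki]; first last.
    by rewrite !mxE eq_sym (negPf ki) mulr0.
  by rewrite !mxE eqxx addr0 eq_sym mulr_natr.
apply/matrixP => i j; rewrite mxE dE.
under eq_bigr => k _ do rewrite !dE.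
rewrite (bigD1 i) //= big1 => [|k ki]; last by rewrite eq_sym (negPf ki) mul0r.
by rewrite eqxx addr0 mulr1n mulrnAr -scalerAl mul1r scalerA.
Qed.

Lemma Umu_mulV : Umu *m Umu_inv = 1%:M /\ Umu_inv *m Umu = 1%:M.
Proof.
have id1 : 1%:M = \sum_(k < m) (1 : A)%:A *: delta_mx k k :> 'M[Hmuv mu]_m.
  by rewrite mx1_sum_delta; apply: eq_bigr => k _; rewrite !scale1r.
by split; rewrite diagMM id1; apply: eq_bigr => k _;
  rewrite -lmonD ?addrN ?addNr lmon0.
Qed.

Definition tPsi_spec (f : YHv -> 'M[Hmuv mu]_m) : Prop :=
  (forall c x y, corner (toYv Emu) x -> corner (toYv Emu) y ->
     f (c *: x + y) = scmx c (f x) + f y) /\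
  (forall k l w, char_act w (chark l) = chark k ->
     let u := pmul (pmul (pi mu k)^-1%g w) (pi mu l) in
     f (toYv (E_elt (chark k) * gw w)) =
       (vdiff w u *: toHv (hGmu mu u)) *: delta_mx k l).

Definition tPhi_spec (f : 'M[Hmuv mu]_m -> YHv) : Prop :=
  (forall c M N, f (scmx c M + N) = c *: f M + f N) /\
  (forall k l w, w \in young mu ->
     let u := pmul (pmul (pi mu k) w) (pi mu l)^-1%g in
     f (toHv (hGmu mu w) *: delta_mx k l) =
       vdiff w u *: toYv (E_elt (chark k) * gw u * E_elt (chark l))).

(* the linear maps on E_mu Y and on Mat(H^mu), after extension of scalars,    *)
(* with the prescribed values on spanning families; the values of tPsi        *)
(* outside E_mu Y are irrelevant.  Were there no such map, tPsi and tPhi would *)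
(* be the zero map                                                            *)
Definition tPsi (x : YHv) : 'M[Hmuv mu]_m :=
  xget (fun=> 0 : 'M[Hmuv mu]_m) [set f | tPsi_spec f]%classic x.
Definition tPhi (M : 'M[Hmuv mu]_m) : YHv :=
  xget (fun=> 0 : YHv) [set f | tPhi_spec f]%classic M.

Definition conjU (x : YH) : 'M[Hmuv mu]_m := Umu *m tPsi (toYv x) *m Umu_inv.
Definition conjUV (M : 'M[Hmu mu]_m) : YHv :=
  tPhi (Umu_inv *m map_mx (@toHv mu) M *m Umu).

(* the element over C[q, q^-1] that becomes conjU x after extension of scalars *)
Definition Psi (x : YH) : 'M[Hmu mu]_m :=
  xget 0 [set M | map_mx (@toHv mu) M = conjU x]%classic.
Definition Phi (M : 'M[Hmu mu]_m) : YH := xget 0 [set x | toYv x = conjUV M]%classic.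

End Maps.

Definition prod_Mat : pzRingType := prod_ring (fun mu : wcomp => 'M[Hmu mu]_(mnum mu)).

Definition prod_Mat_scale (c : A) (M : prod_Mat) : prod_Mat := fun mu => scmx c (M mu).

Definition Psi_n (a : YH) : prod_Mat := fun mu => Psi mu (Emu mu * a).
Definition Phi_n (M : prod_Mat) : YH := \sum_(mu : wcomp) Phi (M mu).

End Algebras.

Arguments toYv {C d n} x.
Arguments toHv {C d n} mu x.
Arguments Emu {C d n} xi pi mu.
Arguments Umu C {d n} pi mu.
Arguments Umu_inv C {d n} pi mu.
Arguments tPsi {C d n} xi pi mu x.
Arguments tPhi {C d n} xi pi mu M.
Arguments Psi {C d n} xi pi mu x.
Arguments Phi {C d n} xi pi mu M.
Arguments Psi_n {C d n} xi pi a.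
Arguments Phi_n {C d n} xi pi M.
Arguments prod_Mat_scale {C d n} c M.

(* Main.v *)
(* The Hecke algebra has the basis [hGw w] because it acts on the free module
   with basis the permutations, and the subalgebra of the Young subgroup has the
   basis [hGw u], [u] in that subgroup.  The idempotents [E_elt chi] are the
   common eigenprojections of the [t_j], and [g_i] permutes them through its
   action on [chi], so the [E_elt chi * gw w] span the Yokonuma-Hecke algebra.

   Conjugating by [Umu] removes all half-integral powers of q: [Psi] sends [t_j]
   to a diagonal matrix and [g_i] to a monomial matrix with entries 1, q or a
   generator of the Young subgroup.  These matrices satisfy the defining
   relations since the product along a reduced word of [w] only depends on [w]:
   it is q^e G_u with u = pi_k^-1 w pi_l and
   2 e = l(w) - l(u) + l(pi_k) - l(pi_l).  So [Psi] is an algebra map over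
   C[q, q^-1], and it sends a spanning family of E_mu Y to the basis
   [G_u delta_mx k l] up to units, hence is invertible.  The maps over
   C[q^(1/2), q^(-1/2)] are recovered by extension of scalars. *)
Require Import Defs.
From HB Require Import structures.
From mathcomp Require Import all_boot all_order all_algebra all_fingroup.
From mathcomp Require Import boolp classical_sets reals complex.
From mathcomp Require Import zify ring.
Set Implicit Arguments.
Unset Strict Implicit.
Unset Printing Implicit Defensive.
Import Order.TTheory GRing.Theory Num.Theory.

(** * Lengths of permutations and Matsumoto's theorem *)

(** The isomorphism over C[q^(1/2), q^(-1/2)] is proved here as well. [tPsi] and [tPhi] are chosen
    by [xget] among the linear maps with prescribed values, so they can be computed only once such
    maps are known to exist and to be unique where they are used. Existence of [tPhi] requires
    independence of the G_u over C[v, v^-1], v = q^(1/2); existence of [tPsi] requires a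
    representation of Y. A presented algebra is accessible only through its maps to models and its
    spanning families, so independence always comes from sending a spanning family to an independent
    one.

    The exponent e is a natural number because of Deodhar's lemma: s_i pi_k is either another
    minimal representative, of length one more or one less, or pi_k s_j with s_j in the Young
    subgroup. Along a reduced word each letter raises l(w) by one; it then either changes l(pi_k) by
    one, so that e changes by 1 or 0, or raises l(u) by one, so that e is unchanged.

    The group law of ['S_n] composes in the opposite order: [w * adj i] is s_i w, and a left coset
    pi_k S_mu consists of the products [u * p k]. *)

Section Length.
Variable n : nat.
Implicit Types (w u : 'S_n) (i j : 'I_n.-1) (s t : seq 'I_n.-1).

Lemma adjL i : adj i (lo i) = hi i. Proof. exact: tpermL. Qed.
Lemma adjR i : adj i (hi i) = lo i. Proof. exact: tpermR. Qed.
Lemma adjK i : (adj i * adj i)%g = 1%g. Proof. exact: tperm2. Qed.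
Lemma adjV i : (adj i)^-1%g = adj i. Proof. exact: tpermV. Qed.

Lemma adjE i (x : 'I_n) :
  adj i x = (if x == i :> nat then i.+1 else if x == i.+1 :> nat then i : nat else x) :> nat.
Proof.
case: tpermP => [->|->|/eqP xl /eqP xh] /=; rewrite ?eqxx //.
  by case: eqP => //; lia.
by rewrite -!val_eqE /= in xl xh; rewrite (negPf xl) (negPf xh).
Qed.

Lemma adj_mono i (x y : 'I_n) : (x < y)%N -> ~~ ((x == lo i) && (y == hi i)) ->
  (adj i x < adj i y)%N.
Proof.
move=> xy; rewrite -!val_eqE !adjE /= => h.
by do ?case: ifP; lia.
Qed.

Lemma mulg_adjK i w : (w * adj i * adj i)%g = w.
Proof. by rewrite -mulgA adjK mulg1. Qed.

(* s_i w is longer than w, where s_i w = pmul (adj i) w is [w * adj i] *)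
Definition asc i w := (w^-1%g (lo i) < w^-1%g (hi i))%N.

Lemma ascN i w : ~~ asc i w = (w^-1%g (hi i) < w^-1%g (lo i))%N.
Proof.
rewrite /asc -leqNgt leq_eqVlt; case: eqP => // /val_inj/perm_inj E.
by have := congr1 val E => /= ?; lia.
Qed.

Lemma asc_adj i w : asc i (w * adj i)%g = ~~ asc i w.
Proof. by rewrite ascN /asc invMg adjV !permM adjL adjR. Qed.

Definition inversions w : {set 'I_n * 'I_n} :=
  [set p : 'I_n * 'I_n | (p.1 < p.2)%N && (w p.2 < w p.1)%N].

(** Applying s_i after w exchanges the values i and i+1, so only the pair of positions carrying
    these two values changes status. *)
Lemma inversions_adj i w : asc i w ->
  inversions (w * adj i)%g = (w^-1%g (lo i), w^-1%g (hi i)) |: inversions w.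
Proof.
move=> iw; apply/setP => -[x y]; rewrite !inE /= xpair_eqE !permM.
case: (boolP ((x == _) && _)) => [/andP[/eqP-> /eqP->]|xyN] /=.
  by rewrite !permKV adjL adjR -/(asc i w) iw /= ltnSn.
case: ltnP => //= xy; apply/idP/idP => h.
- rewrite ltnNge leq_eqVlt; apply/negP => /orP[/eqP/val_inj/perm_inj E|wxy].
    by move: xy; rewrite E ltnn.
  have := adj_mono (i := i) wxy; rewrite ltnNge (ltnW h) /= => E.
  have /negbNE/andP[/eqP wx /eqP wy] := contraFN E (erefl _).
  by move: xyN; rewrite -wx -wy !permK !eqxx.
- apply: adj_mono => //; apply/negP => /andP[/eqP wy /eqP wx].
  by move: iw xy; rewrite /asc -wx -wy !permK; lia.
Qed.

Lemma inversions_adj_card i w : asc i w ->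
  #|inversions (w * adj i)%g| = #|inversions w|.+1.
Proof.
move=> iw; rewrite inversions_adj // cardsU1 !inE /= !permKV.
by case: ltngtP => //=; lia.
Qed.

(** Without descents w^-1 is increasing; upward induction gives x <= w^-1 x, downward induction the
    reverse. *)
Lemma exists_desc w : w != 1%g -> exists i, ~~ asc i w.
Proof.
move=> w1; apply/existsP; apply: contraR w1; rewrite negb_exists => /forallP h.
have h2 (x y : 'I_n) : x.+1 = y -> (w^-1%g x < w^-1%g y)%N.
  move=> xy; have xn : (x < n.-1)%N by have := ltn_ord y; lia.
  have := negbNE (h (Ordinal xn)); rewrite /asc.
  by congr (w^-1%g _ < w^-1%g _)%N; apply: val_inj.
have le k (kn : (k < n)%N) : (k <= w^-1%g (Ordinal kn))%N.
  elim: k kn => // k IH kn; have kn' : (k < n)%N by lia.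
  exact: leq_ltn_trans (IH kn') (h2 _ _ _).
have ge k : forall x : 'I_n, (n - x = k)%N -> (w^-1%g x <= x)%N.
  elim: k => [|k IH] x xk; first by have := ltn_ord x; lia.
  case: (ltnP x.+1 n) => xn; last by have := ltn_ord (w^-1%g x); lia.
  have := IH (Ordinal xn) ltac:(rewrite /=; lia).
  by have := h2 x (Ordinal xn) (erefl _); rewrite /=; lia.
have w1 : w^-1%g = 1%g.
  apply/permP => x; rewrite perm1; apply: val_inj; apply/eqP.
  rewrite eqn_leq (ge _ _ (erefl _)) /=.
  by have := le x (ltn_ord x); congr (_ <= w^-1%g _)%N; apply: val_inj.
by rewrite -[w]invgK w1 invg1.
Qed.

Lemma word_perm_cons i s : word_perm (i :: s) = (word_perm s * adj i)%g.
Proof. by []. Qed.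

Lemma inversions_word s : (#|inversions (word_perm s)| <= size s)%N.
Proof.
elim: s => [|i s IH].
  rewrite leqn0 cards_eq0; apply/eqP/setP => -[x y]; rewrite !inE /= !perm1.
  by case: ltngtP.
rewrite word_perm_cons; case: (boolP (asc i (word_perm s))) => h.
  by rewrite inversions_adj_card.
rewrite -asc_adj in h; have := inversions_adj_card h.
by rewrite mulg_adjK => E; rewrite E in IH; exact: ltnW (leqW IH).
Qed.

(** Bubble sort: removing a descent removes exactly one inversion. With [inversions_word] this
    identifies [ell] with the number of inversions. *)
Lemma inversions_word_ex w : exists2 s, word_perm s = w & size s = #|inversions w|.
Proof.
move: {2}#|_| (erefl #|inversions w|) => k; elim: k w => [|k IH] w wk.
  exists [::]; last by rewrite wk.
  apply/esym/eqP; case: (eqVneq w 1%g) => // w1; have [j dj] := exists_desc w1.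
  by rewrite -asc_adj in dj; have := inversions_adj_card dj; rewrite mulg_adjK wk.
have w1 : w != 1%g.
  apply: contra_eq_neq wk => ->; have := inversions_word [::] => /=.
  by case: #|_|.
have [i iw] := exists_desc w1; rewrite -asc_adj in iw.
have := inversions_adj_card iw; rewrite mulg_adjK wk => -[/esym/IH[s sE ss]].
exists (i :: s); first by rewrite word_perm_cons sE mulg_adjK.
by rewrite /= ss -(inversions_adj_card iw) mulg_adjK.
Qed.

Lemma word_perm_redword w : word_perm (redword w) = w.
Proof. by apply/eqP; exact: (xchooseP (redword_ex w)). Qed.

Lemma size_redword w : size (redword w) = ell w.
Proof. exact: size_tuple. Qed.

Lemma ell_le s : (ell (word_perm s) <= size s)%N.
Proof.
rewrite /ell; case: ex_minnP => k _; apply; apply/existsP.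
by exists (in_tuple s); rewrite eqxx.
Qed.

Lemma ell_inversions w : ell w = #|inversions w|.
Proof.
apply/eqP; rewrite eqn_leq; apply/andP; split.
  by have [s <- <-] := inversions_word_ex w; exact: ell_le.
by rewrite -{1}[w]word_perm_redword -(size_redword w) inversions_word.
Qed.

Lemma ell_asc i w : asc i w -> ell (w * adj i)%g = (ell w).+1.
Proof. by rewrite !ell_inversions; exact: inversions_adj_card. Qed.

Lemma ell_desc i w : ~~ asc i w -> ell w = (ell (w * adj i)%g).+1.
Proof. by rewrite -asc_adj => /ell_asc; rewrite mulg_adjK. Qed.

Lemma ell1 : ell (1%g : 'S_n) = 0%N.
Proof. by have := ell_le [::]; rewrite /=; case: ell. Qed.

Lemma word_perm_rev s : word_perm (rev s) = (word_perm s)^-1%g.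
Proof.
elim: s => [|i s IH]; first by rewrite /= invg1.
by rewrite rev_cons -cats1 word_perm_cat IH /= /pmul mul1g invMg adjV.
Qed.

Lemma ellV w : ell w^-1%g = ell w.
Proof.
suff le u : (ell u^-1%g <= ell u)%N by apply/eqP; rewrite eqn_leq le -{1}[w]invgK le.
by rewrite -{1}[u]word_perm_redword -word_perm_rev (leq_trans (ell_le _)) // size_rev size_redword.
Qed.

Definition reduced s := size s == ell (word_perm s).

Lemma reduced_redword w : reduced (redword w).
Proof. by rewrite /reduced size_redword word_perm_redword. Qed.

Lemma reduced_nil : reduced [::].
Proof. by rewrite /reduced /= ell1. Qed.

Lemma reduced_cons i s : reduced (i :: s) = asc i (word_perm s) && reduced s.
Proof.
rewrite /reduced word_perm_cons /=; case: (boolP (asc i _)) => [/ell_asc->|/ell_desc h] //=.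
by apply/negP => /eqP sE; have := ell_le s; rewrite -/(word_perm s) h; lia.
Qed.

End Length.

Section Matsumoto.
Variables (n : nat) (B : pzRingType) (g : 'I_n.-1 -> B).
Local Open Scope ring_scope.
Hypothesis gg : forall i j : 'I_n.-1, (i.+1 < j)%N || (j.+1 < i)%N -> g i * g j = g j * g i.
Hypothesis ggg : forall i j : 'I_n.-1, j = i.+1 :> nat -> g i * g j * g i = g j * g i * g j.

Lemma adj_far (i j : 'I_n.-1) : (i.+1 < j)%N || (j.+1 < i)%N ->
  (adj i * adj j = adj j * adj i)%g.
Proof.
move=> ij; apply/permP => x; apply: val_inj; rewrite !permM /= !adjE.
by do ?case: ifP; lia.
Qed.

Lemma adj_braid (i j : 'I_n.-1) : j = i.+1 :> nat ->
  (adj i * adj j * adj i = adj j * adj i * adj j)%g.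
Proof.
move=> ij; apply/permP => x; apply: val_inj; rewrite !permM /= !adjE ij.
by do ?case: ifP; lia.
Qed.

Lemma asc_far (i j : 'I_n.-1) w : (i.+1 < j)%N || (j.+1 < i)%N ->
  asc j (w * adj i)%g = asc j w.
Proof.
move=> ij; rewrite /asc invMg adjV !permM.
by rewrite !tpermD // -val_eqE /=; apply/eqP; lia.
Qed.

(** The action of s_i and s_j on the three letters they move, packed as a tuple of rewriting rules
    so that ascents can be evaluated by [rewrite]. *)
Lemma braid_pos (i j : 'I_n.-1) : j = i.+1 :> nat ->
  (lo j = hi i) * (adj i (hi j) = hi j) * (adj j (lo i) = lo i) *
  (adj j (hi i) = hi j) * (adj i (lo j) = lo i).
Proof.
move=> ij; have lj : lo j = hi i by apply: val_inj; rewrite /= ij.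
split; last by rewrite lj adjR.
split; last by rewrite -lj adjL.
split; first split.
- by apply: val_inj; rewrite /= ij.
- by apply: tpermD; rewrite -val_eqE /= ij; apply/eqP; lia.
- by apply: tpermD; rewrite -val_eqE /= ij; apply/eqP; lia.
Qed.

(** Induction on the length. If the first letters i and j differ, both are descents of w, so w has
    reduced words that begin with either side of the braid relation of i and j; the induction
    hypothesis joins each given word to one of them. *)
Lemma matsumoto s t : reduced s -> reduced t -> word_perm s = word_perm t ->
  \prod_(i <- s) g i = \prod_(i <- t) g i.
Proof.
move: {2}(size s) (leqnn (size s)) => k; elim: k s t => [|k IH].
  move=> [|//] [|j t] // _ _; rewrite {1}/reduced => /eqP /= + E.
  by rewrite -E ell1.
move=> [|i s] [|j t] //.
- by move=> _ _; rewrite {1}/reduced => /eqP /= + E; rewrite -E ell1.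
- by move=> _; rewrite {1}/reduced => /eqP /= + _ E; rewrite E ell1.
move=> sk0 si tj E; have sk : (size s <= k)%N := sk0; rewrite !big_cons.
have [w wE] : exists w, w = word_perm (i :: s) by exists (word_perm (i :: s)).
have wi : word_perm s = (w * adj i)%g by rewrite wE word_perm_cons mulg_adjK.
have wj : word_perm t = (w * adj j)%g by rewrite wE E word_perm_cons mulg_adjK.
have sl : (size s).+1 = ell w by have /eqP := si; rewrite -wE => <-.
have tl : (size t).+1 = ell w by have /eqP := tj; rewrite -E -wE => <-.
have lst : size s = size t by rewrite -tl in sl; case: sl.
move: (si) (tj); rewrite !reduced_cons wi wj !asc_adj => /andP[di rs] /andP[dj rt].
clear sk0 si tj E wE sl tl.
have [ij|ij] := eqVneq i j.
  rewrite ij; congr (_ * _); apply: IH => //.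
  by rewrite wi wj ij.
case: (boolP ((i.+1 < j)%N || (j.+1 < i)%N)) => far.
  set r := redword (w * adj i * adj j)%g.
  have rE : word_perm r = (w * adj i * adj j)%g by exact: word_perm_redword.
  have rr : reduced r by exact: reduced_redword.
  have -> : \prod_(i <- s) g i = \prod_(i <- j :: r) g i.
    apply: IH => //; first by rewrite reduced_cons rr rE asc_adj asc_far // dj.
    by rewrite word_perm_cons rE wi mulg_adjK.
  have -> : \prod_(i <- t) g i = \prod_(i <- i :: r) g i.
    apply: IH => //; first by rewrite -lst.
      by rewrite reduced_cons rr rE -mulgA (adj_far far) mulgA asc_adj asc_far 1?orbC // di.
    by rewrite word_perm_cons rE wj -!mulgA (mulgA (adj i)) (adj_far far) mulg_adjK.
  by rewrite !big_cons !mulrA gg.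
wlog ij1 : i j s t sk wi wj di rs dj rt lst ij far / j = i.+1 :> nat.
  move=> H; have : (j == i.+1 :> nat) || (i == j.+1 :> nat).
    by move: far ij; rewrite -val_eqE /= => far /eqP ij; apply/orP; lia.
  case/orP => /eqP ij1; first exact: H ij1.
  apply/esym; apply: (H j i t s) => //; by [rewrite -lst | rewrite eq_sym | rewrite orbC].
have E := braid_pos ij1.
(* In function notation w = s_i s_j s_i r with lengths adding up, so [j :: i :: r] and [i :: j :: r]
   are reduced words of s_i w and s_j w. *)
set r := redword (w * adj i * adj j * adj i)%g.
have rE : word_perm r = (w * adj i * adj j * adj i)%g by exact: word_perm_redword.
have rE' : word_perm r = (w * adj j * adj i * adj j)%g.
  by rewrite rE -!mulgA !(mulgA (adj _) (adj _)) adj_braid.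
have rr : reduced r by exact: reduced_redword.
move: (di) (dj); rewrite !ascN E => di' dj'.
have -> : \prod_(i <- s) g i = \prod_(i <- j :: i :: r) g i.
  apply: IH => //; last by rewrite !word_perm_cons rE wi !mulg_adjK.
  rewrite !reduced_cons rr word_perm_cons rE mulg_adjK !asc_adj.
  by rewrite !ascN !invMg !adjV !permM !(E, adjL, adjR) dj' (ltn_trans dj' di').
have -> : \prod_(i <- t) g i = \prod_(i <- i :: j :: r) g i.
  apply: IH => //; first by rewrite -lst.
    rewrite !reduced_cons rr word_perm_cons rE' mulg_adjK !asc_adj.
    by rewrite !ascN !invMg !adjV !permM !(E, adjL, adjR) di' (ltn_trans dj' di').
  by rewrite !word_perm_cons rE' wj !mulg_adjK.
by rewrite !big_cons !mulrA ggg.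
Qed.

(** Common form of [gw] and [hGw], both convertible to it, so that the next lemmas serve both
    algebras. *)
Definition wprod (w : 'S_n) : B := \prod_(i <- redword w) g i.

Lemma wprod_word s : reduced s -> \prod_(i <- s) g i = wprod (word_perm s).
Proof.
move=> rs; apply: matsumoto => //; first exact: reduced_redword.
by rewrite word_perm_redword.
Qed.

Lemma wprod1 : wprod 1 = 1.
Proof. by rewrite -(wprod_word (reduced_nil n)) big_nil. Qed.

Lemma wprod_asc i w : asc i w -> g i * wprod w = wprod (w * adj i)%g.
Proof.
move=> iw; have := @wprod_word (i :: redword w).
rewrite reduced_cons word_perm_redword iw reduced_redword /= /pmul.
by rewrite word_perm_redword big_cons; apply.
Qed.

End Matsumoto.

(** * Minimal coset representatives of Young subgroups *)

Section Blocks.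
Variables (d n : nat) (mu : wcomp d n).
Local Notation psum := (psum mu).
Local Notation block := (block mu).

Lemma size_parts : size (parts mu) = d.
Proof. by rewrite size_map size_tuple. Qed.

Lemma psumS r : psum r.+1 = (psum r + nth 0 (parts mu) r)%N.
Proof.
rewrite /Defs.psum; case: (ltnP r (size (parts mu))) => h.
  by rewrite (take_nth 0) // sumn_rcons.
by rewrite !take_oversize ?nth_default ?addn0 // leqW.
Qed.

Lemma psum_le r r' : (r <= r')%N -> (psum r <= psum r')%N.
Proof.
move/subnK <-; elim: (r' - r)%N => // k IH.
by rewrite addSn psumS (leq_trans IH) // leq_addr.
Qed.

Lemma psum_max : psum d = n.
Proof. by rewrite /Defs.psum take_oversize ?size_parts //; exact: eqP (valP mu). Qed.

Lemma blockP j : (j < n)%N ->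
  [/\ (block j < d)%N, (psum (block j) <= j)%N & (j < psum (block j).+1)%N].
Proof.
move=> jn; have jd : (j < psum d)%N by rewrite psum_max.
have hj : has (fun r => j < psum r.+1)%N (iota 0 d).
  apply/hasP; exists d.-1; last first.
    by apply: (leq_trans jd); apply: psum_le; lia.
  rewrite mem_iota /= add0n; apply: contraTT jd; rewrite -!leqNgt => h.
  by rewrite (@leq_trans (psum 0)) ?psum_le ?/Defs.psum ?take0 //; lia.
have bd : (block j < d)%N by rewrite /Defs.block -[X in (_ < X)%N](size_iota 0) -has_find.
split=> //; last by have := nth_find 0 hj; rewrite nth_iota.
case E: (block j) => [|r]; first by rewrite /Defs.psum take0.
have := @before_find _ 0 (fun r => j < psum r.+1)%N (iota 0 d) r.
rewrite -/(block j) E ltnSn nth_iota; last by rewrite -E ltnW // ltnS ltnW.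
by move=> /(_ isT)/negbT; rewrite -leqNgt.
Qed.

Lemma block_eq j r : (psum r <= j < psum r.+1)%N -> (j < n)%N -> block j = r.
Proof.
move=> /andP[rj jr] /blockP[_ bj jb]; apply/eqP; rewrite eqn_leq.
by apply/andP; split; rewrite leqNgt; apply/negP => /psum_le h; lia.
Qed.

Lemma block_mono j j' : (j <= j')%N -> (block j <= block j')%N.
Proof.
move=> jj'; rewrite /Defs.block; apply: sub_find => r /=; exact: leq_ltn_trans.
Qed.

Lemma Jmu_block (i : 'I_n.-1) : Jmu mu i = (block (lo i) == block (hi i)).
Proof.
have hn := hi_subproof i.
have [bd bj jb] := blockP (ltnW hn); have [bd' bj' jb'] := blockP hn.
apply/negP/eqP => [H|E /mapP[r]].
- apply/eqP; rewrite eqn_leq block_mono ?leqnSn //= leqNgt; apply/negP => lt.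
  apply: H; apply/mapP; exists (block i).+1; first by rewrite mem_iota; lia.
  by have := psum_le lt; rewrite /=; lia.
- move=> _ rE; rewrite -E /= in jb'; move: bj => /=.
  by case: (ltnP (block i) r) => /psum_le /=; lia.
Qed.

Lemma card_block r : #|[set x : 'I_n | block x == r]| = nth 0 (parts mu) r.
Proof.
case: (ltnP r d) => rd; last first.
  rewrite nth_default ?size_parts //; apply/eqP; rewrite cards_eq0.
  apply/eqP/setP => x; rewrite !inE; have [] := blockP (ltn_ord x).
  by move=> bd _ _; apply/eqP; lia.
have le : (psum r + nth 0 (parts mu) r <= n)%N by rewrite -psumS -[X in (_ <= X)%N]psum_max psum_le.
have lt (y : 'I_(nth 0 (parts mu) r)) : (psum r + y < n)%N.
  by apply: leq_trans le; rewrite ltn_add2l.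
rewrite -[RHS]card_ord -(card_imset _ (f := fun y => Ordinal (lt y))); last first.
  by move=> y y' /(congr1 val) /= /addnI/val_inj.
apply: eq_card => x; rewrite inE; apply/eqP/imsetP => [xr|[y _ ->]] /=.
  have [_ bx xb] := blockP (ltn_ord x); rewrite xr psumS in bx xb.
  have h : (x - psum r < nth 0 (parts mu) r)%N by lia.
  by exists (Ordinal h) => //; apply: val_inj; rewrite /= subnKC.
apply: block_eq (lt y); rewrite leq_addr psumS ltn_add2l.
exact: ltn_ord.
Qed.

Lemma youngP (w : 'S_n) : reflect (forall x, block (w x) = block x) (w \in young mu).
Proof. by rewrite inE; apply: (iffP forallP) => h x; apply/eqP/h. Qed.

Lemma young_group_set : group_set (young mu).
Proof.
apply/group_setP; split=> [|u v /youngP hu /youngP hv]; apply/youngP => x.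
  by rewrite perm1.
by rewrite permM hv hu.
Qed.
Canonical young_group := Group young_group_set.

Lemma young_adj i : (adj i \in young mu) = Jmu mu i.
Proof.
rewrite Jmu_block; apply/youngP/eqP => [h|E x]; first by rewrite -[LHS]h adjL.
by rewrite /adj; case: tpermP => // ->.
Qed.

(** Blocks are intervals preserved by u, so u never inverts two letters of different blocks. *)
Lemma young_desc u i : u \in young mu -> ~~ asc i u -> Jmu mu i.
Proof.
move=> /groupVr/youngP hu; rewrite ascN Jmu_block eqn_leq block_mono ?leqnSn //=.
by move=> /ltnW/block_mono; rewrite !hu.
Qed.

(** Minimality is recorded as monotonicity on each block, the form in which it is applied. The size
    m is a variable rather than [mnum mu], so that [rep_ex] can destruct it. *)
Record coset_reps m (p : 'I_m -> 'S_n) : Prop := CosetReps {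
  reps_ex : forall w, [exists k, (w * (p k)^-1)%g \in young mu];
  reps_inj : forall k l, (p k * (p l)^-1)%g \in young mu -> k = l;
  reps_mono : forall k (x y : 'I_n), (x < y)%N -> block x = block y -> (p k x < p k y)%N }.

Lemma mono_adjacent (w : 'S_n) :
  (forall i, Jmu mu i -> (w (lo i) < w (hi i))%N) ->
  forall x y : 'I_n, (x < y)%N -> block x = block y -> (w x < w y)%N.
Proof.
move=> H x y xy; move: {2}(y - x.+1)%N (erefl (y - x.+1)%N) => k.
elim: k y xy => [|k IH] y xy yk xyb.
  have xn : (x < n.-1)%N by have := ltn_ord y; lia.
  have := H (Ordinal xn); rewrite Jmu_block.
  have -> : lo (Ordinal xn) = x by apply: val_inj.
  have -> : hi (Ordinal xn) = y by apply: val_inj; rewrite /=; lia.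
  by rewrite xyb eqxx => ->.
have yn : (y.-1 < n.-1)%N by have := ltn_ord y; lia.
have hE : hi (Ordinal yn) = y by apply: val_inj; rewrite /=; lia.
have yl : (lo (Ordinal yn) <= y)%N by rewrite /=; lia.
have xl : (x < lo (Ordinal yn))%N by rewrite /=; lia.
have bE : block x = block (lo (Ordinal yn)).
  have := block_mono (ltnW xl); have := block_mono yl.
  by rewrite -xyb => h h'; apply/eqP; rewrite eqn_leq h'.
have := IH (lo (Ordinal yn)) xl ltac:(rewrite /=; lia) bE => /ltn_trans; apply.
by have := H (Ordinal yn); rewrite Jmu_block -bE hE xyb eqxx => ->.
Qed.

(** If p_k inverted two neighbours of a block, then p_k s_i would be a shorter element of the same
    coset. Passing to inverses turns this right multiplication into the left one of [ell_desc]. *)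
Lemma min_coset_repsP (p : 'I_(mnum mu) -> 'S_n) : min_coset_reps p -> coset_reps p.
Proof.
case=> _ ex1 min; split=> [w|k l kl|k x y xy bxy].
- have [k [[u uy ->] _]] := ex1 w; apply/existsP; exists k.
  by rewrite /pmul mulgK.
- have [k' [_ uniq]] := ex1 (p k).
  rewrite -(uniq k); last by exists 1%g; rewrite ?group1 // /pmul mul1g.
  by apply: uniq; exists (p k * (p l)^-1)%g => //; rewrite /pmul mulgKV.
- move: xy bxy; apply: mono_adjacent => i Ji.
  rewrite ltnNge; apply/negP => h.
  have Jy : adj i \in young mu by rewrite young_adj.
  have := min k _ Jy.
  rewrite /pmul -ellV -[X in (_ <= X)%N]ellV invMg adjV leqNgt.
  rewrite [X in (_ < X)%N](@ell_desc _ i) ?ltnSn // ascN invgK.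
  by rewrite ltn_neqAle h andbT; apply/eqP => /val_inj/perm_inj/(congr1 val)/=; lia.
Qed.

Lemma young_mono_eq1 u : u \in young mu ->
  (forall x y : 'I_n, (x < y)%N -> block x = block y -> (u x < u y)%N) -> u = 1%g.
Proof.
move=> uy H; apply/eqP/negPn/negP; rewrite -eq_invg1 => /exists_desc[i di].
have Ji := young_desc (groupVr uy) di.
move: di; rewrite ascN invgK ltnNge ltnW // H //.
by apply/eqP; rewrite -Jmu_block.
Qed.
End Blocks.

Section Cosets.
Variables (d n : nat) (mu : wcomp d n) (m : nat) (p : 'I_m -> 'S_n).
Local Notation block := (block mu).
Hypothesis pP : coset_reps mu p.
Implicit Types (w : 'S_n) (k l : 'I_m) (i j : 'I_n.-1).

Lemma coset_action : {f : 'S_n -> 'I_m -> 'I_m |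
  forall w k, (p k * w * (p (f w k))^-1)%g \in young mu}.
Proof.
have ex w : exists k, (w * (p k)^-1)%g \in young mu by apply/existsP; exact: reps_ex pP w.
by exists (fun w k => xchoose (ex (p k * w)%g)) => w k; exact: xchooseP (ex _).
Qed.

(** In function notation w p_k = p_l u with l = [cact w k] and u = [cof w k]: the action on left
    cosets and its cocycle in S_mu. The permutation pi_k^-1 w pi_l of the statement is therefore
    [cof w l]. *)
Definition cact : 'S_n -> 'I_m -> 'I_m := sval coset_action.
Definition cof w k : 'S_n := (p k * w * (p (cact w k))^-1)%g.

Lemma cof_young w k : cof w k \in young mu.
Proof. exact: svalP coset_action w k. Qed.

Lemma cact_eq w k l : (p k * w * (p l)^-1)%g \in young mu -> cact w k = l.
Proof.
move=> h; apply: (reps_inj pP).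
by have := groupM (groupVr (cof_young w k)) h; rewrite /cof !invMg !invgK !mulgA !mulgKV.
Qed.

Lemma cact1 k : cact 1 k = k.
Proof. by apply: cact_eq; rewrite mulg1 mulgV group1. Qed.

Lemma cactM w w' k : cact (w * w')%g k = cact w' (cact w k).
Proof.
apply: cact_eq; have := groupM (cof_young w k) (cof_young w' (cact w k)).
by rewrite /cof !mulgA mulgKV.
Qed.

Lemma cof1 k : cof 1 k = 1%g.
Proof. by rewrite /cof cact1 mulg1 mulgV. Qed.

Lemma cofM w w' k : cof (w * w')%g k = (cof w k * cof w' (cact w k))%g.
Proof. by rewrite /cof cactM !mulgA mulgKV. Qed.

Lemma cof_eq w k : (p k * w = cof w k * p (cact w k))%g.
Proof. by rewrite /cof mulgKV. Qed.

(** The index of the root of unity that chi_k takes at t_x. *)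
Definition bl k (x : 'I_n) : nat := block ((p k)^-1%g x).

Lemma bl_cact w k x : bl (cact w k) (w x) = bl k x.
Proof.
rewrite /bl -[in LHS](permKV (p k) x).
have -> : w (p k ((p k)^-1%g x)) = p (cact w k) (cof w k ((p k)^-1%g x)).
  by rewrite -!permM cof_eq.
by rewrite permK; exact: (youngP _ _ (cof_young w k)).
Qed.

Lemma bl_inj k l : bl k =1 bl l -> k = l.
Proof.
move=> E; apply: (reps_inj pP); apply/youngP => x.
by rewrite permM -/(bl l _) -E /bl permK.
Qed.

Lemma cact_adj_bl i k : (cact (adj i) k == k) = (bl k (lo i) == bl k (hi i)).
Proof.
apply/eqP/eqP => [E|E].
  by have := bl_cact (adj i) k (lo i); rewrite adjL E.
apply: bl_inj => x; rewrite -[x in LHS](permKV (adj i)) bl_cact adjV.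
by rewrite /adj; case: tpermP => // ->.
Qed.

(** First half of Deodhar's lemma, s_i p_k = p_k s_j. The preimages of i and i+1 under p_k lie in
    one block; as p_k increases there, no letter fits between them, so they are neighbours. *)
Lemma cact_fixed i k : cact (adj i) k = k ->
  exists j, [/\ Jmu mu j, cof (adj i) k = adj j, p k (lo j) = lo i & p k (hi j) = hi i].
Proof.
move=> E; have /eqP := E; rewrite cact_adj_bl => /eqP; rewrite /bl.
set x := (p k)^-1%g (lo i); set y := (p k)^-1%g (hi i) => xy.
have px : p k x = lo i by rewrite permKV.
have py : p k y = hi i by rewrite permKV.
have lt : (x < y)%N.
  rewrite ltnNge leq_eqVlt; apply/negP => /orP[/eqP/val_inj yx|yx].
    by move: px; rewrite -yx py => /(congr1 val)/=; lia.
  by have := reps_mono pP k yx (esym xy); rewrite px py /=; lia.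
have yE : y = x.+1 :> nat.
  apply/eqP; rewrite eqn_leq lt andbT leqNgt; apply/negP => xy1.
  have zn : (x.+1 < n)%N by have := ltn_ord y; lia.
  pose z := Ordinal zn.
  have xz : block x = block z.
    by apply/eqP; rewrite eqn_leq block_mono ?leqnSn //= xy block_mono //= ltnW.
  have := @reps_mono _ _ _ _ _ pP k x z (ltnSn _) xz.
  have := @reps_mono _ _ _ _ _ pP k z y xy1 (etrans (esym xz) xy).
  by rewrite px py /=; lia.
have jn : (x < n.-1)%N by have := ltn_ord y; lia.
have xl : lo (Ordinal jn) = x by exact: val_inj.
have yh : hi (Ordinal jn) = y by apply: val_inj; rewrite /= yE.
exists (Ordinal jn); rewrite xl yh; split=> //.
  by rewrite Jmu_block xl yh xy.
by rewrite /cof E /adj xl yh -px -py -tpermJ /conjg !mulgA mulgV mul1g mulgK.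
Qed.

(** Second half: s_i p_k is again minimal. The only order that s_i reverses is that of i and i+1,
    whose preimages lie in different blocks, so [cof] is increasing on every block and hence
    trivial. *)
Lemma cact_moved i k : cact (adj i) k != k ->
  p (cact (adj i) k) = (p k * adj i)%g /\ cof (adj i) k = 1%g.
Proof.
move=> N; suff E : cof (adj i) k = 1%g by split; rewrite // cof_eq E mul1g.
apply: (young_mono_eq1 (cof_young _ _)) => x y xy bxy.
have byxu : block (cof (adj i) k x) = block (cof (adj i) k y).
  by rewrite !(youngP _ _ (cof_young _ _)).
rewrite ltnNge leq_eqVlt; apply/negP => /orP[/eqP/val_inj/perm_inj E|lt].
  by move: xy; rewrite E ltnn.
have := reps_mono pP (cact (adj i) k) lt (esym byxu).
rewrite -!permM -cof_eq !permM ltnNge ltnW // adj_mono ?(reps_mono pP) //.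
apply: contra N => /andP[/eqP xl /eqP yh].
by rewrite cact_adj_bl /bl -xl -yh !permK bxy.
Qed.

(** Here w^-1 p_l = p_k u^-1 with l = [cact w k] and u = [cof w k], and p_k increases on blocks, so
    an ascent of w at i becomes one of u at j. *)
Lemma asc_cof i j w k : asc i w ->
  Jmu mu j -> p (cact w k) (lo j) = lo i -> p (cact w k) (hi j) = hi i ->
  asc j (cof w k).
Proof.
move=> + Jj pl ph; rewrite /asc -pl -ph => iw; move: Jj; rewrite Jmu_block => /eqP bj.
have vE x : w^-1%g (p (cact w k) x) = p k ((cof w k)^-1%g x).
  apply: (@perm_inj _ w); rewrite permKV -[w _]permM cof_eq permM permKV //.
rewrite !vE in iw.
have /groupVr/youngP yV := cof_young w k.
rewrite ltnNge leq_eqVlt; apply/negP => /orP[/eqP/val_inj h|lt].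
  by move: iw; rewrite h ltnn.
by have := reps_mono pP k lt ltac:(by rewrite !yV); rewrite ltnNge ltnW.
Qed.
End Cosets.

(** * The basis of the Hecke algebra *)

Local Open Scope ring_scope.

(** * Laurent polynomials: constants, monomials and the substitution q := v^2 *)

Section LaurentMore.
Variable F : fieldType.
Local Notation "x %:F" := (FracField.tofrac x).

Lemma lvalE (x y : laurent F) : lval x = lval y -> x = y.
Proof. exact: val_inj. Qed.

Lemma lconst_zmod : zmod_morphism (@lconst F).
Proof.
move=> a b; apply: lvalE; rewrite lvalB; change ((a - b)%:P%:F = a%:P%:F - b%:P%:F).
by rewrite polyCB tofracB.
Qed.

Lemma lconst_monoid : monoid_morphism (@lconst F).
Proof.
split=> [|a b]; apply: lvalE.
  by change ((1%:P)%:F = 1 :> {fraction {poly F}}); rewrite tofrac1.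
rewrite lvalM; change ((a * b)%:P%:F = a%:P%:F * b%:P%:F).
by rewrite polyCM tofracM.
Qed.

HB.instance Definition _ := GRing.isZmodMorphism.Build F (laurent F) (@lconst F) lconst_zmod.
HB.instance Definition _ := GRing.isMonoidMorphism.Build F (laurent F) (@lconst F) lconst_monoid.

Lemma lconstV (a : F) : a != 0 -> lconst a^-1 * lconst a = 1.
Proof. by move=> a0; rewrite -rmorphM mulVf // rmorph1. Qed.

Lemma lsquare_inj : injective (@lsquare F).
Proof.
apply: raddf_inj => x x0; have [[p k] /= xE] := lval_ex x.
have := congr1 (@lval F) x0; rewrite (lsquareE xE).
change (lval 0) with (0 : {fraction {poly F}}); move/eqP.
rewrite mulf_eq0 invr_eq0 (negPf (fracXn_neq0 _ _)) orbF tofrac_eq0.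
rewrite comp_poly_eq0 ?size_polyXn // => /eqP p0; apply: lvalE.
by rewrite xE p0 tofrac0 mul0r.
Qed.

Lemma lmonK (z : int) : lmon F z * lmon F (- z) = 1.
Proof. by rewrite -lmonD subrr lmon0. Qed.

Lemma lmonNK (z : int) : lmon F (- z) * lmon F z = 1.
Proof. by rewrite -lmonD addNr lmon0. Qed.

Lemma lsquare_monn (e : nat) : lsquare (lmon F e%:Z) = lmon F (e.*2)%:Z.
Proof.
elim: e => [|e IH]; first by rewrite !lmon0 rmorph1.
have -> : lmon F e.+1%:Z = lmon F 1 * lmon F e%:Z by rewrite -lmonD.
have -> : lsquare (lmon F 1 * lmon F e%:Z) = lsquare (lmon F 1) * lsquare (lmon F e%:Z).
  exact: rmorphM.
by rewrite IH lsquare_mon -lmonD.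
Qed.

Lemma lsquare_lmonN (e : nat) : lsquare (lmon F (- e%:Z)) = lmon F (- e.*2%:Z).
Proof.
have E : lsquare (lmon F (- e%:Z)) * lmon F e.*2%:Z = 1.
  rewrite -lsquare_monn; have := congr1 (@lsquare F) (lmonNK e%:Z).
  by rewrite (rmorphM (@lsquare F)) rmorph1.
by rewrite -[LHS]mulr1 -(lmonK e.*2%:Z) mulrA E mul1r.
Qed.
End LaurentMore.

Section Span.
Variables (R : comNzRingType) (V : lmodType R) (I : finType) (P : pred I) (e : I -> V).

Definition lspan (x : V) := exists a : I -> R, x = \sum_(i | P i) a i *: e i.

Lemma lspan_gen i : P i -> lspan (e i).
Proof.
move=> Pi; exists (fun j => (j == i)%:R); rewrite (bigD1 i) //= eqxx scale1r.
by rewrite big1 ?addr0 // => j /andP[_ /negPf->]; rewrite scale0r.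
Qed.

Lemma lspan0 : lspan 0.
Proof. by exists (fun=> 0); rewrite big1 // => i _; rewrite scale0r. Qed.

Lemma lspanD x y : lspan x -> lspan y -> lspan (x + y).
Proof.
move=> [a ->] [b ->]; exists (fun i => a i + b i).
by rewrite -big_split; apply: eq_bigr => i _; rewrite scalerDl.
Qed.

Lemma lspanZ c x : lspan x -> lspan (c *: x).
Proof.
move=> [a ->]; exists (fun i => c * a i).
by rewrite scaler_sumr; apply: eq_bigr => i _; rewrite scalerA.
Qed.

Lemma lspan_sum (J : Type) (r : seq J) (Q : pred J) (f : J -> V) :
  (forall j, Q j -> lspan (f j)) -> lspan (\sum_(j <- r | Q j) f j).
Proof. by move=> H; elim/big_ind: _ => //; [exact: lspan0|exact: lspanD]. Qed.
End Span.

Lemma perm_asc_ind n (S : 'S_n -> Prop) : S 1%g ->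
  (forall i w, asc i w -> S w -> S (w * adj i)%g) -> forall w, S w.
Proof.
move=> S1 SS w; move: {2}(ell w) (erefl (ell w)) => k.
elim: k w => [|k IH] w wk.
  case: (eqVneq w 1%g) => [->//|/exists_desc[i /ell_desc]]; by rewrite wk.
case: (eqVneq w 1%g) => [->//|/exists_desc[i di]].
rewrite -(mulg_adjK i w); apply: SS; first by rewrite asc_adj.
by apply: IH; have := ell_desc di; rewrite wk => -[].
Qed.

(** * The regular representation of the Hecke algebra *)

Section RegularMatrices.
Variables (n : nat) (R : comNzRingType) (q : R).
Implicit Types (w : 'S_n) (i j : 'I_n.-1).
Variables (m : nat) (e : 'S_n -> 'I_m.+1) (e' : 'I_m.+1 -> 'S_n).
Hypotheses (eK : cancel e e') (e'K : cancel e' e).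
Local Notation alpha i w := (if asc i w then 1 else q).
Local Notation beta i w := (if asc i w then 0 else q - 1).
Let T (w : 'S_n) : 'cV[R]_m.+1 := delta_mx (e w) 0.
(** Left multiplication by G_i in the expected basis, transported to matrices by an enumeration of
    the permutations; the size is a successor so that these matrices form a model. *)
Definition reg_mx (i : 'I_n.-1) : 'M[R]_m.+1 := \matrix_(a, b)
  let w := e' b in
  alpha i w * (a == e (w * adj i)%g)%:R + beta i w * (a == b)%:R.

Local Notation L := reg_mx.

Lemma reg_mxE i w : L i *m T w = alpha i w *: T (w * adj i)%g + beta i w *: T w.
Proof.
apply/matrixP => a c; rewrite !mxE (bigD1 (e w)) //= big1 ?addr0 => [|b bw].
  by rewrite !mxE eK ord1 !eqxx !andbT mulr1.
by rewrite !mxE (negPf bw) mulr0.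
Qed.

Let matT (M N : 'M[R]_m.+1) : (forall w, M *m T w = N *m T w) -> M = N.
Proof.
move=> MN; apply/matrixP => a b; rewrite -(e'K b).
have : col (e (e' b)) M = col (e (e' b)) N by rewrite !colE; exact: MN.
by move/matrixP/(_ a 0); rewrite !mxE.
Qed.

Lemma reg_mx_far i j : (i.+1 < j)%N || (j.+1 < i)%N -> L i *m L j = L j *m L i.
Proof.
move=> ij; apply: matT => w.
  have ji : (j.+1 < i)%N || (i.+1 < j)%N by rewrite orbC.
  rewrite -!mulmxA !(reg_mxE, mulmxDr, =^~scalemxAr) !(asc_far _ ij) !(asc_far _ ji).
  have -> : (w * adj i * adj j = w * adj j * adj i)%g by rewrite -!mulgA (adj_far ij).
  move: (T w) (T (w * adj i)%g) (T (w * adj j)%g) (T (w * adj j * adj i)%g) => t1 t2 t3 t4.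
  by apply/matrixP => a b; rewrite !mxE; case: (asc i w); case: (asc j w); ring.
Qed.

Lemma reg_mx_braid i j : j = i.+1 :> nat -> L i *m L j *m L i = L j *m L i *m L j.
Proof.
move=> ij; apply: matT => w.
  have E := braid_pos ij.
  have a1 : asc j (w * adj i)%g = asc i (w * adj j)%g.
    by rewrite /asc !invMg !adjV !permM !(E, adjL, adjR).
  have a2 : asc i (w * adj i * adj j)%g = asc j w.
    by rewrite /asc !invMg !adjV !permM !(E, adjL, adjR).
  have a3 : asc j (w * adj j * adj i)%g = asc i w.
    by rewrite /asc !invMg !adjV !permM !(E, adjL, adjR).
  (* This ascent compares the outer two of three values. Transitivity fixes it when i and j are both
     ascents or both descents, which removes the cases where the identity would fail. *)
  have a4 : if asc i w && asc j w then asc i (w * adj j)%g else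
            if ~~ asc i w && ~~ asc j w then ~~ asc i (w * adj j)%g else true.
    rewrite !ascN /asc !invMg !adjV !permM !(E, adjL, adjR).
    case: ifP => [/andP[]|_]; first exact: ltn_trans.
    by case: ifP => // /andP[h h']; exact: ltn_trans h' h.
  rewrite -!mulmxA !(reg_mxE, mulmxDr, =^~scalemxAr) !mulg_adjK !asc_adj a1 a2 a3.
  have -> : (w * adj j * adj i * adj j = w * adj i * adj j * adj i)%g.
    by rewrite -!mulgA !(mulgA (adj _) (adj _)) (adj_braid ij).
  move: (T w) (T (w * adj i)%g) (T (w * adj j)%g) => t1 t2 t3.
  move: (T (w * adj i * adj j)%g) (T (w * adj j * adj i)%g) (T (_ * adj i)%g) => t4 t5 t6.
  apply/matrixP => a b; rewrite !mxE.
  by move: a4; case: (asc i w); case: (asc j w); case: (asc i _) => //= _; ring.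
Qed.

Lemma reg_mx_sqr i : L i *m L i = q%:M + (q - 1) *: L i.
Proof.
apply: matT => w.
  rewrite -mulmxA !(reg_mxE, mulmxDr, =^~scalemxAr) mulmxDl -!scalemxAl reg_mxE mul_scalar_mx.
  rewrite !mulg_adjK asc_adj; apply/matrixP => a b; rewrite !mxE.
  by case: (asc i w) => /=; ring.
Qed.
End RegularMatrices.

Section Hecke.
Variables (C : fieldType) (n : nat).
Local Notation A := (laurent C).
Local Notation q := (lmon C 1).
Local Notation H := (Hecke C n).
Implicit Types (w : 'S_n) (i j : 'I_n.-1).

Lemma hGw1 : hGw C (1%g : 'S_n) = 1 :> H.
Proof. by apply: wprod1; have [] := Hecke_rels C n. Qed.

Lemma hG_asc i w : asc i w -> hG C i * hGw C w = hGw C (w * adj i)%g.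
Proof. by apply: wprod_asc; have [] := Hecke_rels C n. Qed.

Lemma hG_desc i w : ~~ asc i w ->
  hG C i * hGw C w = q *: hGw C (w * adj i)%g + (q - 1) *: hGw C w.
Proof.
rewrite -asc_adj => h; have := hG_asc h; rewrite mulg_adjK => E.
rewrite -{1}E mulrA -expr2 (hecke_G2 (Hecke_rels C n)) mulrDl -scalerAl mul1r.
by rewrite -scalerAl E.
Qed.

Section Regular.
Variables (m : nat) (e : 'S_n -> 'I_m.+1) (e' : 'I_m.+1 -> 'S_n).
Hypotheses (eK : cancel e e') (e'K : cancel e' e).
Local Notation L := (reg_mx q e e').

Let L_rels : hecke_rels L.
Proof.
split=> [i j ij|i j ij|i]; first exact: reg_mx_far.
  exact: reg_mx_braid.
by rewrite expr2 -[q%:A]/(q *: 1%:M) scalemx1; exact: reg_mx_sqr.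
Qed.

Let rho (x : H) : 'M[A]_m.+1 := pres_eval (P := Hecke_pres C n) L x.

(** Applying F x to the vector of the identity reads off the coordinates of x in the family G_w. *)
Lemma regular_rep : exists F : H -> 'M[A]_m.+1,
  semilinear_rels (@idfun A : {rmorphism A -> A}) F /\
  forall w, F (hGw C w) *m delta_mx (e 1%g) 0 = delta_mx (e w) (0 : 'I_1).
Proof.
exists rho; split; first split=> [|x y|x y|a x].
- exact: (@pres_eval1 _ (Hecke_pres C n) _ _ L_rels).
- exact: (@pres_evalD _ (Hecke_pres C n) _ _ L_rels x y).
- exact: (@pres_evalM _ (Hecke_pres C n) _ _ L_rels x y).
- exact: (@pres_evalZ _ (Hecke_pres C n) _ _ L_rels a x).
elim/perm_asc_ind => [|i w iw IH].
  by rewrite hGw1 [X in X *m _](@pres_eval1 _ (Hecke_pres C n) _ _ L_rels) mul1mx.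
rewrite -hG_asc // [X in X *m _](@pres_evalM _ (Hecke_pres C n) _ _ L_rels).
rewrite -[_ * _]/(_ *m _) -mulmxA [X in _ *m X]IH.
rewrite [X in X *m _](@pres_eval_gen _ (Hecke_pres C n) _ _ L_rels) reg_mxE //.
by rewrite iw scale1r scale0r addr0.
Qed.
End Regular.
End Hecke.

(** A basis together with its coordinate functions as data, so that linear maps can be defined by
    their values on it, as in [mxlift]. *)
Record coords (R : comNzRingType) (V : lmodType R) (I : finType) (P : pred I) (b : I -> V)
    (c : V -> I -> R) : Prop := Coords {
  coords_lin : forall a x y i, c (a *: x + y) i = a * c x i + c y i;
  coords_dual : forall i j, P i -> P j -> c (b i) j = (i == j)%:R;
  coordsK : forall x, x = \sum_(i | P i) c x i *: b i }.

Section LinearMaps.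
Variables (R : comNzRingType) (V W : lmodType R) (f : V -> W).
Hypothesis fl : forall a x y, f (a *: x + y) = a *: f x + f y.

Lemma lin0 : f 0 = 0.
Proof. by have := fl (-1) 0 0; rewrite scaler0 addr0 scaleN1r addNr. Qed.

Lemma linZ a x : f (a *: x) = a *: f x.
Proof. by have := fl a x 0; rewrite lin0 !addr0. Qed.

Lemma linD x y : f (x + y) = f x + f y.
Proof. by have := fl 1 x y; rewrite !scale1r. Qed.

Lemma lin_sum I (r : seq I) (P : pred I) (F : I -> V) :
  f (\sum_(i <- r | P i) F i) = \sum_(i <- r | P i) f (F i).
Proof. exact: (big_morph f linD lin0). Qed.

Lemma lin_sumZ I (r : seq I) (P : pred I) (a : I -> R) (F : I -> V) :
  f (\sum_(i <- r | P i) a i *: F i) = \sum_(i <- r | P i) a i *: f (F i).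
Proof. by rewrite lin_sum; apply: eq_bigr => i _; exact: linZ. Qed.
End LinearMaps.

Lemma coords_of_span (R : comNzRingType) (V : lmodType R) (I : finType) (P : pred I)
    (b : I -> V) (c : V -> I -> R) :
  (forall a x y i, c (a *: x + y) i = a * c x i + c y i) ->
  (forall i j, P i -> P j -> c (b i) j = (i == j)%:R) ->
  (forall x, lspan P b x) -> coords P b c.
Proof.
move=> cl cd sp; split=> // x; have [a xE] := sp x; rewrite {1}xE.
apply: eq_bigr => i Pi; congr (_ *: _); rewrite xE.
rewrite (@lin_sumZ _ V R^o (c^~ i)) => [|z x' y]; last exact: cl.
rewrite (bigD1 i) //= cd // eqxx big1 ?addr0 => [|j /andP[Pj /negPf ji]].
  by rewrite -[LHS]mulr1.
by rewrite cd // ji -[LHS]/(a j * 0) mulr0.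
Qed.

Section ScalarExtensionMore.
Variables (R R' : comNzRingType) (phi : {rmorphism R -> R'}) (B : algType R).
Variable h : exists (D : algType R') (f : B -> D), semilinear_rels phi f.
Local Notation iota := (scext_in h).

Lemma semilinear0 (D : algType R') (f : B -> D) : semilinear_rels phi f -> f 0 = 0.
Proof. by case=> _ fD _ _; apply: (addIr (f 0)); rewrite -fD !add0r. Qed.

Lemma semilinear_sum (D : algType R') (f : B -> D) (I : Type) (r : seq I) (P : pred I)
    (a : I -> R) (b : I -> B) : semilinear_rels phi f ->
  f (\sum_(i <- r | P i) a i *: b i) = \sum_(i <- r | P i) phi (a i) *: f (b i).
Proof.
move=> fs; have [_ fD _ fZ] := fs.
rewrite (big_morph f fD (semilinear0 fs)).
by apply: eq_bigr => i _; exact: fZ.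
Qed.

(** The span is closed under products because [iota] is multiplicative: a product of two images is
    the image of a product in B. *)
Lemma scext_span (I : finType) (P : pred I) (e : I -> B) : (forall x, lspan P e x) ->
  forall y : scalar_ext h, lspan P (fun i => iota (e i)) y.
Proof.
move=> sp; have it := scext_in_rels h; have [_ _ itM _] := it.
have spi b : lspan P (fun i => iota (e i)) (iota b).
  by have [a ->] := sp b; exists (phi \o a); rewrite (semilinear_sum _ _ _ _ it).
elim/pres_ind => [b||x y sx sy|x y [a ->] [b ->]|a x sx].
- exact: spi.
- by have [<- _ _ _] := it; exact: spi.
- exact: lspanD.
- rewrite mulr_suml; apply: lspan_sum => i _; rewrite mulr_sumr; apply: lspan_sum => j _.
  by rewrite -scalerAl -scalerAr -itM; do 2!apply: lspanZ; exact: spi.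
- exact: lspanZ.
Qed.
End ScalarExtensionMore.

(** * The parabolic subalgebra H^mu and its scalar extension *)

Section Parabolic.
Variables (C : fieldType) (d n : nat) (mu : wcomp d n).
Local Notation A := (laurent C).
Local Notation q := (lmon C 1).
Local Notation H := (Hecke C n).
Local Notation Hmu := (Hmu C mu).
Local Notation Hmuv := (Hmuv C mu).
Local Notation hGmu := (hGmu C mu).
Local Notation young := (young mu).
Implicit Types (w u : 'S_n) (i j : 'I_n.-1).

Lemma hGw_adj i : hGw C (adj i) = hG C i.
Proof. by rewrite -[adj i]mul1g -hG_asc ?hGw1 ?mulr1 // /asc invg1 !perm1 /= ltnSn. Qed.

Lemma hGw_mem u : u \in young ->
  hGw C u \in subalg_pred [set hG C i | i in [set i | Jmu mu i]]%classic.
Proof.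
elim/perm_asc_ind: u => [|i u iu IH] uy; apply/asboolP => S Scl GS.
  by rewrite hGw1; case: Scl.
have Ji : Jmu mu i by apply: young_desc uy _; rewrite asc_adj negbK.
rewrite -hG_asc //; have [_ _ SM] := Scl; apply: SM; first by apply: GS; exists i.
have iy : adj i \in young by rewrite young_adj.
have uy' : u \in young by rewrite -(groupMr _ iy).
by have /asboolP := IH uy'; apply.
Qed.

Lemma hGmuE u : u \in young -> subalg_val (hGmu u) = hGw C u.
Proof. by move/hGw_mem => h; exact: (insubdK _ h). Qed.

Lemma subalg_valP (x y : Hmu) : subalg_val x = subalg_val y -> x = y.
Proof. exact: val_inj. Qed.

Lemma subalg_valL a (x y : Hmu) : subalg_val (a *: x + y) = a *: subalg_val x + subalg_val y.
Proof. by []. Qed.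

Lemma hGmu1 : hGmu 1%g = 1.
Proof. by apply: subalg_valP; rewrite hGmuE ?group1 // hGw1. Qed.

Lemma hGmu_asc j u : Jmu mu j -> u \in young -> asc j u ->
  hGmu (adj j) * hGmu u = hGmu (u * adj j)%g.
Proof.
rewrite -young_adj => jy uy ju; apply: subalg_valP.
rewrite [RHS]hGmuE ?groupM // -hG_asc // -hGw_adj -!hGmuE //.
Qed.

Lemma hGmu_sqr j : Jmu mu j ->
  hGmu (adj j) * hGmu (adj j) = q%:A + (q - 1) *: hGmu (adj j).
Proof.
rewrite -young_adj => jy; apply: subalg_valP.
change (subalg_val (hGmu (adj j)) * subalg_val (hGmu (adj j)) =
  q%:A + (q - 1) *: subalg_val (hGmu (adj j))).
by rewrite !hGmuE // hGw_adj -expr2 (hecke_G2 (Hecke_rels C n)).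
Qed.

(** The elements whose left multiplication preserves the span form a subalgebra containing the
    generators, hence all of H^mu; apply them to 1 = G_1. *)
Lemma Hmu_span (x : Hmu) : lspan (fun u => u \in young) hGmu x.
Proof.
pose sp := lspan (fun u => u \in young) (@hGw C n).
suff [a xE] : sp (subalg_val x).
  exists a; apply: subalg_valP; rewrite xE (lin_sumZ subalg_valL).
  by apply: eq_bigr => u uy; rewrite hGmuE.
suff h : forall z, sp z -> sp (subalg_val x * z).
  by rewrite -[subalg_val x]mulr1; apply: h; rewrite -hGw1; apply: lspan_gen; exact: group1.
have /asboolP := valP x.
move=> /(_ [pred y | `[< forall z, sp z -> sp (y * z) >]]) h; apply/asboolP; apply: h.
  split=> [|a y z /asboolP hy /asboolP hz|y z /asboolP hy /asboolP hz]; apply/asboolP => t st.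
  - by rewrite mul1r.
  - by rewrite mulrDl -scalerAl; apply: lspanD; [apply: lspanZ; exact: hy|exact: hz].
  - by rewrite -mulrA; apply: hy; exact: hz.
move=> _ [i Ji <-]; apply/asboolP => _ [a ->].
rewrite mulr_sumr; apply: lspan_sum => u uy; rewrite -scalerAr; apply: lspanZ.
have iy : (u * adj i)%g \in young by rewrite groupM // young_adj.
case: (boolP (asc i u)) => iu; first by rewrite hG_asc //; exact: lspan_gen.
by rewrite hG_desc //; apply: lspanD; apply: lspanZ; exact: lspan_gen.
Qed.

Lemma toHv_semilinear : semilinear_rels (@lsquare C : {rmorphism A -> A}) (@toHv C d n mu).
Proof. exact: scext_in_rels. Qed.

(** [c] comes from the regular representation and [cv] from the same matrices after q := v^2, so one
    construction gives freeness over both rings, with compatible coordinates. *)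
Lemma Hmu_coords_ex : exists c cv,
  [/\ coords (fun u => u \in young) hGmu c,
      coords (fun u => u \in young) (fun u => toHv mu (hGmu u)) cv &
      forall x u, cv (toHv mu x) u = lsquare (c x u)].
Proof.
have N0 : (0 < #|'S_n|)%N by apply/card_gt0P; exists 1%g.
pose m := #|'S_n|.-1; have mE : #|'S_n| = m.+1 by rewrite prednK.
pose e (w : 'S_n) : 'I_m.+1 := cast_ord mE (enum_rank w).
pose e' (k : 'I_m.+1) : 'S_n := enum_val (cast_ord (esym mE) k).
have eK : cancel e e' by move=> w; rewrite /e /e' cast_ordK enum_rankK.
have e'K : cancel e' e by move=> k; rewrite /e /e' enum_valK cast_ordKV.
have [F [[F1 FD FM FZ] FT]] := regular_rep C eK e'K.
pose f (x : Hmu) : 'M[A]_m.+1 := map_mx (@lsquare C) (F (subalg_val x)).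
have fP : semilinear_rels (@lsquare C : {rmorphism A -> A}) f.
  split=> [|x y|x y|a x]; rewrite /f.
  - by rewrite -[subalg_val 1]/1 F1 map_mx1.
  - by rewrite -[subalg_val _]/(subalg_val x + subalg_val y) FD map_mxD.
  - by rewrite -[subalg_val _]/(subalg_val x * subalg_val y) FM map_mxM.
  - by rewrite -[subalg_val _]/(a *: subalg_val x) FZ map_mxZ.
pose Fv (y : Hmuv) : 'M[A]_m.+1 := pres_eval (P := scext_pres (Hmu_ext_nz C mu)) f y.
pose c (x : Hmu) w : A := (F (subalg_val x) *m delta_mx (e 1%g) (0 : 'I_1)) (e w) 0.
pose cv (y : Hmuv) w : A := (Fv y *m delta_mx (e 1%g) (0 : 'I_1)) (e w) 0.
have cvE x u : cv (toHv mu x) u = lsquare (c x u).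
  rewrite /cv /Fv [X in X *m _](@pres_eval_gen _ (scext_pres (Hmu_ext_nz C mu)) _ _ fP) /f /c.
  have -> : delta_mx (e 1%g) (0 : 'I_1) = map_mx (@lsquare C) (delta_mx (e 1%g) (0 : 'I_1)).
    by rewrite map_delta_mx.
  by rewrite -map_mxM mxE map_delta_mx.
have cd u w : u \in young -> c (hGmu u) w = (u == w)%:R.
  move=> uy; rewrite /c hGmuE // FT mxE eqxx andbT eq_sym.
  by rewrite (inj_eq (can_inj eK)).
exists c, cv; split=> //.
- apply: coords_of_span => [a x y w|u w uy _|]; last exact: Hmu_span.
    rewrite /c subalg_valL FD FZ mulmxDl -scalemxAl.
    by rewrite [LHS]mxE [X in X + _ = _]mxE.
  exact: cd.
- apply: coords_of_span => [a x y w|u w uy _|].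
  + rewrite /cv /Fv (@pres_evalD _ (scext_pres (Hmu_ext_nz C mu)) _ _ fP).
    rewrite (@pres_evalZ _ (scext_pres (Hmu_ext_nz C mu)) _ _ fP) mulmxDl -scalemxAl.
    by rewrite [LHS]mxE [X in X + _ = _]mxE.
  + by rewrite cvE cd // rmorph_nat.
  + refine (@scext_span _ _ _ _ (Hmu_ext_nz C mu) _ _ _ Hmu_span).
Qed.

(** The coordinates of [toHv mu x] are those of x after the injective substitution q := v^2. *)
Lemma toHv_inj : injective (@toHv C d n mu).
Proof.
have [c [cv [cP cvP E]]] := Hmu_coords_ex; move=> x y xy.
rewrite (coordsK cP x) (coordsK cP y); apply: eq_bigr => u _; congr (_ *: _).
by apply: lsquare_inj; rewrite -!E xy.
Qed.
End Parabolic.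

(** * Idempotents of the Yokonuma-Hecke algebra *)

(* the sum is unchanged by the cyclic shift s -> s + 1 of its terms *)
Lemma geom_shift (B : pzRingType) (d : nat) (x y : B) : (0 < d)%N ->
  GRing.comm x y -> x ^+ d = 1 -> y ^+ d = 1 ->
  y * (\sum_(s < d) x ^+ s * y ^+ (d - s)) = x * (\sum_(s < d) x ^+ s * y ^+ (d - s)).
Proof.
case: d => // d _ xy xd yd; rewrite !mulr_sumr big_ord_recl [RHS]big_ord_recr /=.
rewrite subn0 subSnn expr0 mul1r yd mulr1 expr1 mulrA -exprS xd mul1r addrC.
congr (_ + _); apply: eq_bigr => i _.
rewrite /bump /= ?add1n mulrA (commrX i.+1 (commr_sym xy)) -mulrA -exprS subSS mulrA -exprS.
by rewrite subSn // ltnW.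
Qed.

Section Roots.
Variables (C : fieldType) (d : nat) (xi : d.-tuple C).
Hypotheses (hd : (0 < d)%N) (xi_uniq : uniq xi) (xi_root : forall i, tnth xi i ^+ d = 1).

Lemma unity_root_mem (a : C) : a ^+ d = 1 -> a \in (xi : seq C).
Proof.
move=> ad; apply/negPn/negP => aN.
have p0 : ('X^d - 1 : {poly C}) != 0 by rewrite -size_poly_eq0 size_XnsubC.
have rt : all (root ('X^d - 1)) (a :: xi).
  rewrite /= /root !(hornerE, hornerXn) ad subrr eqxx /=; apply/allP => b /tnthP[i ->].
  by rewrite /root !(hornerE, hornerXn) xi_root subrr.
have := max_poly_roots p0 rt; rewrite size_XnsubC // cons_uniq aN xi_uniq /= size_tuple.
by move=> /(_ isT); rewrite ltnn.
Qed.

Lemma unity_root_neq0 i : tnth xi i != 0.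
Proof.
apply/eqP => E; have := xi_root i; rewrite E expr0n gtn_eqF //= => /esym/eqP.
by rewrite oner_eq0.
Qed.

(** Some root b has b^s different from 1, else X^s - 1 would have d > s roots. Multiplication by b
    permutes the roots and multiplies the sum by b^s. *)
Lemma unity_root_power_sum s : (0 < s < d)%N -> \sum_(i < d) tnth xi i ^+ s = 0.
Proof.
move=> /andP[s0 sd]; rewrite -(big_tuple 0 +%R xi xpredT (fun a => a ^+ s)).
have [i bi] : exists i, tnth xi i ^+ s != 1.
  apply/existsP; apply: contraLR sd; rewrite negb_exists => /forallP h.
  have p0 : ('X^s - 1 : {poly C}) != 0 by rewrite -size_poly_eq0 size_XnsubC.
  have rt : all (root ('X^s - 1)) xi.
    apply/allP => b /tnthP[j ->]; have := negbNE (h j) => /eqP E.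
    by rewrite /root !(hornerE, hornerXn) E subrr.
  by have := max_poly_roots p0 rt xi_uniq; rewrite size_XnsubC // size_tuple ltnS -leqNgt.
set S := \sum_(_ <- _) _; set b := tnth xi i in bi.
suff : (b ^+ s - 1) * S = 0.
  by move/eqP; rewrite mulf_eq0 subr_eq0 (negPf bi) => /eqP.
rewrite mulrBl mul1r; apply/eqP; rewrite subr_eq0; apply/eqP.
rewrite mulr_sumr; under eq_bigr => a _ do rewrite -exprMn.
rewrite -(big_map (fun a => b * a) xpredT (fun a => a ^+ s)); apply: perm_big.
have bI : injective (fun a => b * a) by apply: mulfI; exact: unity_root_neq0.
apply: uniq_perm => //; first by rewrite map_inj_uniq.
have [] // := uniq_min_size _ (s1 := map (fun a => b * a) xi) (s2 := xi).
- by rewrite map_inj_uniq.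
- move=> _ /mapP[_ /tnthP[j ->] ->]; apply: unity_root_mem.
  by rewrite exprMn !xi_root mulr1.
- by rewrite size_map.
Qed.

(** By [geom_shift] the sum is killed by the difference of the two roots. *)
Lemma unity_root_orth i j : \sum_(s < d) tnth xi i ^+ s * tnth xi j ^+ (d - s) = (d * (i == j))%:R.
Proof.
have [->|ij] := eqVneq i j.
  rewrite muln1 (eq_bigr (fun=> 1)) ?sumr_const ?card_ord // => s _.
  by rewrite -exprD subnKC ?xi_root // ltnW.
have := @geom_shift C d (tnth xi i) (tnth xi j) hd (mulrC _ _) (xi_root i) (xi_root j).
rewrite muln0; set S := \sum_(_ < _) _ => /eqP; rewrite -subr_eq0 -mulrBl mulf_eq0 subr_eq0.
by rewrite [_ == _ in X in X -> _](inj_eq (tuple_uniqP _ xi_uniq)) eq_sym (negPf ij) => /eqP.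
Qed.
End Roots.

Section Idempotents.
Variables (C : fieldType) (d n : nat) (xi : d.-tuple C).
Hypotheses (hd : (0 < d)%N) (dC : d%:R != 0 :> C).
Hypotheses (xi_uniq : uniq xi) (xi_root : forall i, tnth xi i ^+ d = 1).
Local Notation A := (laurent C).
Local Notation q := (lmon C 1).
Local Notation Y := (YH C d n).
Local Notation yt := (yt C d (n := n)).
Local Notation yg := (yg C d (n := n)).
Local Notation chars := {ffun 'I_n -> 'I_d}.
Implicit Types (f : chars) (w : 'S_n) (i : 'I_n.-1) (j : 'I_n).

(** Characters are indexed by the positions of their values in [xi], which makes them a finite type
    to sum over. *)
Definition char_val f : {ffun 'I_n -> C} := [ffun j => tnth xi (f j)].
Definition Ef f : Y := E_elt d (char_val f).

Definition eigproj (t : Y) (a : C) : Y :=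
  lconst d%:R^-1 *: \sum_(s < d) lconst (a ^+ s) *: t ^+ (d - s).

Lemma EfE f : Ef f = \prod_(j < n) eigproj (yt j) (tnth xi (f j)).
Proof. by apply: eq_bigr => j _; rewrite /eigproj ffunE. Qed.

Lemma yt_comm j j' : GRing.comm (yt j) (yt j').
Proof. exact: yh_tt (YH_rels C d n) j j'. Qed.

Lemma yt_d j : yt j ^+ d = 1.
Proof. exact: yh_td (YH_rels C d n) j. Qed.

Lemma eigproj_comm (x t : Y) a : GRing.comm x t -> GRing.comm x (eigproj t a).
Proof.
move=> xt; rewrite /GRing.comm -scalerAr -scalerAl mulr_sumr mulr_suml; congr (_ *: _).
by apply: eq_bigr => s _; rewrite -scalerAr -scalerAl (commrX _ xt).
Qed.

Lemma yt_eigproj j r : yt j * eigproj (yt j) (tnth xi r) =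
  lconst (tnth xi r) *: eigproj (yt j) (tnth xi r).
Proof.
rewrite -scalerAr scalerA mulrC -scalerA; congr (_ *: _).
have sE : \sum_(s < d) lconst (tnth xi r ^+ s) *: yt j ^+ (d - s) =
    \sum_(s < d) (lconst (tnth xi r))%:A ^+ s * yt j ^+ (d - s).
  by apply: eq_bigr => s _; rewrite exprZn expr1n mulr_algl rmorphXn.
rewrite sE geom_shift ?mulr_algl //; last exact: yt_d.
- by rewrite /GRing.comm mulr_algl mulr_algr.
- by rewrite exprZn expr1n -rmorphXn xi_root rmorph1 scale1r.
Qed.

(** After summing over r only s = 0 survives, where t^(d-s) = t^d = 1. *)
Lemma eigproj_sum j : \sum_(r < d) eigproj (yt j) (tnth xi r) = 1.
Proof.
rewrite -scaler_sumr exchange_big /=.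
under eq_bigr => s _ do rewrite -scaler_suml -rmorph_sum.
case: d hd dC xi xi_uniq xi_root (yt_d j) => // d' hd' dC' xi' uxi' rxi' td.
rewrite big_ord_recl /= [X in _ + X]big1 => [|s _].
  rewrite addr0 subn0 td (eq_bigr (fun=> 1)) ?sumr_const ?card_ord // scalerA.
  by rewrite -rmorphM mulVf // rmorph1 scale1r.
by rewrite unity_root_power_sum ?rmorph0 ?scale0r // /bump /= ltnS ltn_ord.
Qed.

Lemma yt_Ef j f : yt j * Ef f = lconst (tnth xi (f j)) *: Ef f.
Proof.
rewrite EfE; have := mem_index_enum j; elim: (index_enum _) => // k s IH.
rewrite inE big_cons => /predU1P[->|js]; first by rewrite mulrA yt_eigproj -scalerAl.
rewrite mulrA (eigproj_comm _ (yt_comm j k)) -mulrA IH //.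
by rewrite -scalerAr.
Qed.

Lemma Ef_yt j f : Ef f * yt j = lconst (tnth xi (f j)) *: Ef f.
Proof.
rewrite -yt_Ef EfE; elim/big_rec: _ => [|k x _ IH]; first by rewrite mul1r mulr1.
by rewrite -mulrA IH mulrA -(eigproj_comm _ (yt_comm j k)) mulrA.
Qed.

Lemma Ef_sum : \sum_f Ef f = 1.
Proof.
under eq_bigr => f _ do rewrite EfE.
rewrite -(bigA_distr_bigA (fun j r => eigproj (yt j) (tnth xi r))).
by apply: big1 => j _; exact: eigproj_sum.
Qed.

Lemma lconst_scaleI (V : lmodType A) (a b : C) (x : V) :
  lconst a *: x = lconst b *: x -> a != b -> x = 0.
Proof.
move=> /eqP; rewrite -subr_eq0 -scalerBl -rmorphB => /eqP E ab.
by rewrite -[x]scale1r -(lconstV (a := a - b)) ?subr_eq0 // -scalerA E scaler0.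
Qed.

Lemma xi_eq r r' : (tnth xi r == tnth xi r') = (r == r').
Proof. exact: (inj_eq (tuple_uniqP _ xi_uniq)). Qed.

(** Moving t_j across x multiplies the product by two different eigenvalues. The case x = 1 gives
    orthogonality, the case x = g_i the commutation rule [yg_Ef]. *)
Lemma Ef_between x f f' j j' : yt j * x = x * yt j' -> f j != f' j' -> Ef f * x * Ef f' = 0.
Proof.
move=> tx; rewrite -xi_eq; apply: lconst_scaleI.
transitivity (Ef f * yt j * x * Ef f'); first by rewrite Ef_yt -!scalerAl.
by rewrite -(mulrA (Ef f)) tx -!mulrA yt_Ef -!scalerAr.
Qed.

Lemma Ef_orth f f' : Ef f * Ef f' = if f == f' then Ef f else 0.
Proof.
have h g g' : g != g' -> Ef g * Ef g' = 0.
  move=> gg'; have /existsP[j jn] : [exists j, g j != g' j].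
    apply: contraR gg'; rewrite negb_exists => /forallP E.
    by apply/eqP/ffunP => j; apply/eqP/negbNE/E.
  by rewrite -[Ef g]mulr1; apply: Ef_between jn; rewrite mulr1 mul1r.
case: eqVneq => [<-|]; last exact: h.
rewrite -[RHS]mulr1 -Ef_sum mulr_sumr (bigD1 f) //= big1 ?addr0 // => g gf.
by apply: h; rewrite eq_sym.
Qed.

Definition char_comp f w : chars := [ffun j => f (w j)].

(** Decompose 1 into idempotents on the left of one side and on the right of the other: by
    [Ef_between] both reduce to the same middle term. *)
Lemma yg_Ef i f : yg i * Ef f = Ef (char_comp f (adj i)) * yg i.
Proof.
have h g g' : g' != char_comp g (adj i) -> Ef g' * yg i * Ef g = 0.
  move=> gg'; have /existsP[j jn] : [exists j, g' j != char_comp g (adj i) j].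
    apply: contraR gg'; rewrite negb_exists => /forallP E.
    by apply/eqP/ffunP => j; apply/eqP/negbNE/E.
  apply: (Ef_between (j := j) (j' := adj i j)); first exact: yh_tg (YH_rels C d n) i j.
  by rewrite ffunE in jn.
transitivity (Ef (char_comp f (adj i)) * yg i * Ef f).
  rewrite -[LHS]mul1r -Ef_sum mulr_suml (bigD1 (char_comp f (adj i))) //= big1 ?addr0 ?mulrA //.
  by move=> g gf; rewrite mulrA h.
rewrite -[RHS]mulr1 -Ef_sum mulr_sumr (bigD1 f) //= [X in _ = _ + X]big1 ?addr0 //.
move=> g gf; apply: h; apply: contraNneq gf => /ffunP E; apply/eqP/ffunP => j.
by have := E (adj i j); rewrite !ffunE -permM adjK perm1.
Qed.

Lemma e_elt_Ef j j' f : e_elt d (yt j) (yt j') * Ef f = (f j == f j')%:R *: Ef f.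
Proof.
have tX k s : yt k ^+ s * Ef f = lconst (tnth xi (f k) ^+ s) *: Ef f.
  elim: s => [|s IH]; first by rewrite !expr0 rmorph1 mul1r scale1r.
  by rewrite exprSr -mulrA yt_Ef -scalerAr IH scalerA -rmorphM exprS.
rewrite /e_elt -scalerAl mulr_suml.
under eq_bigr => s _ do rewrite -mulrA tX -scalerAr tX scalerA mulrC -rmorphM.
rewrite -scaler_suml -rmorph_sum unity_root_orth // scalerA -rmorphM natrM mulrA mulVf // mul1r.
by rewrite rmorph_nat.
Qed.

Lemma gw_asc i w : asc i w -> yg i * gw C d w = gw C d (w * adj i)%g.
Proof. by apply: wprod_asc; have [] := YH_rels C d n. Qed.

Lemma gw1 : gw C d (1%g : 'S_n) = 1.
Proof. by apply: wprod1; have [] := YH_rels C d n. Qed.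

Lemma gw_desc i w : ~~ asc i w -> yg i * gw C d w =
  q *: gw C d (w * adj i)%g + (q - 1) *: (e_elt d (yt (lo i)) (yt (hi i)) * gw C d w).
Proof.
rewrite -asc_adj => h; have := gw_asc h; rewrite mulg_adjK => E.
rewrite -{1}E mulrA -expr2 (yh_g2 (YH_rels C d n)) mulrDl -scalerAl mul1r.
by rewrite -scalerAl -mulrA E.
Qed.

Lemma gw_Ef w f : gw C d w * Ef f = Ef (char_comp f w^-1%g) * gw C d w.
Proof.
elim/perm_asc_ind: w => [|i w iw IH].
  rewrite gw1 mul1r mulr1; congr Ef; apply/ffunP => j; rewrite ffunE invg1 perm1 //.
rewrite -gw_asc // -mulrA IH mulrA yg_Ef mulrA; congr (Ef _ * _ * _).
by apply/ffunP => j; rewrite !ffunE invMg adjV permM.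
Qed.

(** The span contains 1 and is stable under left multiplication by the generators; e_i acts on each
    idempotent by 0 or 1, so the quadratic relation stays inside it. *)
Lemma YH_span x : lspan xpredT (fun fw : chars * 'S_n => Ef fw.1 * gw C d fw.2) x.
Proof.
pose sp := lspan xpredT (fun fw : chars * 'S_n => Ef fw.1 * gw C d fw.2).
have sg f w : sp (Ef f * gw C d w) by exact: (@lspan_gen _ _ _ xpredT _ (f, w)).
suff h : forall z, sp z -> sp (x * z).
  rewrite -[x]mulr1; apply: h; rewrite -Ef_sum; apply: lspan_sum => f _.
  by have := sg f 1%g; rewrite gw1 mulr1.
elim/pres_ind: x => [[i|j]||x y hx hy|x y hx hy|a x hx] z sz.
- have [a ->] := sz; rewrite mulr_sumr; apply: lspan_sum => -[f w] _ /=.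
  rewrite -scalerAr; apply: lspanZ; rewrite mulrA -[pres_gen _]/(yg i) yg_Ef -mulrA.
  case: (boolP (asc i w)) => iw; first by rewrite gw_asc //; exact: sg.
  rewrite gw_desc // mulrDr -!scalerAr; apply: lspanD; apply: lspanZ; first exact: sg.
  rewrite mulrA; set g := char_comp _ _.
  have -> : Ef g * e_elt d (yt (lo i)) (yt (hi i)) = e_elt d (yt (lo i)) (yt (hi i)) * Ef g.
    have c k : GRing.comm (Ef g) (yt k) by rewrite /GRing.comm Ef_yt yt_Ef.
    rewrite /e_elt -scalerAr -scalerAl mulr_sumr mulr_suml; congr (_ *: _); apply: eq_bigr => s _.
    by apply: commrM; apply: commrX; exact: c.
  by rewrite e_elt_Ef -scalerAl; apply: lspanZ; exact: sg.
- have [a ->] := sz; rewrite mulr_sumr; apply: lspan_sum => -[f w] _ /=.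
  rewrite -scalerAr; apply: lspanZ; rewrite mulrA -[pres_gen _]/(yt j) yt_Ef.
  by rewrite -scalerAl; apply: lspanZ; exact: sg.
- by rewrite mul1r.
- by rewrite mulrDl; apply: lspanD; [exact: hx|exact: hy].
- by rewrite -mulrA; apply: hx; exact: hy.
- by rewrite -scalerAl; apply: lspanZ; exact: hx.
Qed.
End Idempotents.

(** * Induced monomial matrices *)

Section Monomial.
Variables (R : comNzRingType) (K : algType R) (m : nat).
Implicit Types (s t : 'I_m -> 'I_m) (D E : 'I_m -> K).

Definition monmx s D : 'M[K]_m := \matrix_(k, l) if k == s l then D l else 0.

Lemma monmxM s D t E : monmx s D *m monmx t E = monmx (s \o t) (fun l => D (t l) * E l).
Proof.
apply/matrixP => k l; rewrite !mxE (bigD1 (t l)) //= big1 ?addr0 => [|j jl].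
  by rewrite !mxE eqxx; case: ifP => // _; rewrite mul0r.
by rewrite !mxE (negPf jl) mulr0.
Qed.

Lemma monmx1 : 1%:M = monmx id (fun=> 1).
Proof. by apply/matrixP => k l; rewrite !mxE; case: (k == l). Qed.

Lemma eq_monmx s D t E : s =1 t -> D =1 E -> monmx s D = monmx t E.
Proof. by move=> st DE; apply/matrixP => k l; rewrite !mxE st DE. Qed.

Lemma scmxMl c (M N : 'M[K]_m) : scmx c M *m N = scmx c (M *m N).
Proof.
apply/matrixP => k l; rewrite !mxE scaler_sumr; apply: eq_bigr => j _.
by rewrite !mxE scalerAl.
Qed.

Lemma scmxMr c (M N : 'M[K]_m) : M *m scmx c N = scmx c (M *m N).
Proof.
apply/matrixP => k l; rewrite !mxE scaler_sumr; apply: eq_bigr => j _.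
by rewrite !mxE scalerAr.
Qed.

Lemma scmxA a b (M : 'M[K]_m) : scmx a (scmx b M) = scmx (a * b) M.
Proof. by apply/matrixP => k l; rewrite !mxE scalerA. Qed.

Lemma scmx1 (M : 'M[K]_m) : scmx 1 M = M.
Proof. by apply/matrixP => k l; rewrite !mxE scale1r. Qed.

Lemma scmxDr a (M N : 'M[K]_m) : scmx a (M + N) = scmx a M + scmx a N.
Proof. by apply/matrixP => k l; rewrite !mxE scalerDr. Qed.

Lemma scmxDl (M : 'M[K]_m) a b : scmx (a + b) M = scmx a M + scmx b M.
Proof. by apply/matrixP => k l; rewrite !mxE scalerDl. Qed.
End Monomial.

(* MathComp only makes 'M[K]_m a module over K; these copies of it are a module *)
(* and an algebra over the base ring R                                          *)
Definition mxmod (R : comNzRingType) (K : algType R) (m : nat) : Type := 'M[K]_m.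
Section MatrixModule.
Variables (R : comNzRingType) (K : algType R) (m : nat).
HB.instance Definition _ := GRing.Zmodule.on (mxmod K m).
HB.instance Definition _ := GRing.Zmodule_isLmodule.Build R (mxmod K m)
  (@scmxA R K m) (@scmx1 R K m) (@scmxDr R K m) (@scmxDl R K m).
End MatrixModule.

Definition mxalg (R : comNzRingType) (K : algType R) (m : nat) : Type := 'M[K]_m.+1.
Section MatrixAlgebra.
Variables (R : comNzRingType) (K : algType R) (m : nat).
HB.instance Definition _ := GRing.NzRing.on (mxalg K m).
HB.instance Definition _ := GRing.Zmodule_isLmodule.Build R (mxalg K m)
  (@scmxA R K m.+1) (@scmx1 R K m.+1) (@scmxDr R K m.+1) (@scmxDl R K m.+1).
Fact mxalg_scaleAl (a : R) (M N : mxalg K m) : a *: (M * N) = a *: M * N.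
Proof. exact: esym (scmxMl a M N). Qed.
HB.instance Definition _ := GRing.Lmodule_isLalgebra.Build R (mxalg K m) mxalg_scaleAl.
Fact mxalg_scaleAr (a : R) (M N : mxalg K m) : a *: (M * N) = M * (a *: N).
Proof. exact: esym (scmxMr a M N). Qed.
HB.instance Definition _ := GRing.Lalgebra_isAlgebra.Build R (mxalg K m) mxalg_scaleAr.
End MatrixAlgebra.

Section Induced.
Variables (d n : nat) (mu : wcomp d n) (m : nat) (p : 'I_m -> 'S_n).
Hypothesis pP : coset_reps mu p.
Variables (R : comNzRingType) (q : R) (K : algType R) (h : 'S_n -> K).
Hypothesis h1 : h 1%g = 1.
Hypothesis h_asc : forall j u, Jmu mu j -> u \in young mu -> asc j u ->
  h (adj j) * h u = h (u * adj j)%g.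
Hypothesis h_sqr : forall j, Jmu mu j -> h (adj j) * h (adj j) = q%:A + (q - 1) *: h (adj j).
Local Notation cact := (cact pP).
Local Notation cof := (cof pP).
Implicit Types (w : 'S_n) (k l : 'I_m) (i j : 'I_n.-1) (s t : seq 'I_n.-1).

(** The value q^e h(u) for w = s_i, where 2e = 1 - l(u) + l(p_k) - l(p_l) and k = [cact (adj i) l]:
    e = 0 if the coset is fixed, and e = 1 or 0 if the representative gets longer or shorter. *)
Definition ind_coef i l : K :=
  if cact (adj i) l == l then h (cof (adj i) l)
  else if (ell (p l) < ell (p (cact (adj i) l)))%N then q%:A else 1.

Definition ind_mx i : 'M[K]_m := monmx (cact (adj i)) (ind_coef i).

Lemma ind_mxE i : ind_mx i = monmx (cact (adj i)) (ind_coef i).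
Proof. by []. Qed.

Fixpoint word_coef s l : K :=
  if s is i :: s' then ind_coef i (cact (word_perm s') l) * word_coef s' l else 1.

(** By the second part of [word_coefE], neither the truncated subtraction nor the halving loses
    anything. *)
Definition expo w l : nat :=
  (ell w + ell (p (cact w l)) - (ell (cof w l) + ell (p l)))./2.

(* each step of a reduced word of w either stays in a coset and multiplies the *)
(* element of the Young subgroup by a generator, raising its length, or moves  *)
(* to another coset and changes the length of its representative by one        *)
Lemma word_coefE s l : reduced s ->
  word_coef s l = q ^+ expo (word_perm s) l *: h (cof (word_perm s) l) /\
  (expo (word_perm s) l * 2 + (ell (cof (word_perm s) l) + ell (p l)) =
     ell (word_perm s) + ell (p (cact (word_perm s) l)))%N.
Proof.
suff H : reduced s -> exists2 e, word_coef s l = q ^+ e *: h (cof (word_perm s) l) &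
  (e * 2 + (ell (cof (word_perm s) l) + ell (p l)) =
     ell (word_perm s) + ell (p (cact (word_perm s) l)))%N.
  move=> /H[e -> E]; suff -> : expo (word_perm s) l = e by [].
  by rewrite /expo -E addnK muln2 doubleK.
elim: s => [|i s IH].
  by exists 0%N; rewrite /= ?cof1 ?cact1 ?h1 ?expr0 ?scale1r // !ell1.
rewrite reduced_cons => /andP[iw rs]; have [e sE eE] := IH rs.
rewrite /= sE /pmul; set w := word_perm s in iw eE *; clearbody w.
set k := cact w l in eE *; rewrite cactM cofM -/k ell_asc // /ind_coef.
case: eqVneq => [kk|kk].
  have [j [Jj cE pl ph]] := cact_fixed kk.
  have ju : asc j (cof w l) by exact: asc_cof pl ph.
  exists e; last by rewrite kk cE ell_asc //; lia.
  by rewrite cE -scalerAr h_asc // cof_young.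
have [pE cE] := cact_moved kk; rewrite cE mulg1.
have lE : (asc i (p k) /\ ell (p (cact (adj i) k)) = (ell (p k)).+1) \/
    (~~ asc i (p k) /\ ell (p k) = (ell (p (cact (adj i) k))).+1).
  rewrite pE; case: (boolP (asc i (p k))) => a; [left|right]; split=> //.
    exact: ell_asc.
  exact: ell_desc.
case: lE => -[a lE]; rewrite lE.
  exists e.+1; last by lia.
  by rewrite ltnSn mulr_algl scalerA -exprS.
exists e; last by rewrite lE in eE; lia.
by rewrite ltnNge leqnSn /= mul1r.
Qed.

(** This yields the braid relations, whose two sides are reduced words of one permutation. *)
Lemma word_coef_reduced s t l : reduced s -> reduced t -> word_perm s = word_perm t ->
  word_coef s l = word_coef t l.
Proof.
move=> rs rt st; have [-> _] := word_coefE l rs; have [-> _] := word_coefE l rt.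
by rewrite st.
Qed.

Lemma asc1 i : asc i (1%g : 'S_n).
Proof. by rewrite /asc invg1 !perm1 /= ltnSn. Qed.

Lemma ind_mx_far i j : (i.+1 < j)%N || (j.+1 < i)%N ->
  ind_mx i *m ind_mx j = ind_mx j *m ind_mx i.
Proof.
move=> ij; have ji : (j.+1 < i)%N || (i.+1 < j)%N by rewrite orbC.
rewrite !ind_mxE !monmxM; apply: eq_monmx => l; first by rewrite /= -!cactM (adj_far ij).
have := @word_coef_reduced [:: i; j] [:: j; i] l.
rewrite /= /pmul (mul1g (adj i)) (mul1g (adj j)) cact1.
rewrite (mulr1 (ind_coef i l)) (mulr1 (ind_coef j l)).
apply.
- by rewrite !reduced_cons reduced_nil !word_perm_cons asc_far // !asc1.
- by rewrite !reduced_cons reduced_nil !word_perm_cons asc_far // !asc1.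
- by rewrite (adj_far ij).
Qed.

Lemma ind_mx_braid i j : j = i.+1 :> nat ->
  ind_mx i *m ind_mx j *m ind_mx i = ind_mx j *m ind_mx i *m ind_mx j.
Proof.
move=> ij; have E := braid_pos ij.
rewrite !ind_mxE !monmxM; apply: eq_monmx => l.
  by rewrite /= -!cactM !mulgA (adj_braid ij).
have := @word_coef_reduced [:: i; j; i] [:: j; i; j] l.
rewrite /= /pmul (mul1g (adj i)) (mul1g (adj j)) cact1.
rewrite (mulr1 (ind_coef i l)) (mulr1 (ind_coef j l)).
rewrite (mulrA (ind_coef i _)) (mulrA (ind_coef j _)) !cactM; apply.
- rewrite !reduced_cons reduced_nil !word_perm_cons asc1 /= !mul1g.
  by rewrite /asc !invMg !adjV !permM !(E, adjL, adjR) /= ij; lia.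
- rewrite !reduced_cons reduced_nil !word_perm_cons asc1 /= !mul1g.
  by rewrite /asc !invMg !adjV !permM !(E, adjL, adjR) /= ij; lia.
- by rewrite (adj_braid ij).
Qed.

(** The diagonal factor is the image of e_i. On a fixed coset the relation is that of a generator of
    H^mu; on a pair of exchanged cosets e_i vanishes and the two entries are 1 and q, with product
    q. *)
Lemma ind_mx_sqr i : ind_mx i *m ind_mx i =
  scmx q 1%:M + scmx (q - 1)
    (monmx id (fun l => (bl mu p l (lo i) == bl mu p l (hi i))%:R) *m ind_mx i).
Proof.
rewrite !ind_mxE !monmxM monmx1; apply/matrixP => k l; rewrite !mxE /= -(cact_adj_bl pP).
rewrite -cactM adjK cact1 /ind_coef -cactM adjK cact1.
case: (eqVneq (cact (adj i) l) l) => [E|N].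
  rewrite E; case: eqVneq => [_|_]; last by rewrite !scaler0 addr0.
  have [j [Jj cE _ _]] := cact_fixed E.
  by rewrite mulr1n mul1r cE h_sqr.
rewrite mul0r if_same scaler0 addr0 eq_sym.
case: eqVneq => [_|_]; last by rewrite scaler0.
have [-> _] := cact_moved N.
case: (boolP (asc i (p l))) => [/ell_asc ->|/ell_desc ->].
  by rewrite ltnSn ltnNge leqnSn /= mul1r.
by rewrite ltnSn ltnNge leqnSn /= mulr1.
Qed.
End Induced.

Section Diagonal.
Variables (R : comNzRingType) (K : algType R) (m : nat).
Implicit Types D E : 'I_m.+1 -> K.

Definition dg D : mxalg K m := monmx id D.

Lemma eq_dg D E : D =1 E -> dg D = dg E.
Proof. by move=> DE; apply: eq_monmx. Qed.

Lemma dg1 : dg (fun=> 1) = 1.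
Proof. by rewrite -[RHS]/(1%:M) monmx1. Qed.

Lemma dgM D E : dg D * dg E = dg (fun l => D l * E l).
Proof. exact: monmxM. Qed.

Lemma dgX D s : dg D ^+ s = dg (fun l => D l ^+ s).
Proof.
elim: s => [|s IH]; first by rewrite expr0 -dg1; apply: eq_dg => l.
by rewrite exprS IH dgM; apply: eq_dg => l; rewrite exprS.
Qed.

Lemma dgZ a D : a *: dg D = dg (fun l => a *: D l).
Proof. by apply/matrixP => k l; rewrite !mxE; case: ifP => // _; rewrite scaler0. Qed.

Lemma dgD D E : dg D + dg E = dg (fun l => D l + E l).
Proof. by apply/matrixP => k l; rewrite !mxE; case: ifP => // _; rewrite addr0. Qed.

Lemma dg0 : dg (fun=> 0) = 0.
Proof. by apply/matrixP => k l; rewrite !mxE; case: ifP. Qed.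

Lemma dg_sum I (r : seq I) (D : I -> 'I_m.+1 -> K) :
  \sum_(i <- r) dg (D i) = dg (fun l => \sum_(i <- r) D i l).
Proof.
elim: r => [|i r IH]; first by rewrite big_nil -dg0; apply: eq_dg => l; rewrite big_nil.
by rewrite big_cons IH dgD; apply: eq_dg => l; rewrite big_cons.
Qed.
End Diagonal.

(** Spelled out with [scmx] because the algebra [mxalg] exists only in positive size, whereas m is
    arbitrary here. *)
Record mx_hom (R : comNzRingType) (Y K : algType R) m (f : Y -> 'M[K]_m) : Prop := MxHom {
  mx_hom1 : f 1 = 1%:M;
  mx_homD : forall x y, f (x + y) = f x + f y;
  mx_homM : forall x y, f (x * y) = f x *m f y;
  mx_homZ : forall a x, f (a *: x) = scmx a (f x) }.

(** * The matrix representation of Y attached to a composition *)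

Section Representation.
Variables (C : fieldType) (d n : nat) (xi : d.-tuple C).
Hypotheses (hd : (0 < d)%N) (dC : d%:R != 0 :> C).
Hypotheses (xi_uniq : uniq xi) (xi_root : forall i, tnth xi i ^+ d = 1).
Variable mu : wcomp d n.
Local Notation A := (laurent C).
Local Notation q := (lmon C 1).
Local Notation Y := (YH C d n).
Local Notation Hmu := (Hmu C mu).
Local Notation Hmuv := (Hmuv C mu).
Local Notation hGmu := (hGmu C mu).
Local Notation to_v := (@lsquare C : {rmorphism A -> A}).

Section Cosets.
Variables (m : nat) (p : 'I_m -> 'S_n).
Hypothesis pP : coset_reps mu p.
Implicit Types (w u : 'S_n) (k l : 'I_m) (i : 'I_n.-1) (j : 'I_n).

Lemma bl_lt k j : (bl mu p k j < d)%N.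
Proof. by have [] := blockP mu (ltn_ord ((p k)^-1%g j)). Qed.

Definition orbit_char k : {ffun 'I_n -> 'I_d} := [ffun j => Ordinal (bl_lt k j)].

Lemma orbit_char_inj : injective orbit_char.
Proof.
move=> k l /ffunP E; apply: (bl_inj pP) => j.
by have /(congr1 val) := E j; rewrite !ffunE.
Qed.

Definition rep_g i : 'M[Hmu]_m := ind_mx pP q hGmu i.
Definition rep_t j : 'M[Hmu]_m := monmx id (fun l => (lconst (tnth xi (orbit_char l j)))%:A).
End Cosets.

Section Positive.
Variables (m : nat) (p : 'I_m.+1 -> 'S_n).
Hypothesis pP : coset_reps mu p.
Local Notation rep_g := (rep_g pP).
Local Notation rep_t := (rep_t p).
Local Notation B := (mxalg Hmu m).

Lemma rep_tE j : rep_t j = dg (fun l => (lconst (tnth xi (orbit_char p l j)))%:A) :> B.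
Proof. by []. Qed.

Lemma e_elt_rep j j' : e_elt d (rep_t j : B) (rep_t j') =
  dg (fun l => (bl mu p l j == bl mu p l j')%:R).
Proof.
rewrite /e_elt; under eq_bigr => s _ do rewrite !rep_tE !dgX dgM.
rewrite dg_sum dgZ; apply: eq_dg => l.
under eq_bigr => s _ do rewrite !exprZn !expr1n -scalerAl mul1r scalerA -!rmorphXn -rmorphM.
rewrite -scaler_suml -rmorph_sum (unity_root_orth hd xi_uniq xi_root) scalerA -rmorphM.
rewrite natrM mulrA mulVf // mul1r rmorph_nat scaler_nat.
by rewrite !ffunE -val_eqE.
Qed.

Lemma rep_rels : yh_rels d (rep_g : _ -> B) (rep_t : _ -> B).
Proof.
have h1 := hGmu1 C mu; have ha := @hGmu_asc C d n mu; have hs := @hGmu_sqr C d n mu.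
split=> [i j ij|i j ij|i j|i j|j|i].
- refine (@ind_mx_far _ _ _ _ _ pP _ q _ _ h1 ha _ _ ij).
- refine (@ind_mx_braid _ _ _ _ _ pP _ q _ _ h1 ha _ _ ij).
- rewrite !rep_tE !dgM; apply: eq_dg => l.
  by rewrite -!scalerAl !mul1r !scalerA mulrC.
- apply: (etrans (monmxM _ _ _ _)); apply: (etrans _ (esym (monmxM _ _ _ _))).
  apply: eq_monmx => // l /=; rewrite mulr_algl mulr_algr; congr (lconst (tnth xi _) *: _).
  rewrite !ffunE; apply: val_inj => /=.
  by rewrite -[in LHS](permKV (adj i) j) adjV (bl_cact pP).
- rewrite rep_tE dgX -dg1; apply: eq_dg => l.
  by rewrite exprZn expr1n -rmorphXn xi_root rmorph1 scale1r.
- by rewrite expr2 e_elt_rep; exact: (ind_mx_sqr pP hs).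
Qed.

Let f (z : 'I_n.-1 + 'I_n) : B := match z with inl i => rep_g i | inr j => rep_t j end.
Let fP : @rels _ (YH_pres C d n) B f := rep_rels.
Let F (x : Y) : 'M[Hmu]_m.+1 := pres_eval (P := YH_pres C d n) f x.

Let F_hom : mx_hom F.
Proof.
split=> [|x y|x y|a x].
- exact: (@pres_eval1 _ (YH_pres C d n) _ _ fP).
- exact: (@pres_evalD _ (YH_pres C d n) _ _ fP).
- exact: (@pres_evalM _ (YH_pres C d n) _ _ fP).
- exact: (@pres_evalZ _ (YH_pres C d n) _ _ fP).
Qed.

Let Fm (x : Y) : mxalg Hmuv m := map_mx (toHv mu) (F x).
Let FmP : semilinear_rels to_v Fm.
Proof.
have [t1 tD tM tZ] := toHv_semilinear C mu; have [F1 FD FM FZ] := F_hom.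
have t0 := semilinear0 (toHv_semilinear C mu).
split=> [|x y|x y|a x]; apply/matrixP => k l; rewrite mxE.
- by rewrite F1 !mxE; case: (k == l); rewrite ?t1 ?t0.
- by rewrite FD !mxE tD.
- rewrite FM !mxE (big_morph _ tD t0); apply: eq_bigr => j _.
  by rewrite !mxE tM.
- by rewrite FZ !mxE tZ.
Qed.

Lemma rep_ex_pos : exists F Fv,
  [/\ mx_hom (F : Y -> 'M[Hmu]_m.+1),
      forall i, F (yg C d i) = rep_g i, forall j, F (yt C d j) = rep_t j,
      mx_hom (Fv : YHv C d n -> 'M[Hmuv]_m.+1) &
      forall x, Fv (toYv x) = map_mx (toHv mu) (F x)].
Proof.
exists F, (fun y => pres_eval (P := scext_pres (YH_ext_nz C d n)) Fm y).
split=> [||||x]; first exact: F_hom.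
- move=> i; exact: (@pres_eval_gen _ (YH_pres C d n) _ _ fP (inl i)).
- move=> j; exact: (@pres_eval_gen _ (YH_pres C d n) _ _ fP (inr j)).
- split=> [|x y|x y|a x].
  + exact: (@pres_eval1 _ (scext_pres (YH_ext_nz C d n)) _ _ FmP).
  + exact: (@pres_evalD _ (scext_pres (YH_ext_nz C d n)) _ _ FmP).
  + exact: (@pres_evalM _ (scext_pres (YH_ext_nz C d n)) _ _ FmP).
  + exact: (@pres_evalZ _ (scext_pres (YH_ext_nz C d n)) _ _ FmP).
- exact: (@pres_eval_gen _ (scext_pres (YH_ext_nz C d n)) _ _ FmP).
Qed.
End Positive.

Lemma rep_ex m (p : 'I_m -> 'S_n) (pP : coset_reps mu p) : exists F Fv,
  [/\ mx_hom (F : Y -> 'M[Hmu]_m),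
      forall i, F (yg C d i) = rep_g pP i, forall j, F (yt C d j) = rep_t p j,
      mx_hom (Fv : YHv C d n -> 'M[Hmuv]_m) &
      forall x, Fv (toYv x) = map_mx (toHv mu) (F x)].
Proof.
(* Size 0 is impossible, since the identity lies in some coset. *)
case: m p pP => [|m] p pP; last exact: rep_ex_pos.
by have /existsP[[]] := reps_ex pP 1%g.
Qed.

Section Values.
Variables (m : nat) (p : 'I_m -> 'S_n).
Hypothesis pP : coset_reps mu p.
Variable F : Y -> 'M[Hmu]_m.
Hypothesis Fh : mx_hom F.
Hypothesis Fg : forall i, F (yg C d i) = rep_g pP i.
Hypothesis Ft : forall j, F (yt C d j) = rep_t p j.
Implicit Types (w u : 'S_n) (k l : 'I_m) (f : {ffun 'I_n -> 'I_d}).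
Local Notation Ef := (Ef (n := n) xi).
Local Notation cact := (cact pP).
Local Notation cof := (cof pP).

(** Left multiplication by t_j scales row k by the value of chi_k and, [Ef f] being an eigenvector,
    also by the value of f. *)
Lemma rep_Ef_eq0 f k l : orbit_char p k != f -> F (Ef f) k l = 0.
Proof.
move=> kf; have /existsP[j jn] : [exists j, orbit_char p k j != f j].
  apply: contraR kf; rewrite negb_exists => /forallP E.
  by apply/eqP/ffunP => j; apply/eqP/negbNE/E.
apply: (lconst_scaleI _ (a := tnth xi (orbit_char p k j)) (b := tnth xi (f j))); last first.
  by rewrite xi_eq.
have := congr1 (fun x => F x k l) (yt_Ef hd xi_root j f).
rewrite (mx_homM Fh) (mx_homZ Fh) Ft [RHS]mxE => <-.
rewrite [RHS]mxE (bigD1 k) //= big1 ?addr0 => [|k' k'k].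
  by rewrite mxE eqxx mulr_algl.
by rewrite mxE eq_sym (negPf k'k) mul0r.
Qed.

Lemma rep_Ef_eq0r f k l : orbit_char p l != f -> F (Ef f) k l = 0.
Proof.
move=> kf; have /existsP[j jn] : [exists j, orbit_char p l j != f j].
  apply: contraR kf; rewrite negb_exists => /forallP E.
  by apply/eqP/ffunP => j; apply/eqP/negbNE/E.
apply: (lconst_scaleI _ (a := tnth xi (orbit_char p l j)) (b := tnth xi (f j))); last first.
  by rewrite xi_eq.
have := congr1 (fun x => F x k l) (Ef_yt hd xi_root j f).
rewrite (mx_homM Fh) (mx_homZ Fh) Ft [RHS]mxE => <-.
rewrite [RHS]mxE (bigD1 l) //= big1 ?addr0 => [|k' k'k].
  by rewrite mxE eqxx mulr_algr.
by rewrite mxE (negPf k'k) mulr0.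
Qed.

Lemma rep0 : F 0 = 0.
Proof. by apply: (addIr (F 0)); rewrite -(mx_homD Fh) !add0r. Qed.

Lemma rep_sum I (r : seq I) (P : pred I) (x : I -> Y) :
  F (\sum_(i <- r | P i) x i) = \sum_(i <- r | P i) F (x i).
Proof. exact: (big_morph F (mx_homD Fh) rep0). Qed.

(** The idempotents sum to 1, and only this one can contribute to the entry (k, k), which is
    therefore 1. *)
Lemma rep_Ef k : F (Ef (orbit_char p k)) = delta_mx k k.
Proof.
have kk : F (Ef (orbit_char p k)) k k = 1.
  have := congr1 (fun x => F x k k) (Ef_sum n hd dC xi_uniq xi_root).
  rewrite (mx_hom1 Fh) rep_sum [RHS]mxE eqxx summxE.
  rewrite (bigD1 (orbit_char p k)) //= big1 ?addr0 // => f fk.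
  by rewrite rep_Ef_eq0 // eq_sym.
apply/matrixP => a b; rewrite [RHS]mxE.
case: (eqVneq a k) => [->|ak] /=; last by rewrite rep_Ef_eq0 // (inj_eq (orbit_char_inj pP)).
case: (eqVneq b k) => [->|bk] /=; first exact: kk.
by rewrite rep_Ef_eq0r // (inj_eq (orbit_char_inj pP)).
Qed.

Lemma rep_word s : F (\prod_(i <- s) yg C d i) =
  monmx (cact (word_perm s)) (word_coef pP q hGmu s).
Proof.
elim: s => [|i s IH].
  by rewrite big_nil (mx_hom1 Fh) monmx1; apply: eq_monmx => l //; rewrite cact1.
rewrite big_cons (mx_homM Fh) IH Fg [rep_g _ _]ind_mxE monmxM; apply: eq_monmx => // l.
by rewrite word_perm_cons cactM.
Qed.

Lemma rep_Ef_gw w l : F (Ef (orbit_char p (cact w l)) * gw C d w) =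
  (q ^+ expo pP w l *: hGmu (cof w l)) *: delta_mx (cact w l) l.
Proof.
rewrite (mx_homM Fh) rep_Ef [F (gw C d w)]rep_word word_perm_redword.
have [h1 ha] := (hGmu1 C mu, @hGmu_asc C d n mu).
have [E _] := word_coefE pP q h1 ha l (reduced_redword w).
rewrite word_perm_redword in E.
apply/matrixP => a b; rewrite [LHS]mxE [RHS]mxE (bigD1 (cact w l)) //= big1 ?addr0 => [|k kN].
  rewrite !mxE eqxx andbT; case: (eqVneq a) => _ /=; last by rewrite mul0r mulr0.
  rewrite mul1r; case: (eqVneq b l) => [->|bl]; first by rewrite eqxx mulr1 E.
  rewrite mulr0; case: eqP => // ab; case/eqP: bl.
  have := congr1 (cact w^-1%g) ab.
  by rewrite -!cactM mulgV !cact1 => ->.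
by rewrite !mxE (negPf kN) andbF mul0r.
Qed.

Lemma expoE w l : (expo pP w l * 2 + (ell (cof w l) + ell (p l)) =
  ell w + ell (p (cact w l)))%N.
Proof.
have [h1 ha] := (hGmu1 C mu, @hGmu_asc C d n mu).
have [_] := word_coefE pP q h1 ha l (reduced_redword w).
by rewrite word_perm_redword.
Qed.
End Values.
End Representation.

(** * Orbits of characters *)

Section Fibres.
Variables (n d : nat).
Implicit Types f g : {ffun 'I_n -> 'I_d}.

Lemma perm_of_fibres f g : (forall r, #|[set j | f j == r]| = #|[set j | g j == r]|) ->
  exists w : 'S_n, forall j, f j = g (w j).
Proof.
move=> fg; have cE (h : {ffun 'I_n -> 'I_d}) r :
    count_mem r [tuple h j | j < n] = #|[set j | h j == r]|.
  rewrite /= count_map cardE -size_filter; congr size.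
  by rewrite enumT; apply: eq_filter => j; rewrite !inE.
have /tuple_permP[w wE] : perm_eq [tuple f j | j < n] [tuple g j | j < n].
  by apply/allP => r _; rewrite /= -!/(count_mem _ _) !cE fg.
exists w => j; have := congr1 (fun s => nth (f j) s j) wE.
by rewrite -!tnth_nth !tnth_mktuple.
Qed.

Lemma card_fibres f : (\sum_(r < d) #|[set j | f j == r]| = n)%N.
Proof.
under eq_bigr => r _ do rewrite -sum1_card.
rewrite -[RHS]card_ord -sum1_card (partition_big f xpredT) //=.
by apply: eq_bigr => r _; apply: eq_bigl => j; rewrite inE.
Qed.
End Fibres.

Section Orbits.
Variables (d n : nat).
Implicit Types (mu : wcomp d n) (f : {ffun 'I_n -> 'I_d}).

Lemma parts_inj mu mu' : (forall r, nth 0%N (parts mu) r = nth 0%N (parts mu') r) -> mu = mu'.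
Proof.
move=> E; apply/val_inj/eq_from_tnth => r; apply: val_inj; have := E r.
by rewrite !(nth_map ord0) ?size_tuple // -!tnth_nth.
Qed.

Lemma card_orbit_char mu m (p : 'I_m -> 'S_n) k (r : 'I_d) :
  #|[set j | orbit_char mu p k j == r]| = nth 0%N (parts mu) r.
Proof.
rewrite -card_block -[RHS](card_imset _ (@perm_inj _ (p k))); apply: eq_card => j.
rewrite inE ffunE -val_eqE /=; apply/idP/imsetP => [h|[x xr ->]].
  by exists ((p k)^-1%g j); rewrite ?permKV // inE.
by rewrite /bl permK; rewrite inE in xr.
Qed.

Lemma fibre_card_lt f r : (#|[set j | f j == r]| < n.+1)%N.
Proof. by rewrite ltnS -[X in (_ <= X)%N]card_ord max_card. Qed.

Lemma fibre_parts_sum f :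
  sumn [seq val x | x <- [tuple Ordinal (fibre_card_lt f r) | r < d]] == n.
Proof.
rewrite sumnE big_map big_tuple; apply/eqP; rewrite -[RHS](card_fibres f).
by apply: eq_bigr => r _; rewrite tnth_mktuple.
Qed.

(** The composition of fibre sizes; it labels the orbit of the character. *)
Definition char_type f : wcomp d n :=
  exist (fun mu : d.-tuple 'I_n.+1 => sumn [seq val x | x <- mu] == n) _ (fibre_parts_sum f).

Lemma char_type_parts f (r : 'I_d) : nth 0%N (parts (char_type f)) r = #|[set j | f j == r]|.
Proof.
rewrite (nth_map ord0) ?size_tuple // -[nth _ _ _](tnth_nth ord0 (val (char_type f)) r).
by rewrite tnth_mktuple.
Qed.

Lemma char_type_orbit mu m (p : 'I_m -> 'S_n) k : char_type (orbit_char mu p k) = mu.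
Proof.
apply: parts_inj => r; case: (ltnP r d) => rd; last by rewrite !nth_default ?size_parts.
by rewrite (char_type_parts _ (Ordinal rd)) card_orbit_char.
Qed.

(** The character f and the standard one [b0] have equal fibre sizes, so f = b0 o w for some w, and
    k is the coset of w^-1. *)
Lemma orbit_char_ex f m (p : 'I_m -> 'S_n) : coset_reps (char_type f) p ->
  exists k, orbit_char (char_type f) p k = f.
Proof.
move=> pP.
pose b0 : {ffun 'I_n -> 'I_d} :=
  [ffun x : 'I_n => Ordinal (let: And3 h _ _ := blockP (char_type f) (ltn_ord x) in h)].
have [w wE] : exists w : 'S_n, forall j, f j = b0 (w j).
  apply: perm_of_fibres => r; rewrite -char_type_parts -card_block.
  by apply: eq_card => j; rewrite !inE ffunE -val_eqE.
have /existsP[k] := reps_ex pP w^-1%g; rewrite -groupV invMg !invgK => /youngP wk.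
exists k; apply/ffunP => j; apply: val_inj; rewrite ffunE wE ffunE /= /bl.
by have := wk ((p k)^-1%g j); rewrite permM permKV => ->.
Qed.
End Orbits.

(** * The isomorphism *)

Lemma scmxE (R : comNzRingType) (K : algType R) m c (M : 'M[K]_m) k l :
  scmx c M k l = c *: M k l.
Proof. exact: mxE. Qed.

Lemma toYv_semilinear (C : fieldType) (d n : nat) :
  semilinear_rels (@lsquare C : {rmorphism laurent C -> laurent C}) (@toYv C d n).
Proof. exact: scext_in_rels. Qed.

(** * Linear maps on matrices given by their values on a basis *)

Section MatrixBasis.
Variables (R : comNzRingType) (V : lmodType R) (K : algType R) (m : nat).
Variables (I : finType) (P : pred I) (h : I -> K) (c : K -> I -> R).
Hypothesis cP : coords P h c.
Variable ee : 'I_m -> 'I_m -> I -> V.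

(** Used twice: with values in Y it is the inverse of the representation, with values in the scalar
    extension it is [tPhi]. *)
Definition mxlift (M : 'M[K]_m) : V :=
  \sum_k \sum_l \sum_(u | P u) c (M k l) u *: ee k l u.

Lemma mxlift_lin a (M N : 'M[K]_m) : mxlift (scmx a M + N) = a *: mxlift M + mxlift N.
Proof.
rewrite /mxlift scaler_sumr -big_split; apply: eq_bigr => k _.
rewrite scaler_sumr -big_split; apply: eq_bigr => l _.
rewrite scaler_sumr -big_split; apply: eq_bigr => u _ /=.
by rewrite !mxE (coords_lin cP) scalerDl scalerA.
Qed.

Lemma coords0 u : c 0 u = 0.
Proof.
by have := coords_lin cP (-1) 0 0 u; rewrite scaler0 addr0 mulN1r addNr.
Qed.

Lemma mxlift_gen k l u : P u -> mxlift (h u *: delta_mx k l) = ee k l u.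
Proof.
move=> Pu; rewrite /mxlift (bigD1 k) //= [X in _ + X]big1 ?addr0 => [|k' kk]; last first.
  apply: big1 => l' _; apply: big1 => u' _.
  by rewrite !mxE (negPf kk) mulr0 coords0 scale0r.
rewrite (bigD1 l) //= [X in _ + X]big1 ?addr0 => [|l' ll]; last first.
  by apply: big1 => u' _; rewrite !mxE (negPf ll) andbF mulr0 coords0 scale0r.
rewrite (bigD1 u) //= [X in _ + X]big1 ?addr0 => [|u' /andP[Pu' uu]].
  by rewrite !mxE !eqxx mulr1 (coords_dual cP) // eqxx scale1r.
by rewrite !mxE !eqxx mulr1 (coords_dual cP) // eq_sym (negPf uu) scale0r.
Qed.

Lemma mx_expand (M : 'M[K]_m) :
  M = \sum_k \sum_l \sum_(u | P u) scmx (c (M k l) u) (h u *: delta_mx k l).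
Proof.
apply/matrixP => a b; rewrite summxE (bigD1 a) //= [X in _ + X]big1 => [|k ka]; last first.
  rewrite summxE; apply: big1 => l _; rewrite summxE; apply: big1 => u _.
  by rewrite !mxE eq_sym (negPf ka) mulr0 scaler0.
rewrite addr0 summxE (bigD1 b) //= [X in _ + X]big1 => [|l lb]; last first.
  rewrite summxE; apply: big1 => u _.
  by rewrite !mxE [b == l]eq_sym (negPf lb) andbF mulr0 scaler0.
rewrite addr0 summxE {1}(coordsK cP (M a b)); apply: eq_bigr => u _.
by rewrite !mxE !eqxx mulr1.
Qed.

Lemma mxlift_uniq (f : 'M[K]_m -> V) :
  (forall a M N, f (scmx a M + N) = a *: f M + f N) ->
  (forall k l u, P u -> f (h u *: delta_mx k l) = ee k l u) -> f =1 mxlift.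
Proof.
move=> fl fE M; have fl' : forall a (M N : mxmod K m), f (a *: M + N) = a *: f M + f N by exact: fl.
rewrite {1}(mx_expand M) (@lin_sum _ (mxmod K m) _ f fl'); apply: eq_bigr => k _.
rewrite (@lin_sum _ (mxmod K m) _ f fl'); apply: eq_bigr => l _.
rewrite (@lin_sum _ (mxmod K m) _ f fl'); apply: eq_bigr => u Pu.
by rewrite [LHS](@linZ _ (mxmod K m) _ f fl') fE.
Qed.

Lemma mxliftK (f : V -> 'M[K]_m) :
  (forall a x y, f (a *: x + y) = scmx a (f x) + f y) ->
  (forall k l u, P u -> f (ee k l u) = h u *: delta_mx k l) -> cancel mxlift f.
Proof.
move=> fl fE M; have fl' : forall a x y, f (a *: x + y) = a *: (f x : mxmod K m) + f y by exact: fl.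
rewrite /mxlift [LHS](@lin_sum _ V (mxmod K m) f fl') [RHS]mx_expand; apply: eq_bigr => k _.
rewrite [LHS](@lin_sum _ V (mxmod K m) f fl'); apply: eq_bigr => l _.
rewrite [LHS](@lin_sum _ V (mxmod K m) f fl'); apply: eq_bigr => u Pu.
by rewrite [LHS](@linZ _ V (mxmod K m) f fl') fE.
Qed.
End MatrixBasis.

(** * The maps attached to a single composition *)

Section Component.
Variables (C : fieldType) (d n : nat) (xi : d.-tuple C).
Hypotheses (hd : (0 < d)%N) (dC : d%:R != 0 :> C).
Hypotheses (xi_uniq : uniq xi) (xi_root : forall i, tnth xi i ^+ d = 1).
Variable pi : forall mu : wcomp d n, 'I_(mnum mu) -> 'S_n.
Arguments pi : clear implicits.
Hypothesis pi_reps : forall mu, min_coset_reps (pi mu).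
Variable mu : wcomp d n.
Local Notation A := (laurent C).
Local Notation q := (lmon C 1).
Local Notation Y := (YH C d n).
Local Notation Hmu := (Hmu C mu).
Local Notation Hmuv := (Hmuv C mu).
Local Notation hGmu := (hGmu C mu).
Local Notation m := (mnum mu).
Local Notation p := (pi mu).
Local Notation to_v := (@lsquare C : {rmorphism A -> A}).
Local Notation Ef := (Ef (n := n) xi).
Local Notation oc := (orbit_char mu p).
Local Notation Emu := (Emu xi pi mu).
Implicit Types (w u : 'S_n) (k l : 'I_m).

Let pP : coset_reps mu p := min_coset_repsP (pi_reps mu).
Local Notation cact := (cact pP).
Local Notation cof := (cof pP).

Lemma charkE k : chark xi pi k = char_val xi (oc k).
Proof.
by apply/ffunP => j; rewrite !ffunE (tnth_nth 0).
Qed.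

Lemma EmuE : Emu = \sum_k Ef (oc k).
Proof. by apply: eq_bigr => k _; rewrite charkE. Qed.

Lemma Emu_orbit k : Emu * Ef (oc k) = Ef (oc k).
Proof.
rewrite EmuE mulr_suml (bigD1 k) //= big1 => [|l lk].
  by rewrite (Ef_orth hd dC xi_uniq xi_root) eqxx addr0.
by rewrite (Ef_orth hd dC xi_uniq xi_root) (inj_eq (orbit_char_inj pP)) (negPf lk).
Qed.

Lemma Emu_other f : char_type f != mu -> Emu * Ef f = 0.
Proof.
move=> fmu; rewrite EmuE mulr_suml big1 // => k _; rewrite (Ef_orth hd dC xi_uniq xi_root).
by case: eqP => // E; rewrite -E char_type_orbit eqxx in fmu.
Qed.

(** In this form the sum of all the E_mu is a regrouping of [Ef_sum] by type. *)
Lemma Emu_sumE : Emu = \sum_(f | char_type f == mu) Ef f.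
Proof.
rewrite -[LHS]mulr1 -(Ef_sum n hd dC xi_uniq xi_root) mulr_sumr.
rewrite (bigID (fun f => char_type f == mu)) /= [X in _ + X]big1 ?addr0 => [|f]; last first.
  exact: Emu_other.
apply: eq_bigr => f /eqP fmu; have := @orbit_char_ex d n f; rewrite fmu => /(_ _ _ pP)[k <-].
exact: Emu_orbit.
Qed.

(** In function notation p_k u p_l^-1; for fixed l this inverts w |-> ([cact w l], [cof w l]). *)
Definition coset_perm k l u : 'S_n := ((p l)^-1 * (u * p k))%g.

Lemma cact_coset_perm k l u : u \in young mu -> cact (coset_perm k l u) l = k.
Proof. by move=> uy; apply: cact_eq; rewrite /coset_perm !mulgA mulgV mul1g mulgK. Qed.

Lemma cof_coset_perm k l u : u \in young mu -> cof (coset_perm k l u) l = u.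
Proof.
by move=> uy; rewrite /cof cact_coset_perm // /coset_perm !mulgA mulgV mul1g mulgK.
Qed.

Lemma coset_perm_cof w l : coset_perm (cact w l) l (cof w l) = w.
Proof. by rewrite /coset_perm -cof_eq mulKg. Qed.

(** The power of q is chosen so that F sends this element exactly to G_u M_(k,l). *)
Definition basisY k l u : Y :=
  lmon C (- (expo pP (coset_perm k l u) l)%:Z) *: (Ef (oc k) * gw C d (coset_perm k l u)).

Lemma lmon_exp e : q ^+ e = lmon C e%:Z.
Proof. by elim: e => [|e IH]; rewrite ?lmon0 // exprS IH -lmonD. Qed.

Lemma corner_span a : lspan (fun klu => klu.2 \in young mu)
  (fun klu : 'I_m * 'I_m * 'S_n => basisY klu.1.1 klu.1.2 klu.2) (Emu * a).
Proof.
have [b ->] := YH_span hd dC xi_uniq xi_root a; rewrite mulr_sumr.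
apply: lspan_sum => -[f w] _ /=; rewrite -scalerAr mulrA; apply: lspanZ.
case: (eqVneq (char_type f) mu) => [fmu|/Emu_other->]; last by rewrite mul0r; exact: lspan0.
have [k <-] : exists k, oc k = f.
  by have := @orbit_char_ex d n f; rewrite fmu => /(_ _ _ pP).
rewrite Emu_orbit; have [l <-] : exists l, cact w l = k.
  by exists (cact w^-1%g k); rewrite -cactM mulVg cact1.
have -> : Ef (oc (cact w l)) * gw C d w =
    lmon C (expo pP w l)%:Z *: basisY (cact w l) l (cof w l).
  by rewrite /basisY coset_perm_cof scalerA lmonK scale1r.
apply: lspanZ; have := @lspan_gen _ _ _ (fun klu => klu.2 \in young mu)
  (fun klu : 'I_m * 'I_m * 'S_n => basisY klu.1.1 klu.1.2 klu.2) (cact w l, l, cof w l).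
by apply; exact: cof_young.
Qed.

Lemma Emu_basisY k l u : Emu * basisY k l u = basisY k l u.
Proof. by rewrite /basisY -scalerAr mulrA Emu_orbit. Qed.

Section Rep.
Variables (F : Y -> 'M[Hmu]_m) (Fv : YHv C d n -> 'M[Hmuv]_m).
Hypothesis Fh : mx_hom F.
Hypothesis Fg : forall i, F (yg C d i) = rep_g C pP i.
Hypothesis Ft : forall j, F (yt C d j) = rep_t xi mu p j.
Hypothesis Fvh : mx_hom Fv.
Hypothesis FvE : forall x, Fv (toYv x) = map_mx (toHv mu) (F x).
Variables (c : Hmu -> 'S_n -> A) (cv : Hmuv -> 'S_n -> A).
Hypothesis cP : coords (fun u => u \in young mu) hGmu c.
Hypothesis cvP : coords (fun u => u \in young mu) (fun u => toHv mu (hGmu u)) cv.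
Hypothesis cvE : forall x u, cv (toHv mu x) u = lsquare (c x u).

Lemma F_lin a x y : F (a *: x + y) = scmx a (F x) + F y.
Proof. by rewrite (mx_homD Fh) (mx_homZ Fh). Qed.

Lemma F_basisY k l u : u \in young mu -> F (basisY k l u) = hGmu u *: delta_mx k l.
Proof.
move=> uy; rewrite (mx_homZ Fh).
have := rep_Ef_gw hd dC xi_uniq xi_root Fh Fg Ft (coset_perm k l u) l.
rewrite cact_coset_perm // cof_coset_perm // => ->.
apply/matrixP => a b; rewrite !mxE -!scalerAl scalerA lmon_exp lmonNK.
by rewrite scale1r.
Qed.

Lemma F_Emu : F Emu = 1%:M.
Proof.
rewrite EmuE (rep_sum Fh) mx1_sum_delta; apply: eq_bigr => k _.
exact: (rep_Ef hd dC xi_uniq xi_root pP Fh Ft).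
Qed.

Definition rep_inv := mxlift (fun u => u \in young mu) c basisY.

Lemma rep_invK : cancel rep_inv F.
Proof. apply: (mxliftK cP) => *; [exact: F_lin|exact: F_basisY]. Qed.

Lemma Emu_rep_inv M : Emu * rep_inv M = rep_inv M.
Proof.
rewrite mulr_sumr; apply: eq_bigr => k _; rewrite mulr_sumr; apply: eq_bigr => l _.
by rewrite mulr_sumr; apply: eq_bigr => u _; rewrite -scalerAr Emu_basisY.
Qed.

(** By linearity it is enough to check the spanning family [basisY], which F sends to the basis
    defining [rep_inv]. *)
Lemma FK a : rep_inv (F (Emu * a)) = Emu * a.
Proof.
have lin b x y : rep_inv (F (b *: x + y)) = b *: rep_inv (F x) + rep_inv (F y).
  by rewrite F_lin [LHS](mxlift_lin cP).
have [b ->] := corner_span a; rewrite (lin_sumZ lin); apply: eq_bigr => -[[k l] u] uy.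
by rewrite /= F_basisY // [X in _ *: X](mxlift_gen cP).
Qed.

Lemma F_Emul a : F (Emu * a) = F a.
Proof. by rewrite (mx_homM Fh) F_Emu mul1mx. Qed.

Lemma diagE (b : 'I_m -> A) k l :
  (\sum_k (b k)%:A *: delta_mx k k : 'M[Hmuv]_m) k l = if k == l then (b k)%:A else 0.
Proof.
rewrite summxE (bigD1 k) //= big1 ?addr0 => [|j jk].
  by rewrite !mxE eqxx /= eq_sym; case: eqP; rewrite ?mulr1 ?mulr0.
by rewrite !mxE eq_sym (negPf jk) mulr0.
Qed.

Lemma diag_mull (b : 'I_m -> A) (M : 'M[Hmuv]_m) k l :
  ((\sum_k (b k)%:A *: delta_mx k k) *m M) k l = b k *: M k l.
Proof.
rewrite mxE; under eq_bigr => j _ do rewrite diagE.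
rewrite (bigD1 k) //= big1 ?addr0 => [|j jk]; first by rewrite eqxx mulr_algl.
by rewrite eq_sym (negPf jk) mul0r.
Qed.

Lemma diag_mulr (b : 'I_m -> A) (M : 'M[Hmuv]_m) k l :
  (M *m (\sum_k (b k)%:A *: delta_mx k k)) k l = b l *: M k l.
Proof.
rewrite mxE; under eq_bigr => j _ do rewrite diagE.
rewrite (bigD1 l) //= big1 ?addr0 => [|j jl]; first by rewrite eqxx mulr_algr.
by rewrite (negPf jl) mulr0.
Qed.

Lemma diag_conjE (b b' : 'I_m -> A) (M : 'M[Hmuv]_m) k l :
  ((\sum_k (b k)%:A *: delta_mx k k) *m M *m (\sum_k (b' k)%:A *: delta_mx k k)) k l =
  (b k * b' l) *: M k l.
Proof. by rewrite diag_mulr diag_mull scalerA mulrC. Qed.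

Definition lell k : int := (ell (p k))%:Z.

Lemma conjU_entry (M : 'M[Hmuv]_m) k l :
  (Umu C pi mu *m M *m Umu_inv C pi mu) k l = lmon C (lell k - lell l) *: M k l.
Proof. by rewrite diag_conjE -lmonD. Qed.

Lemma conjUV_entry (M : 'M[Hmuv]_m) k l :
  (Umu_inv C pi mu *m M *m Umu C pi mu) k l = lmon C (lell l - lell k) *: M k l.
Proof. by rewrite diag_conjE -lmonD addrC. Qed.

(** An explicit solution of [tPsi_spec], obtained by undoing the conjugation by U_mu. *)
Definition tF (y : YHv C d n) : 'M[Hmuv]_m :=
  Umu_inv C pi mu *m Fv y *m Umu C pi mu.

Lemma tF_lin a x y : tF (a *: x + y) = scmx a (tF x) + tF y.
Proof.
apply/matrixP => k l; have -> : (scmx a (tF x) + tF y) k l = a *: tF x k l + tF y k l.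
  by rewrite mxE scmxE.
rewrite !conjUV_entry (mx_homD Fvh) (mx_homZ Fvh).
by rewrite mxE scmxE scalerDr !scalerA mulrC.
Qed.

Lemma expo_int w l : (expo pP w l).*2%:Z =
  (ell w)%:Z + lell (cact w l) - (ell (cof w l))%:Z - lell l.
Proof.
have := expoE C pP w l; rewrite muln2 /lell => /(congr1 Posz).
by rewrite !PoszD => E; lia.
Qed.

Lemma lsquare_exp e : lsquare (q ^+ e) = lmon C e.*2%:Z.
Proof. by rewrite lmon_exp lsquare_monn. Qed.

Lemma chark_act k l w : char_act w (chark xi pi l) = chark xi pi k -> cact w l = k.
Proof.
rewrite !charkE => /ffunP E; apply: (orbit_char_inj pP); apply/ffunP => j.
have := E j; rewrite !ffunE => /(tuple_uniqP _ xi_uniq) <-.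
by apply: val_inj; rewrite /= -[in LHS](permKV w j) (bl_cact pP).
Qed.

Lemma tF_spec : tPsi_spec xi pi tF.
Proof.
split=> [a x y _ _|k l w]; first exact: tF_lin.
move=> /chark_act wl /=.
have -> : pmul (pmul (p k)^-1%g w) (p l) = cof w l by rewrite /cof wl /pmul mulgA.
rewrite charkE -[E_elt _ _]/(Ef (oc k)) -{1}wl.
apply/matrixP => a b; rewrite conjUV_entry FvE.
rewrite (rep_Ef_gw hd dC xi_uniq xi_root Fh Fg Ft) wl !mxE.
have [t1 tD tM tZ] := toHv_semilinear C mu; have t0 := semilinear0 (toHv_semilinear C mu).
case: (eqVneq a k) => [->|_] /=; last by rewrite !mulr0 t0 scaler0.
case: (eqVneq b l) => [->|_] /=; last by rewrite !mulr0 t0 scaler0.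
rewrite !mulr1 tZ scalerA -[to_v (q ^+ _)]/(lsquare _) lsquare_exp -lmonD.
(* The conjugation contributes l(p_l) - l(p_k), which cancels these terms of 2 e and leaves l(w) -
   l(u). *)
rewrite expo_int wl /vdiff; congr (lmon _ _ *: _).
by lia.
Qed.

(** Two solutions of [tPsi_spec] agree on the images of the family [basisY], hence on all elements
    that it spans. *)
Lemma tPsiE x : tPsi xi pi mu (toYv (Emu * x)) = tF (toYv (Emu * x)).
Proof.
have [y1 yD yM yZ] := toYv_semilinear C d n.
have sp : tPsi_spec xi pi (tPsi xi pi mu).
  apply: (@xgetPex _ (fun=> 0 : 'M[Hmuv]_m) [set f | tPsi_spec xi pi f]%classic).
  by exists tF; exact: tF_spec.
move: (tPsi xi pi mu) sp => f [fl fE]; have [gl gE] := tF_spec.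
have c0 : corner (toYv Emu) 0 by exists 0 => //; rewrite mulr0.
have cD a y z : corner (toYv Emu) y -> corner (toYv Emu) z -> corner (toYv Emu) (a *: y + z).
  by move=> [y' _ <-] [z' _ <-]; exists (a *: y' + z') => //; rewrite mulrDr -scalerAr.
have f0 : f 0 = 0.
  have := fl (-1) 0 0 c0 c0; rewrite scaler0 addr0 => ->.
  by apply/matrixP => k l; rewrite !mxE scaleN1r addNr.
have g0 : tF 0 = 0.
  have := gl (-1) 0 0 c0 c0; rewrite scaler0 addr0 => ->.
  by apply/matrixP => k l; rewrite !mxE scaleN1r addNr.
have [b ->] := corner_span x.
rewrite (semilinear_sum _ _ _ _ (toYv_semilinear C d n)).
(* Linearity of [f] is known only inside the corner, so membership is carried through the
   induction. *)
set S := \sum_(i | _) _; suff [] : corner (toYv Emu) S /\ f S = tF S by [].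
rewrite {}/S; elim/big_rec: _ => [|[[k l] u] y /= uy [cy E]]; first by rewrite f0 g0.
have cb : corner (toYv Emu) (toYv (basisY k l u)).
  by exists (toYv (basisY k l u)) => //; rewrite -yM Emu_basisY.
split; first exact: cD.
rewrite fl // gl // E; congr (scmx _ _ + _).
pose v := coset_perm k l u.
have vk : char_act v (chark xi pi l) = chark xi pi k.
  rewrite !charkE; apply/ffunP => j; rewrite !ffunE; congr (tnth xi _); apply: val_inj => /=.
  by rewrite -(cact_coset_perm k l uy) -[in RHS](permKV v j) (bl_cact pP).
have cE : corner (toYv Emu) (toYv (E_elt d (chark xi pi k) * gw C d v)).
  exists (toYv (E_elt d (chark xi pi k) * gw C d v)) => //.
  by rewrite -yM mulrA charkE Emu_orbit.
have Z (f' : YHv C d n -> 'M[Hmuv]_m)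
    (fl' : forall c x y, corner (toYv Emu) x -> corner (toYv Emu) y ->
       f' (c *: x + y) = scmx c (f' x) + f' y)
    (f'0 : f' 0 = 0) a y' : corner (toYv Emu) y' -> f' (a *: y') = scmx a (f' y').
  by move=> cy'; have := fl' a y' 0 cy' c0; rewrite f'0 !addr0.
rewrite /basisY yZ -/v -[Ef (oc k)]/(E_elt d (char_val xi (oc k))) -charkE.
rewrite (Z f fl f0) // (Z tF gl g0) //.
by rewrite (fE k l v vk) (gE k l v vk).
Qed.

Definition basisYv k l u : YHv C d n :=
  let w := pmul (pmul (p k) u) (p l)^-1%g in
  vdiff C u w *: toYv (E_elt d (chark xi pi k) * gw C d w * E_elt d (chark xi pi l)).

(** Freeness of the scalar extension of H^mu gives both existence and uniqueness of a solution of
    [tPhi_spec]. *)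
Lemma tPhiE M : tPhi xi pi mu M = mxlift (fun u => u \in young mu) cv basisYv M.
Proof.
have sp : tPhi_spec xi pi (mxlift (fun u => u \in young mu) cv basisYv).
  by split=> [a M' N|k l u uy]; [exact: (mxlift_lin cvP)|exact: (mxlift_gen cvP)].
have : tPhi_spec xi pi (tPhi xi pi mu).
  apply: (@xgetPex _ (fun=> 0 : YHv C d n) [set f | tPhi_spec xi pi f]%classic).
  by exists (mxlift (fun u => u \in young mu) cv basisYv).
by move=> [fl fE]; apply: (mxlift_uniq cvP).
Qed.

(** The right-hand idempotent becomes E_(chi_k) when moved across g_w and is absorbed; the exponents
    of v add up to the even number -2 e. *)
Lemma basisYvE k l u : u \in young mu ->
  lmon C (lell l - lell k) *: basisYv k l u = toYv (basisY k l u).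
Proof.
move=> uy; have [y1 yD yM yZ] := toYv_semilinear C d n.
rewrite /basisYv /basisY -/(coset_perm k l u); set v := coset_perm k l u.
rewrite !charkE -![E_elt d _]/(Ef _) -mulrA (gw_Ef hd dC xi_uniq xi_root) mulrA.
have -> : char_comp (oc l) v^-1 = oc k.
  apply/ffunP => j; rewrite !ffunE; apply: val_inj => /=.
  by rewrite -(cact_coset_perm k l uy) -[in RHS](permKV v j) (bl_cact pP).
rewrite (Ef_orth hd dC xi_uniq xi_root) eqxx yZ scalerA /vdiff -lmonD.
rewrite -[to_v _]/(lsquare _) lsquare_lmonN; congr (_ *: _).
rewrite expo_int cact_coset_perm // cof_coset_perm //; congr (lmon _ _).
by ring.
Qed.

Lemma tPhi_conj M :
  tPhi xi pi mu (Umu_inv C pi mu *m map_mx (toHv mu) M *m Umu C pi mu) = toYv (rep_inv M).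
Proof.
have [y1 yD yM yZ] := toYv_semilinear C d n.
have y0 := semilinear0 (toYv_semilinear C d n).
rewrite tPhiE /rep_inv /mxlift.
rewrite [RHS](big_morph (@toYv C d n) yD y0); apply: eq_bigr => k _.
rewrite [RHS](big_morph (@toYv C d n) yD y0); apply: eq_bigr => l _.
rewrite [RHS](big_morph (@toYv C d n) yD y0); apply: eq_bigr => u uy.
rewrite conjUV_entry mxE.
have := coords_lin cvP (lmon C (lell l - lell k)) (toHv mu (M k l)) 0 u.
rewrite (coords0 cvP) !addr0 => ->.
rewrite yZ -basisYvE // cvE mulrC -scalerA; exact: erefl.
Qed.

Lemma tF_conj x : Umu C pi mu *m tF x *m Umu_inv C pi mu = Fv x.
Proof.
apply/matrixP => k l; rewrite conjU_entry conjUV_entry scalerA -lmonD.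
by rewrite addrA subrK subrr lmon0 scale1r.
Qed.
End Rep.
End Component.

(** * Descent to C[q, q^-1] and the sum over all compositions *)

Section Decomposition.
Variables (C : fieldType) (d n : nat) (xi : d.-tuple C).
Hypotheses (hd : (0 < d)%N) (dC : d%:R != 0 :> C).
Hypotheses (xi_uniq : uniq xi) (xi_root : forall i, tnth xi i ^+ d = 1).
Variable pi : forall mu : wcomp d n, 'I_(mnum mu) -> 'S_n.
Arguments pi : clear implicits.
Hypothesis pi_reps : forall mu, min_coset_reps (pi mu).
Local Notation Y := (YH C d n).
Implicit Types mu : wcomp d n.

Lemma map_toHv_inj mu : injective (@map_mx _ _ (@toHv C d n mu) (mnum mu) (mnum mu)).
Proof.
move=> M N /matrixP E; apply/matrixP => k l; apply: (@toHv_inj C d n mu).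
by have := E k l; rewrite !mxE.
Qed.

(** That F factors through [toYv] follows from its extension Fv and the injectivity of [toHv]; it is
    the input of [toYv_inj]. *)
Lemma component_ex mu : exists (F : Y -> 'M[Hmu C mu]_(mnum mu)) G,
  [/\ mx_hom F, F (Emu xi pi mu) = 1%:M, cancel G F &
      forall a, G (F a) = Emu xi pi mu * a] /\
  [/\ forall M, Emu xi pi mu * G M = G M,
      forall x y, toYv x = toYv y -> F x = F y,
      forall a, conjU xi pi mu (Emu xi pi mu * a) = map_mx (toHv mu) (F a) &
      forall M, conjUV xi pi M = toYv (G M)].
Proof.
have [F [Fv [Fh Fg Ft Fvh FvE]]] :=
  rep_ex hd dC xi_uniq xi_root (min_coset_repsP (pi_reps mu)).
have [c [cv [cP cvP cvE]]] := Hmu_coords_ex C mu.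
exists F, (rep_inv xi pi_reps c); split; split.
- exact: Fh.
- exact: (F_Emu hd dC xi_uniq xi_root pi_reps Fh Ft).
- exact: (rep_invK hd dC xi_uniq xi_root Fh Fg Ft cP).
- move=> a; rewrite -(F_Emul hd dC xi_uniq xi_root pi_reps Fh Ft).
  exact: (FK hd dC xi_uniq xi_root Fh Fg Ft cP).
- exact: Emu_rep_inv.
- by move=> x y xy; apply: (@map_toHv_inj mu); rewrite -!FvE xy.
- move=> a; rewrite /conjU (tPsiE hd dC xi_uniq xi_root Fh Fg Ft Fvh FvE) tF_conj FvE.
  by rewrite (F_Emul hd dC xi_uniq xi_root pi_reps Fh Ft).
- move=> M; exact: (tPhi_conj hd dC xi_uniq xi_root pi_reps cvP cvE).
Qed.

Lemma Emu_orth mu mu' : mu != mu' -> Emu xi pi mu * Emu xi pi mu' = 0.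
Proof.
move=> N; rewrite [in X in _ * X]EmuE mulr_sumr; apply: big1 => k _.
by apply: Emu_other; rewrite // char_type_orbit eq_sym.
Qed.

Lemma Emu_sum : \sum_mu Emu xi pi mu = 1.
Proof.
under eq_bigr => mu _ do rewrite (Emu_sumE hd dC xi_uniq xi_root pi_reps).
by rewrite -(Ef_sum n hd dC xi_uniq xi_root) [RHS](partition_big (@char_type d n) xpredT).
Qed.

(** An element is the sum of its parts E_mu x, and each of them is recovered from F x, which depends
    only on [toYv x]. *)
Lemma toYv_inj : injective (@toYv C d n).
Proof.
move=> x y xy; rewrite -[x]mul1r -[y]mul1r -Emu_sum !mulr_suml; apply: eq_bigr => mu _.
have [F [G [[_ _ _ GF] [_ tF _ _]]]] := component_ex mu.
by rewrite -!GF (tF _ _ xy).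
Qed.

Lemma component_iso mu :
  (forall a : Y,
     map_mx (toHv mu) (Psi xi pi mu (Emu xi pi mu * a)) =
     Umu C pi mu *m tPsi xi pi mu (toYv (Emu xi pi mu * a)) *m Umu_inv C pi mu) /\
  (forall M : 'M[Hmu C mu]_(mnum mu),
     toYv (Phi xi pi mu M) =
     tPhi xi pi mu (Umu_inv C pi mu *m map_mx (toHv mu) M *m Umu C pi mu)) /\
  corner_alg_iso (Emu xi pi mu) (fun c M => scmx c M) (Psi xi pi mu) (Phi xi pi mu) /\
  (forall M, Emu xi pi mu * Phi xi pi mu M = Phi xi pi mu M).
Proof.
have [F [G [[Fh FE GK GF] [EG _ cU cV]]]] := component_ex mu.
have PsiP a : map_mx (toHv mu) (Psi xi pi mu (Emu xi pi mu * a)) =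
    conjU xi pi mu (Emu xi pi mu * a).
  apply: (@xgetPex _ 0 [set M | map_mx (toHv mu) M = conjU xi pi mu (_ * a)]%classic).
  by exists (F a); rewrite /= cU.
(* Injectivity of [toHv] makes the matrix chosen by [Psi] unique, as [toYv_inj] does for [Phi]
   below. *)
have PsiE a : Psi xi pi mu (Emu xi pi mu * a) = F a.
  by apply: (@map_toHv_inj mu); rewrite PsiP cU.
have PhiP M : toYv (Phi xi pi mu M) = conjUV xi pi M.
  apply: (@xgetPex _ 0 [set x | toYv x = conjUV xi pi M]%classic).
  by exists (G M); rewrite /= cV.
have PhiE M : Phi xi pi mu M = G M by apply: toYv_inj; rewrite PhiP cV.
split; first exact: PsiP.
split; first exact: PhiP.
split; last by move=> M; rewrite PhiE.
split=> [_ _ [a _ <-] [b _ <-]|c _ [a _ <-]|_ _ [a _ <-] [b _ <-]||M|_ [a _ <-]|M].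
- by rewrite -mulrDr !PsiE (mx_homD Fh).
- by rewrite scalerAr !PsiE (mx_homZ Fh).
- by rewrite -mulrA !PsiE !(mx_homM Fh) FE mul1mx.
- by rewrite -[X in Psi _ _ _ X]mulr1 PsiE (mx_hom1 Fh).
- by exists (G M) => //; rewrite EG PhiE.
- by rewrite PsiE PhiE GF.
- by rewrite PhiE -EG PsiE GK.
Qed.

Lemma YH_iso :
  corner_alg_iso (1 : Y) prod_Mat_scale (Psi_n xi pi) (Phi_n xi pi).
Proof.
have ci mu := (component_iso mu).2.2.1; have EPhi mu := (component_iso mu).2.2.2.
have Ec mu a : corner (Emu xi pi mu) (Emu xi pi mu * a) by exists a.
split=> [x y _ _|c x _|x y _ _||M|x _|M].
- apply: functional_extensionality_dep => mu; rewrite /Psi_n mulrDr.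
  exact: (cisoD (ci mu)).
- apply: functional_extensionality_dep => mu; rewrite /Psi_n -scalerAr.
  exact: (cisoZ (ci mu)).
- apply: functional_extensionality_dep => mu; rewrite /Psi_n.
  (* Multiplicativity is read on F, a morphism on all of Y with F a = [Psi] (E_mu a). *)
  have [F [G [[Fh FE GK GF] [EG tI cU cV]]]] := component_ex mu.
  have PE a : Psi xi pi mu (Emu xi pi mu * a) = F a.
    by apply: (@map_toHv_inj mu); rewrite (component_iso mu).1 -cU.
  rewrite [RHS]/(Psi xi pi mu (Emu xi pi mu * x) *m Psi xi pi mu (Emu xi pi mu * y)).
  by rewrite !PE (mx_homM Fh).
- apply: functional_extensionality_dep => mu; rewrite /Psi_n mulr1.
  exact: (ciso1 (ci mu)).
- by exists (Phi_n xi pi M) => //; rewrite mul1r.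
- rewrite /Phi_n -[RHS]mul1r -Emu_sum mulr_suml; apply: eq_bigr => mu _.
  exact: (cisoK (ci mu)).
- apply: functional_extensionality_dep => mu; rewrite /Psi_n /Phi_n mulr_sumr.
  rewrite (bigD1 mu) //= big1 ?addr0 => [|mu' N].
    by rewrite EPhi; exact: (cisoVK (ci mu)).
  by rewrite -EPhi mulrA Emu_orth ?mul0r // eq_sym.
Qed.
End Decomposition.

Theorem theorem4p3 (R : realType) (d n : nat) (hd : (0 < d)%N) (hn : (0 < n)%N)
  (xi : d.-tuple R[i]) (xi_uniq : uniq xi) (xi_root : forall i, tnth xi i ^+ d = 1)
  (pi : forall mu : wcomp d n, 'I_(mnum mu) -> 'S_n)
  (pi_reps : forall mu, min_coset_reps (pi mu)) :
  injective (@toYv R[i] d n) /\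
  (forall mu : wcomp d n, injective (@toHv R[i] d n mu)) /\
  (forall mu : wcomp d n,
    (forall a : YH R[i] d n,
       map_mx (toHv mu) (Psi xi pi mu (Emu xi pi mu * a)) =
       Umu R[i] pi mu *m tPsi xi pi mu (toYv (Emu xi pi mu * a)) *m Umu_inv R[i] pi mu) /\
    (forall M : 'M[Hmu R[i] mu]_(mnum mu),
       toYv (Phi xi pi mu M) =
       tPhi xi pi mu (Umu_inv R[i] pi mu *m map_mx (toHv mu) M *m Umu R[i] pi mu)) /\
    corner_alg_iso (Emu xi pi mu) (fun c M => scmx c M) (Psi xi pi mu) (Phi xi pi mu)) /\
  corner_alg_iso (1 : YH R[i] d n) prod_Mat_scale (Psi_n xi pi) (Phi_n xi pi).
Proof.
have dC : d%:R != 0 :> R[i] by rewrite pnatr_eq0 -lt0n.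
split; first exact: (toYv_inj hd dC xi_uniq xi_root pi_reps).
split; first by move=> mu; exact: toHv_inj.
split=> [mu|]; last exact: (YH_iso hd dC xi_uniq xi_root pi_reps).
by have [PsiP [PhiP [iso _]]] := component_iso hd dC xi_uniq xi_root pi_reps mu.
Qed.
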